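(* Let $\zeta_{\mathrm{EZ},3}(s_1,s_2,s_3)$ be the meromorphic continuation to $\mathbb C^3$ of $$\sum_{0<n_1<n_2<n_3}n_1^{-s_1}n_2^{-s_2}n_3^{-s_3},$$ and put $t=s_2+s_3$, $w=s_1+s_2+s_3$. The singular hyperplanes of $\zeta_{\mathrm{EZ},3}$ are exactly $$s_3=1,\qquad t\in\{2,1,0,-2,-4,-6,\dots\},\qquad w\in\mathbb Z_{\le3}.$$ All are generically simple.
   Context: The sums run over positive integers $n_1,n_2,n_3$. A singular hyperplane is an irreducible component of the polar divisor; ''generically simple'' means that at a generic point of the hyperplane the pole is of order one. *)

(* Defs.v *)
From HB Require Import structures.
From mathcomp Require Import all_boot all_order all_algebra.
From mathcomp Require Import all_classical all_reals all_analysis.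
From mathcomp Require Import complex.

Set Implicit Arguments.
Unset Strict Implicit.
Unset Printing Implicit Defensive.

Import Order.TTheory GRing.Theory Num.Theory.
Import numFieldNormedType.Exports.

Local Open Scope classical_set_scope.
Local Open Scope ring_scope.

(* [R[i]] does not by itself carry the topology of a [numFieldType]; packing it
   as a [numClosedFieldType] makes the normed-module structures on [cplx R] and
   on ['rV[cplx R]_3] available, so that [differentiable] below is Frechet
   differentiability over the complex numbers. *)
Definition cplx (R : realType) : numClosedFieldType := R[i]%C.

Definition cplx3 (R : realType) := 'rV[cplx R]_3.

Definition s1 (R : realType) (s : cplx3 R) : cplx R := s 0 0.
Definition s2 (R : realType) (s : cplx3 R) : cplx R := s 0 1.
Definition s3 (R : realType) (s : cplx3 R) : cplx R := s 0 2.

(** * Holomorphic and meromorphic functions on C^3 *)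

Definition holomorphic (R : realType) (V : set (cplx3 R))
    (f : cplx3 R -> cplx R) : Prop :=
  forall z, V z -> differentiable f z.

(* A holomorphic function on [V] that vanishes identically on no nonempty open
   subset of [V]. *)
Definition denominator (R : realType) (V : set (cplx3 R))
    (h : cplx3 R -> cplx R) : Prop :=
  holomorphic V h /\ V `<=` closure [set z | h z != 0].

(* Equality as meromorphic functions: meromorphic functions are represented by
   total functions whose values on a thin analytic set carry no information. *)
Definition mero_eq (R : realType) (V : set (cplx3 R))
    (f g : cplx3 R -> cplx R) : Prop :=
  exists2 h, denominator V h & forall z, V z -> h z != 0 -> f z = g z.

Definition meromorphic (R : realType) (f : cplx3 R -> cplx R) : Prop :=
  forall p, exists (V : set (cplx3 R)) (g h : cplx3 R -> cplx R),
    [/\ open V, V p, holomorphic V g, denominator V h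
      & mero_eq V f (fun z => g z / h z)].

Definition regular_at (R : realType) (f : cplx3 R -> cplx R) (p : cplx3 R) :
    Prop :=
  exists (V : set (cplx3 R)) (g : cplx3 R -> cplx R),
    [/\ open V, V p, holomorphic V g & mero_eq V f g].

(* The support of the polar divisor. *)
Definition polar_set (R : realType) (f : cplx3 R -> cplx R) : set (cplx3 R) :=
  [set p | ~ regular_at f p].

(** * Analytic sets and their irreducible components *)

Definition analytic_set (R : realType) (A : set (cplx3 R)) : Prop :=
  forall p, exists (V : set (cplx3 R)) (m : nat)
      (F : 'I_m -> cplx3 R -> cplx R),
    [/\ open V, V p, forall i, holomorphic V (F i)
      & forall z, V z -> (A z <-> forall i, F i z = 0)].

Definition irreducible_analytic (R : realType) (A : set (cplx3 R)) : Prop :=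
  [/\ analytic_set A, A !=set0
    & forall B1 B2, analytic_set B1 -> analytic_set B2 ->
        A = B1 `|` B2 -> A = B1 \/ A = B2].

Definition irreducible_component (R : realType) (P Z : set (cplx3 R)) : Prop :=
  [/\ irreducible_analytic Z, Z `<=` P
    & forall Y, irreducible_analytic Y -> Y `<=` P -> Z `<=` Y -> Y = Z].

Definition polar_component (R : realType) (f : cplx3 R -> cplx R)
    (Z : set (cplx3 R)) : Prop :=
  irreducible_component (polar_set f) Z.

(** * Order of a pole *)

(* Near [p], [Z] is the smooth hypersurface [u = 0] with [du(p) <> 0], and
   [f = g / u ^ m] with [g] holomorphic and [g p <> 0]. *)
Definition pole_of_order_at (R : realType) (f : cplx3 R -> cplx R)
    (Z : set (cplx3 R)) (m : nat) (p : cplx3 R) : Prop :=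
  exists (V : set (cplx3 R)) (u g : cplx3 R -> cplx R),
    [/\ open V /\ V p, holomorphic V u /\ holomorphic V g,
        (forall z, V z -> (Z z <-> u z = 0)) /\ (exists v, 'd u p v <> 0),
        g p != 0
      & mero_eq V f (fun z => g z / u z ^+ m)].

(* A generic point of an irreducible [Z] is a point outside some analytic set
   that does not contain [Z]. *)
Definition generically_simple (R : realType) (f : cplx3 R -> cplx R)
    (Z : set (cplx3 R)) : Prop :=
  exists A, [/\ analytic_set A, ~ (Z `<=` A)
    & forall p, Z p -> ~ A p -> pole_of_order_at f Z 1 p].

(** * The Euler-Zagier triple zeta function *)

Definition cexp (R : realType) (z : cplx R) : cplx R :=
  let a := complex.Re z in let b := complex.Im z in
  ((expR a * cos b) +i* (expR a * sin b))%C.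

(* [n ^ (- s)] for a positive integer [n]. *)
Definition npowN (R : realType) (n : nat) (s : cplx R) : cplx R :=
  cexp (- s * (ln n%:R)%:C%C).

Definition ez3_term (R : realType) (s : cplx3 R) (n1 n2 n3 : nat) : cplx R :=
  npowN n1 (s1 s) * npowN n2 (s2 s) * npowN n3 (s3 s).

Definition ez3_abs_convergent (R : realType) (s : cplx3 R) : Prop :=
  summable [set n : nat * nat * nat | (0 < n.1.1 < n.1.2)%N /\ (n.1.2 < n.2)%N]
    (fun n => (complex.Re `|ez3_term s n.1.1 n.1.2 n.2|)%:E).

Definition ez3_partial_sum (R : realType) (s : cplx3 R) (N : nat) : cplx R :=
  \sum_(1 <= n3 < N) \sum_(1 <= n2 < n3) \sum_(1 <= n1 < n2)
    ez3_term s n1 n2 n3.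

Definition ez3_continuation (R : realType) (f : cplx3 R -> cplx R) : Prop :=
  meromorphic f /\
  forall s, ez3_abs_convergent s -> ez3_partial_sum s N @[N --> \oo] --> f s.

(* Main.v *)
(** Euler-Maclaurin summation over [n_3], then over [n_2], then over [n_1], writes
    [zeta], up to a remainder that is holomorphic on a large ball after multiplication
    by the linear factors, as a finite combination of products of
    [B_k (s_3)_{k-1} / k!], [B_j (t - 1 + k)_{j-1} / j!] and [zeta (w - 2 + k + j)],
    where [(s)_{-1} = 1 / (s - 1)].
    Hence the only possible poles are [s_3 = 1], [t = 2 - k] with [B_k <> 0], and
    [w = 3 - l] with [l = k + j], all of order one. By uniqueness of continuation this
    holds for every meromorphic continuation of the series.

    Each of these hyperplanes is polar because the numerator is nonzero at one of its
    points: [(1, 1, 1)] for [s_3 = 1]; [(1, -k, 2)] for [t = 2 - k], and also for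
    [w = 3 - k] when [B_k <> 0]; and [(-l, 1, 2)] for [w = 3 - l] with [l >= 3] odd,
    where only [(k, j) = (1, l - 1)] and [(l - 1, 1)] contribute, with the same sign.

    An irreducible analytic set contained in a locally finite union of hyperplanes lies
    in one of them, so these hyperplanes are the irreducible components of the polar
    set. *)

Require Import Defs.
From HB Require Import structures.
From mathcomp Require Import all_boot all_order all_algebra.
From mathcomp Require Import all_classical all_reals all_analysis.
From mathcomp Require Import complex.
From mathcomp Require Import ring lra zify.

Import Order.TTheory GRing.Theory Num.Theory.
Import numFieldNormedType.Exports.

Local Open Scope classical_set_scope.
Local Open Scope ring_scope.

(** * Holomorphic functions *)

(** Holomorphy here is complex differentiability at each point and nothing more. The function theory
    is built on that alone: bisection of rectangles gives the mean value property, this gives the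
    maximum principle, and the latter, applied to quotients by powers of [z - c], gives the identity
    theorem and Cauchy's estimate. Several variables enter through complex lines.

    Infinitely many hyperplanes are polar, but only finitely many meet a given ball, and an
    Euler-Maclaurin order growing linearly with the radius makes all remainders converge there;
    hence the exhaustion by balls. Clearing all linear factors makes every term holomorphic, and at
    a point where several factors vanish most terms disappear. The test points are chosen so that
    the surviving terms involve [(a - 1) zeta (a)] at [a = 1] only, and every remainder is either
    multiplied by a vanishing factor or taken at exponent [1], where it is [0]. Such a point may lie
    on several hyperplanes, so it is not generic; it is joined by a complex line inside the
    hyperplane to a second point lying on no other one. *)

Section Goursat.
Context {R : realType}.
Implicit Types (f : R -> R) (P Q : R -> R -> R).

Definition segint f (a b : R) : R :=
  \int[@lebesgue_measure R]_(x in `[a, b]) f x.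

Lemma segint_integrable f (a b : R) :
  (forall x, a <= x <= b -> {for x, continuous f}) ->
  (@lebesgue_measure R).-integrable `[a, b] (EFin \o f).
Proof.
move=> cf; apply: continuous_compact_integrable; first exact: segment_compact.
apply: continuous_in_subspaceT => x; rewrite inE /= in_itv /= => xab.
exact: cf.
Qed.

Lemma segint_cat f (a b c : R) : a <= c <= b ->
  (forall x, a <= x <= b -> {for x, continuous f}) ->
  segint f a b = segint f a c + segint f c b.
Proof.
move=> /andP[ac cb] cf.
have int := segint_integrable _ _ _ cf.
have /(@Rintegral_itvB R f (BLeft a) (BRight b) c) := int.
rewrite !bnd_simp => /(_ ac cb) E.
rewrite /segint -[LHS](subrK (segint f a c)) E addrC; congr (_ + _).
apply: Rintegral_itv_obnd_cbnd.
apply: integrableS int => //; apply: subset_itv; rewrite bnd_simp //.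
Qed.

Lemma segint_affine (u v a b : R) : a <= b ->
  segint (fun x => u + v * x) a b = u * (b - a) + v * (b ^+ 2 - a ^+ 2) / 2.
Proof.
rewrite le_eqVlt => /predU1P[->|ab].
  rewrite /segint set_itv1 Rintegral_set1; ring.
pose F x : R := u * x + v * x ^+ 2 / 2.
have dF (x : R) : is_derive x 1 F (u + v * x).
  by rewrite /F; apply: is_derive_eq; rewrite /= /GRing.scale /=; field.
have cF : continuous F.
  by move=> x; apply: differentiable_continuous; apply/derivable1_diffP; case: (dF x).
rewrite /segint /Rintegral (@continuous_FTC2 _ _ F a b) //=; first by rewrite /F; field.
- apply: continuous_subspaceT => x.
  apply: (@continuousD _ R^o) => //; first exact: cst_continuous.
  by apply: continuousM => //; exact: cst_continuous.
- split.
  + by move=> x _; case: (dF x).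
  + by apply: cvg_at_right_filter; exact: cF.
  + by apply: cvg_at_left_filter; exact: cF.
- by move=> x _; rewrite derive1E; case: (dF x).
Qed.

Lemma segint_near_affine f (u v e a b : R) : a <= b ->
  (forall x, a <= x <= b -> {for x, continuous f}) ->
  (forall x, a <= x <= b -> `|f x - (u + v * x)| <= e) ->
  `|segint f a b - (u * (b - a) + v * (b ^+ 2 - a ^+ 2) / 2)| <= e * (b - a).
Proof.
move=> ab cf fe.
have aff (u0 v0 : R) x : {for x, continuous (fun x => u0 + v0 * x)}.
  apply: (@continuousD _ R^o) => //; first exact: cst_continuous.
  by apply: continuousM => //; exact: cst_continuous.
have up : segint f a b <= segint (fun x => (u + e) + v * x) a b.
  apply: le_Rintegral => //; try exact: segint_integrable.
  move=> x /=; rewrite in_itv /= => /fe; rewrite ler_norml => /andP[]; lra.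
have lo : segint (fun x => (u - e) + v * x) a b <= segint f a b.
  apply: le_Rintegral => //; try exact: segint_integrable.
  move=> x /=; rewrite in_itv /= => /fe; rewrite ler_norml => /andP[]; lra.
move: up lo; rewrite !segint_affine // ler_norml => up lo; apply/andP; split; nra.
Qed.

Lemma segint_le f (u a b : R) : a <= b ->
  (forall x, a <= x <= b -> {for x, continuous f}) ->
  (forall x, a <= x <= b -> f x <= u) -> segint f a b <= u * (b - a).
Proof.
move=> ab cf fu.
have -> : u * (b - a) = segint (fun x => u + 0 * x) a b.
  by rewrite segint_affine // !mul0r addr0.
apply: le_Rintegral => //; try exact: segint_integrable.
  apply: segint_integrable => x _.
  rewrite (_ : (fun _ => _) = cst u); first exact: cst_continuous.
  by apply/funext => y; rewrite mul0r addr0.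
by move=> x /=; rewrite in_itv /= mul0r addr0 => /fu.
Qed.

Lemma nested_intervals (u v : nat -> R) :
  (forall n, u n <= u n.+1) -> (forall n, v n.+1 <= v n) ->
  (forall n, u n <= v n) -> exists x, forall n, u n <= x <= v n.
Proof.
move=> u_nd v_ni uv.
have uh m k : u m <= u (m + k)%N.
  by elim: k => [|k IH]; rewrite ?addn0 ?addnS // (le_trans IH).
have vh m k : v (m + k)%N <= v m.
  by elim: k => [|k IH]; rewrite ?addn0 ?addnS // (le_trans _ IH).
have uvm n m : u m <= v n.
  by rewrite (le_trans (uh m n)) // (le_trans (uv _)) // addnC.
have ub n : ubound (range u) (v n) by move=> _ [m _ <-].
exists (sup (range u)) => n; apply/andP; split.
  by apply: ub_le_sup; [exists (v 0%N) | exists n].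
by apply: ge_sup => //; exists (u 0%N); exists 0%N.
Qed.

(* The closedness condition [dP/dy = dQ/dx = be] at a point, with no
   continuity of the partial derivatives. *)
Definition closed_form_at P Q (x0 y0 : R) :=
  exists al be ga : R, forall e : R, 0 < e -> exists2 d : R, 0 < d &
    forall x y, `|x - x0| <= d -> `|y - y0| <= d ->
      `|P x y - (P x0 y0 + al * (x - x0) + be * (y - y0))|
         <= e * (`|x - x0| + `|y - y0|) /\
      `|Q x y - (Q x0 y0 + be * (x - x0) + ga * (y - y0))|
         <= e * (`|x - x0| + `|y - y0|).

Lemma linear_bound_continuous f (x0 A d : R) : 0 < d -> 0 <= A ->
  (forall x, `|x - x0| <= d -> `|f x - f x0| <= A * `|x - x0|) ->
  {for x0, continuous f}.
Proof.
move=> d0 A0 fA; apply/cvgrPdist_le => e e0.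
have d'0 : 0 < Num.min d (e / (A + 1)).
  by rewrite lt_min d0 divr_gt0 // ltr_wpDl.
near=> x; rewrite distrC.
have : `|x0 - x| <= Num.min d (e / (A + 1)).
  by near: x; apply: cvgr_dist_le => //; exact: cvg_id.
rewrite (distrC x0) le_min => /andP[xd xe].
rewrite (le_trans (fA _ xd)) // (le_trans (ler_wpM2l A0 xe)) //.
rewrite mulrA ler_pdivrMr ?ltr_wpDl // mulrC ler_wpM2l // ?ltW //; lra.
Unshelve. all: by end_near. Qed.

Lemma closed_form_continuous P Q (x0 y0 : R) : closed_form_at P Q x0 y0 ->
  {for x0, continuous (P^~ y0)} /\ {for y0, continuous (Q x0)}.
Proof.
move=> [al [be [ga H]]]; have [d d0 Hd] := H 1 ltr01; split.
- apply: (@linear_bound_continuous _ _ (`|al| + 1) d) => //.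
  move=> x xd; have [] := Hd x y0 xd; first by rewrite subrr normr0 ltW.
  rewrite subrr normr0 mulr0 !addr0 mul1r => + _.
  rewrite opprD addrA mulrDl mul1r => h.
  have -> : P x y0 - P x0 y0 = (P x y0 - P x0 y0 - al * (x - x0)) + al * (x - x0)
    by ring.
  by rewrite (le_trans (ler_normD _ _)) // addrC lerD // normrM.
- apply: (@linear_bound_continuous _ _ (`|ga| + 1) d) => //.
  move=> y yd; have [|_] := Hd x0 y _ yd; first by rewrite subrr normr0 ltW.
  rewrite subrr normr0 mulr0 !addr0 add0r mul1r.
  rewrite opprD addrA mulrDl mul1r => h.
  have -> : Q x0 y - Q x0 y0 = (Q x0 y - Q x0 y0 - ga * (y - y0)) + ga * (y - y0)
    by ring.
  by rewrite (le_trans (ler_normD _ _)) // addrC lerD // normrM.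
Qed.

(** The integral of [P dx + Q dy] along the boundary of [[a, b] x [c, d]], counterclockwise. *)
Definition circulation P Q (a b c d : R) : R :=
  segint (Q b) c d - segint (Q a) c d - segint (P^~ d) a b + segint (P^~ c) a b.

Lemma circulation_quarters P Q (a m b c n d : R) :
  a <= m <= b -> c <= n <= d ->
  (forall x y, a <= x <= b -> c <= y <= d -> closed_form_at P Q x y) ->
  circulation P Q a b c d =
    circulation P Q a m c n + circulation P Q m b c n +
    circulation P Q a m n d + circulation P Q m b n d.
Proof.
move=> amb cnd H; have := amb; have := cnd.
move=> /andP[cn nd] /andP[am mb]; rewrite /circulation.
have cQ x : a <= x <= b -> segint (Q x) c d = segint (Q x) c n + segint (Q x) n d.
  move=> xab; apply: segint_cat => // y ycd.
  by have [] := closed_form_continuous _ _ _ _ (H x y xab ycd).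
have cP y : c <= y <= d ->
    segint (P^~ y) a b = segint (P^~ y) a m + segint (P^~ y) m b.
  move=> ycd; apply: segint_cat => // x xab.
  by have [] := closed_form_continuous _ _ _ _ (H x y xab ycd).
rewrite !cQ ?cP; first ring.
all: by apply/andP; split; lra.
Qed.

(** The affine parts of [P] and [Q] share the mixed coefficient [be], so their circulation is [0].
    What remains is the error: at most [e] times the half perimeter on each side, integrated over
    the whole perimeter. *)
Lemma circulation_small P Q (x0 y0 al be ga e a b c d : R) : 0 <= e ->
  a <= x0 <= b -> c <= y0 <= d ->
  (forall x y, a <= x <= b -> c <= y <= d -> closed_form_at P Q x y) ->
  (forall x y, a <= x <= b -> c <= y <= d ->
      `|P x y - (P x0 y0 + al * (x - x0) + be * (y - y0))|
         <= e * (`|x - x0| + `|y - y0|) /\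
      `|Q x y - (Q x0 y0 + be * (x - x0) + ga * (y - y0))|
         <= e * (`|x - x0| + `|y - y0|)) ->
  `|circulation P Q a b c d| <= 2 * e * (b - a + (d - c)) ^+ 2.
Proof.
move=> e0 /andP[ax xb] /andP[cy yd] H hD.
have ab : a <= b by lra. have cd : c <= d by lra.
have small x y : a <= x <= b -> c <= y <= d ->
    e * (`|x - x0| + `|y - y0|) <= e * (b - a + (d - c)).
  move=> /andP[? ?] /andP[? ?]; apply: ler_wpM2l => //; apply: lerD;
  rewrite ler_norml; apply/andP; split; lra.
have hQ x : a <= x <= b ->
    `|segint (Q x) c d - ((Q x0 y0 + be * (x - x0) - ga * y0) * (d - c)
       + ga * (d ^+ 2 - c ^+ 2) / 2)| <= e * (b - a + (d - c)) * (d - c).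
  move=> xab; apply: segint_near_affine => // y ycd.
    by have [] := closed_form_continuous _ _ _ _ (H x y xab ycd).
  have [_] := hD x y xab ycd => h.
  apply: le_trans (small x y xab ycd).
  by apply: etrans h; congr (`| _ | <= _); ring.
have hP y : c <= y <= d ->
    `|segint (P^~ y) a b - ((P x0 y0 + be * (y - y0) - al * x0) * (b - a)
       + al * (b ^+ 2 - a ^+ 2) / 2)| <= e * (b - a + (d - c)) * (b - a).
  move=> ycd; apply: segint_near_affine => // x xab.
    by have [] := closed_form_continuous _ _ _ _ (H x y xab ycd).
  have [h _] := hD x y xab ycd.
  apply: le_trans (small x y xab ycd).
  by apply: etrans h; congr (`| _ | <= _); ring.
have aab : a <= a <= b by rewrite lexx ab.
have bab : a <= b <= b by rewrite lexx ab.
have ccd : c <= c <= d by rewrite lexx cd.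
have dcd : c <= d <= d by rewrite lexx cd.
move: (hQ _ aab) (hQ _ bab) (hP _ ccd) (hP _ dcd); rewrite /circulation.
move: (segint _ _ _) (segint _ _ _) (segint _ _ _) (segint _ _ _) => i1 i2 i3 i4.
rewrite !ler_norml => /andP[? ?] /andP[? ?] /andP[? ?] /andP[? ?].
by apply/andP; split; lra.
Qed.

(** Goursat's bisection. Among the quarters of a rectangle one carries at least a quarter of the
    circulation, so the [n]-th rectangle carries at least [eta / 4 ^ n], while [circulation_small]
    at the common point makes it [o(4 ^ -n)]. *)
Theorem circulation_eq0 P Q (a c w h : R) : 0 <= w -> 0 <= h ->
  (forall x y, a <= x <= a + w -> c <= y <= c + h -> closed_form_at P Q x y) ->
  circulation P Q a (a + w) c (c + h) = 0.
Proof.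
move=> w0 h0 H.
pose wn n : R := w / 2 ^+ n; pose hn n : R := h / 2 ^+ n.
have wS n : wn n = wn n.+1 + wn n.+1.
  by rewrite /wn exprS; field; rewrite expf_neq0.
have hS n : hn n = hn n.+1 + hn n.+1.
  by rewrite /hn exprS; field; rewrite expf_neq0.
have wn0 n : 0 <= wn n by rewrite divr_ge0 // exprn_ge0.
have hn0 n : 0 <= hn n by rewrite divr_ge0 // exprn_ge0.
pose rc n (p : R * R) := circulation P Q p.1 (p.1 + wn n) p.2 (p.2 + hn n).
pose good n (p q : R * R) := `|rc n p| <= 4 * `|rc n.+1 q|.
(* The last quarter is taken without a test: when the other three fail, the triangle inequality
   makes it succeed. *)
pose nxt n (p : R * R) : R * R :=
  if good n p p then p
  else if good n p (p.1 + wn n.+1, p.2) then (p.1 + wn n.+1, p.2)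
  else if good n p (p.1, p.2 + hn n.+1) then (p.1, p.2 + hn n.+1)
  else (p.1 + wn n.+1, p.2 + hn n.+1).
pose p := fix p n := if n is m.+1 then nxt m (p m) else (a, c).
have nxt1 n q : q.1 <= (nxt n q).1 <= q.1 + wn n.+1.
  by rewrite /nxt; case: ifP => _; [|case: ifP => _; [|case: ifP => _]] => /=;
     have := wn0 n.+1; move=> ?; apply/andP; split; lra.
have nxt2 n q : q.2 <= (nxt n q).2 <= q.2 + hn n.+1.
  by rewrite /nxt; case: ifP => _; [|case: ifP => _; [|case: ifP => _]] => /=;
     have := hn0 n.+1; move=> ?; apply/andP; split; lra.
have p1S n : (p n).1 <= (p n.+1).1 by have /andP[] := nxt1 n (p n).
have p2S n : (p n).2 <= (p n.+1).2 by have /andP[] := nxt2 n (p n).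
have p1W n : (p n.+1).1 + wn n.+1 <= (p n).1 + wn n.
  by rewrite (wS n); have /andP[_] := nxt1 n (p n) => /=; lra.
have p2W n : (p n.+1).2 + hn n.+1 <= (p n).2 + hn n.
  by rewrite (hS n); have /andP[_] := nxt2 n (p n) => /=; lra.
have p1i n : a <= (p n).1 /\ (p n).1 + wn n <= a + w.
  elim: n => [|n [i1 i2]]; first by rewrite /= /wn expr0 divr1.
  by have := p1S n; have := p1W n; split; lra.
have p2i n : c <= (p n).2 /\ (p n).2 + hn n <= c + h.
  elim: n => [|n [i1 i2]]; first by rewrite /= /hn expr0 divr1.
  by have := p2S n; have := p2W n; split; lra.
have step n : good n (p n) (p n.+1).
  have E : rc n (p n) = rc n.+1 (p n) + rc n.+1 ((p n).1 + wn n.+1, (p n).2) +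
      rc n.+1 ((p n).1, (p n).2 + hn n.+1) +
      rc n.+1 ((p n).1 + wn n.+1, (p n).2 + hn n.+1).
    have [? ?] := p1i n; have [? ?] := p2i n.
    have := wn0 n.+1; have := hn0 n.+1; have := wS n; have := hS n => ? ? ? ?.
    rewrite /rc (wS n) (hS n) /= (addrA (p n).1) (addrA (p n).2).
    rewrite (@circulation_quarters P Q _ ((p n).1 + wn n.+1) _ _
      ((p n).2 + hn n.+1)) //; last first.
      by move=> x y /andP[? ?] /andP[? ?]; apply: H; apply/andP; split; lra.
      by apply/andP; split; lra.
    by apply/andP; split; lra.
  rewrite /= /nxt; case: ifP => // g1; case: ifP => // g2; case: ifP => // g3.
  move: g1 g2 g3; rewrite /good E.
  move: (rc n.+1 _) (rc n.+1 _) (rc n.+1 _) (rc n.+1 _) => r4 r3 r2 r1.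
  move=> /negbT; rewrite -ltNge => g1 /negbT; rewrite -ltNge => g2.
  move=> /negbT; rewrite -ltNge => g3.
  have := ler_normD (r1 + r2 + r3) r4; have := ler_normD (r1 + r2) r3.
  have := ler_normD r1 r2; lra.
have [x0 hx0] := nested_intervals (fun n => (p n).1) (fun n => (p n).1 + wn n)
  p1S p1W (fun n => ler_wpDr (wn0 n) (lexx _)).
have [y0 hy0] := nested_intervals (fun n => (p n).2) (fun n => (p n).2 + hn n)
  p2S p2W (fun n => ler_wpDr (hn0 n) (lexx _)).
apply/eqP; rewrite -normr_le0 leNgt; apply/negP => eta0.
set eta := `|_| in eta0.
have grow n : eta <= 4 ^+ n * `|rc n (p n)|.
  elim: n => [|n IH]; first by rewrite expr0 mul1r /rc /wn /hn /= !expr0 !divr1.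
  rewrite (le_trans IH) // exprSr -mulrA ler_wpM2l ?exprn_ge0 //; exact: step.
have [||al [be [ga Hd]]] := H x0 y0.
- by have := hx0 0%N; rewrite /wn /= expr0 divr1.
- by have := hy0 0%N; rewrite /hn /= expr0 divr1.
(* With this [e] one has [2 e (w + h) ^ 2 < eta]; the [+ 1] keeps the denominator positive for a
   degenerate rectangle. *)
pose e := eta / (4 * (w + h + 1) ^+ 2).
have e0 : 0 < e by rewrite divr_gt0 // mulr_gt0 // exprn_gt0 //; lra.
have [d d0 hd] := Hd e e0.
have [n nd] : exists n, (w + h) / 2 ^+ n <= d.
  have q0 : 0 <= (w + h) / d by rewrite divr_ge0 ?addr_ge0 // ltW.
  exists (Num.bound ((w + h) / d)).
  rewrite ler_pdivrMr ?exprn_gt0 // mulrC -ler_pdivrMr //.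
  rewrite (le_trans (ltW (archi_boundP q0))) // -natrX ler_nat.
  exact/ltnW/ltn_expl.
have : `|rc n (p n)| <= 2 * e * (wn n + hn n) ^+ 2.
  have [? ?] := p1i n; have [? ?] := p2i n.
  have -> : wn n + hn n = (p n).1 + wn n - (p n).1 + ((p n).2 + hn n - (p n).2).
    by ring.
  apply: (@circulation_small P Q x0 y0 al be ga e _ _ _ _ (ltW e0) (hx0 n) (hy0 n)).
  - move=> x y /andP[? ?] /andP[? ?]; apply: H; apply/andP; split; lra.
  - move=> x y /andP[? ?] /andP[? ?]; apply: hd.
    + have := hx0 n; have := hn0 n; move: nd; rewrite mulrDl -/(wn n) -/(hn n).
      move=> ? ? /andP[? ?]; rewrite ler_norml; apply/andP; split; lra.
    + have := hy0 n; have := wn0 n; move: nd; rewrite mulrDl -/(wn n) -/(hn n).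
      move=> ? ? /andP[? ?]; rewrite ler_norml; apply/andP; split; lra.
have /= gn := grow n; move=> rcn.
have : eta <= 2 * e * (w + h) ^+ 2.
  rewrite (le_trans gn) // (le_trans (ler_wpM2l _ rcn)) ?exprn_ge0 //.
  rewrite /wn /hn -mulrDl expr_div_n -exprM mulnC exprM mulrCA.
  by rewrite -[2 ^+ 2]natrX -[(2 ^ 2)%N]/4%N [4 ^+ n * _]mulrC divfK ?expf_neq0.
rewrite leNgt => /negP; apply.
have <- : e * (4 * (w + h + 1) ^+ 2) = eta.
  by rewrite /e divfK // mulf_neq0 // expf_neq0 // gt_eqF //; lra.
rewrite (mulrC 2) -mulrA ltr_pM2l //.
have := sqr_ge0 (w + h); have := addr_ge0 w0 h0.
by move: (w + h) => t t0 t2; rewrite sqrrD1; lra.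
Qed.

End Goursat.

(** * Real-valued norms and differentiability over the complex numbers *)

Section ComplexNorm.
Context {R : realType}.
Local Notation C := (cplx R).

Definition RtoC (x : R) : C := (x%:C)%C.

(** Norms of modules over [cplx R] are themselves elements of [cplx R]; [nrm] is the same number in
    [R], where the order is total and [lra] applies. *)
Definition nrm {E : normedModType C} (x : E) : R := complex.Re `|x|.

Lemma RtoC_def (x : C) : x \is Num.real -> RtoC (complex.Re x) = x.
Proof. exact: RRe_real. Qed.

Lemma RtoC_le (x y : R) : (RtoC x <= RtoC y) = (x <= y).
Proof. exact: lecR. Qed.

Lemma RtoC_lt (x y : R) : (RtoC x < RtoC y) = (x < y).
Proof. exact: ltcR. Qed.

Lemma RtoCD (x y : R) : RtoC (x + y) = RtoC x + RtoC y.
Proof. exact: rmorphD. Qed.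

Lemma RtoCN (x : R) : RtoC (- x) = - RtoC x.
Proof. exact: rmorphN. Qed.

Lemma RtoCM (x y : R) : RtoC (x * y) = RtoC x * RtoC y.
Proof. exact: rmorphM. Qed.

Lemma RtoC_nat (n : nat) : RtoC n%:R = n%:R.
Proof. exact: rmorph_nat. Qed.

Lemma RtoC0 : RtoC 0 = 0. Proof. by []. Qed.

Lemma RtoC1 : RtoC 1 = 1. Proof. by []. Qed.

Lemma RtoC_inj : injective RtoC. Proof. by move=> x y []. Qed.

Lemma pos_RtoC (e : C) : 0 < e -> exists2 d : R, 0 < d & e = RtoC d.
Proof.
move=> e0; exists (complex.Re e); first by move: e0; rewrite ltcE /= => /andP[].
by rewrite RtoC_def // gtr0_real.
Qed.

Section nrm.
Context {E : normedModType C}.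
Implicit Types x y : E.

Lemma nrmE x : `|x| = RtoC (nrm x).
Proof. by rewrite /nrm RtoC_def // normr_real. Qed.

Lemma nrm_ge0 x : 0 <= nrm x.
Proof. by rewrite -RtoC_le -nrmE normr_ge0. Qed.

Lemma nrm0 : nrm (0 : E) = 0.
Proof. by rewrite /nrm normr0. Qed.

Lemma nrm_eq0 x : (nrm x == 0) = (x == 0).
Proof. by rewrite -(normr_eq0 x) nrmE -RtoC0 (inj_eq RtoC_inj). Qed.

Lemma nrm_gt0 x : (0 < nrm x) = (x != 0).
Proof. by rewrite lt_def nrm_ge0 andbT nrm_eq0. Qed.

Lemma nrmN x : nrm (- x) = nrm x.
Proof. by rewrite /nrm normrN. Qed.

Lemma nrmB x y : nrm (x - y) = nrm (y - x).
Proof. by rewrite /nrm distrC. Qed.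

Lemma nrmD x y : nrm (x + y) <= nrm x + nrm y.
Proof. by rewrite -RtoC_le RtoCD -!nrmE ler_normD. Qed.

Lemma nrm_sub x y : nrm (x - y) <= nrm x + nrm y.
Proof. by rewrite -(nrmN y) nrmD. Qed.

Lemma nrm_dist x y : nrm x - nrm y <= nrm (x - y).
Proof. by rewrite lerBlDr -{1}(subrK y x) nrmD. Qed.

Lemma nrmZ (a : C) x : nrm (a *: x) = nrm a * nrm x.
Proof. by apply: RtoC_inj; rewrite RtoCM -!nrmE normrZ. Qed.

Lemma nrm_sum I (r : seq I) (P : pred I) (F : I -> E) :
  nrm (\sum_(i <- r | P i) F i) <= \sum_(i <- r | P i) nrm (F i).
Proof.
elim/big_ind2: _ => [|x a y b xa yb|//]; first by rewrite nrm0.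
by rewrite (le_trans (nrmD _ _)) // lerD.
Qed.

Lemma nrm_nbhsP (x : E) (A : set E) :
  nbhs x A <-> exists2 e : R, 0 < e & forall y, nrm (x - y) < e -> A y.
Proof.
split.
  move=> /nbhs_ballP[e /= /pos_RtoC[d d0 ->] H]; exists d => // y xy.
  by apply: H; rewrite -ball_normE /= nrmE RtoC_lt.
move=> [e e0 H]; apply/nbhs_ballP; exists (RtoC e); first by rewrite /= -RtoC0 RtoC_lt.
by move=> y; rewrite -ball_normE /= nrmE RtoC_lt => /H.
Qed.

Lemma nrm_openP (V : set E) : open V <->
  forall x, V x -> exists2 e : R, 0 < e & forall y, nrm (x - y) < e -> V y.
Proof.
rewrite openE; split => [H x /H /nrm_nbhsP //|H x /H].
by move=> h; apply/nrm_nbhsP.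
Qed.

Lemma nrm_cvgP T (F : set_system T) (FF : Filter F) (f : T -> E) (l : E) :
  f @ F --> l <-> forall e : R, 0 < e -> \forall t \near F, nrm (l - f t) <= e.
Proof.
split=> [/cvgrPdist_le H e e0|H].
  have : 0 < RtoC e by rewrite -RtoC0 RtoC_lt.
  by move=> /H; apply: filterS => t; rewrite nrmE RtoC_le.
apply/cvgrPdist_le => _ /pos_RtoC[d d0 ->].
by apply: filterS (H d d0) => t; rewrite nrmE RtoC_le.
Qed.

Lemma nrm_open_ball (x : E) (r : R) : open [set y | nrm (x - y) < r].
Proof.
apply/nrm_openP => y /= xy; exists (r - nrm (x - y)); first by rewrite subr_gt0.
move=> z; rewrite ltrBrDl; apply: le_lt_trans.
by rewrite (le_trans _ (nrmD _ _)) // addrA subrK.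
Qed.

End nrm.

Lemma nrmM (x y : C) : nrm (x * y) = nrm x * nrm y.
Proof. exact: nrmZ. Qed.

Lemma nrm1 : nrm (1 : C) = 1.
Proof. by apply: RtoC_inj; rewrite -nrmE normr1. Qed.

Lemma nrmX (x : C) n : nrm (x ^+ n) = nrm x ^+ n.
Proof. by elim: n => [|n IH]; rewrite ?expr0 ?nrm1 // !exprS nrmM IH. Qed.

Lemma nrmV (x : C) : nrm x^-1 = (nrm x)^-1.
Proof.
have [->|x0] := eqVneq x 0; first by rewrite invr0 nrm0 invr0.
apply: (mulfI (_ : nrm x != 0)); first by rewrite nrm_eq0.
by rewrite -nrmM !divff ?nrm1 // nrm_eq0.
Qed.

Lemma nrm_RtoC (x : R) : nrm (RtoC x) = `|x|.
Proof. by rewrite /nrm normc_def /= expr0n addr0 sqrtr_sqr. Qed.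

Lemma nrm_nat (n : nat) : nrm (n%:R : C) = n%:R.
Proof. by rewrite -RtoC_nat nrm_RtoC ger0_norm. Qed.

Lemma nrm_sqr (z : C) : nrm z ^+ 2 = complex.Re z ^+ 2 + complex.Im z ^+ 2.
Proof.
by rewrite /nrm normc_def /= sqr_sqrtr // addr_ge0 // sqr_ge0.
Qed.

Lemma Re_le_nrm (z : C) : `|complex.Re z| <= nrm z.
Proof.
rewrite -(@ler_pXn2r _ 2) ?nnegrE ?nrm_ge0 // nrm_sqr real_normK ?num_real //.
by rewrite lerDl sqr_ge0.
Qed.

Lemma Im_le_nrm (z : C) : `|complex.Im z| <= nrm z.
Proof.
rewrite -(@ler_pXn2r _ 2) ?nnegrE ?nrm_ge0 // nrm_sqr real_normK ?num_real //.
by rewrite lerDr sqr_ge0.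
Qed.

Lemma nrm_le_ReIm (z : C) : nrm z <= `|complex.Re z| + `|complex.Im z|.
Proof.
rewrite -(@ler_pXn2r _ 2) ?nnegrE ?nrm_ge0 ?addr_ge0 // nrm_sqr.
rewrite -[X in X + _ <= _]real_normK ?num_real //.
rewrite -[X in _ + X <= _]real_normK ?num_real // sqrrD lerD2r lerDl.
by rewrite mulrn_wge0 // mulr_ge0.
Qed.

Lemma ReD (x y : C) : complex.Re (x + y) = complex.Re x + complex.Re y.
Proof. by case: x y => a b [c d]. Qed.

Lemma ImD (x y : C) : complex.Im (x + y) = complex.Im x + complex.Im y.
Proof. by case: x y => a b [c d]. Qed.

Lemma ReN (x : C) : complex.Re (- x) = - complex.Re x.
Proof. by case: x. Qed.

Lemma ImN (x : C) : complex.Im (- x) = - complex.Im x.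
Proof. by case: x. Qed.

Lemma ReM (x y : C) : complex.Re (x * y) =
  complex.Re x * complex.Re y - complex.Im x * complex.Im y.
Proof. by case: x y => a b [c d]. Qed.

Lemma ImM (x y : C) : complex.Im (x * y) =
  complex.Re x * complex.Im y + complex.Im x * complex.Re y.
Proof. by case: x y => a b [c d]. Qed.

Lemma complex_ext (x y : C) :
  complex.Re x = complex.Re y -> complex.Im x = complex.Im y -> x = y.
Proof. by case: x y => a b [c d] /= -> ->. Qed.

Section differentiability.
Context {E F : normedModType C}.

Lemma nrm_continuousP (f : E -> F) (x : E) : {for x, continuous f} <->
  forall e : R, 0 < e -> exists2 d : R, 0 < d &
    forall y, nrm (x - y) < d -> nrm (f x - f y) <= e.
Proof.
split=> [cf e e0|H].
  have [d d0 hd] := (nrm_nbhsP _ _).1 ((nrm_cvgP _ _ _ _ _).1 cf e e0).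
  by exists d.
apply/nrm_cvgP => e e0; apply/nrm_nbhsP.
by have [d d0 hd] := H e e0; exists d.
Qed.

Lemma differentiable_bound (f : E -> F) (x : E) : differentiable f x ->
  forall e : R, 0 < e -> exists2 d : R, 0 < d &
    forall h, nrm h < d -> nrm (f (x + h) - f x - 'd f x h) <= e * nrm h.
Proof.
move=> df e e0; have [_ /eqaddoP H] := (diff_locallyP _ _).1 df.
have : 0 < RtoC e by rewrite -RtoC0 RtoC_lt.
move=> /H /nrm_nbhsP[d d0 hd]; exists d => // h hh.
have := hd h; rewrite sub0r nrmN => /(_ hh).
by rewrite !nrmE -RtoCM RtoC_le /= !fctE /= opprD addrA (addrC h).
Qed.

Lemma bound_differentiable (f : E -> F) (df : {linear E -> F}) (x : E) :
  continuous df ->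
  (forall e : R, 0 < e -> exists2 d : R, 0 < d &
    forall h, nrm h < d -> nrm (f (x + h) - f x - df h) <= e * nrm h) ->
  differentiable f x /\ 'd f x = df :> (E -> F).
Proof.
move=> cdf H.
have E1 : f \o shift x = cst (f x) + df +o_ 0 id.
  apply/eqaddoP => _ /pos_RtoC[e e0 ->].
  have [d d0 hd] := H e e0; apply/nrm_nbhsP; exists d => // h.
  rewrite sub0r nrmN => /hd; rewrite !nrmE -RtoCM RtoC_le /= !fctE.
  by rewrite opprD addrA (addrC h).
have D := diff_unique cdf E1.
by split=> //; apply/diff_locallyP; rewrite D.
Qed.

End differentiability.

Section holomorphic_algebra.
Context {E : normedModType C}.
Implicit Types (f g : E -> C) (x : E).

Lemma cont_cst (c : C) x : {for x, continuous (fun _ : E => c)}.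
Proof. exact: cst_continuous. Qed.

Lemma contD f g x : {for x, continuous f} -> {for x, continuous g} ->
  {for x, continuous (fun z => f z + g z)}.
Proof. by move=> cf cg; exact: (@cvgD C C E (nbhs x) _ f g _ _ cf cg). Qed.

Lemma contB f g x : {for x, continuous f} -> {for x, continuous g} ->
  {for x, continuous (fun z => f z - g z)}.
Proof. by move=> cf cg; exact: (@cvgB C C E (nbhs x) _ f g _ _ cf cg). Qed.

Lemma contM f g x : {for x, continuous f} -> {for x, continuous g} ->
  {for x, continuous (fun z => f z * g z)}.
Proof. by move=> cf cg; exact: (@cvgM C E (nbhs x) _ f g _ _ cf cg). Qed.

Lemma holo_cont f x : differentiable f x -> {for x, continuous f}.
Proof. exact: differentiable_continuous. Qed.

Lemma holo_cst (c : C) x : differentiable (fun _ : E => c) x.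
Proof. exact: differentiable_cst. Qed.

Lemma holoD f g x : differentiable f x -> differentiable g x ->
  differentiable (fun z => f z + g z) x.
Proof. exact: differentiableD. Qed.

Lemma holoN f x : differentiable f x -> differentiable (fun z => - f z) x.
Proof. exact: differentiableN. Qed.

Lemma holoB f g x : differentiable f x -> differentiable g x ->
  differentiable (fun z => f z - g z) x.
Proof. exact: differentiableB. Qed.

Lemma holoM f g x : differentiable f x -> differentiable g x ->
  differentiable (fun z => f z * g z) x.
Proof. exact: differentiableM. Qed.

Lemma holoV f x : differentiable f x -> f x != 0 ->
  differentiable (fun z => (f z)^-1) x.
Proof. by move=> df f0; exact: differentiableV. Qed.

Lemma holo_div f g x : differentiable f x -> differentiable g x -> g x != 0 ->
  differentiable (fun z => f z / g z) x.
Proof. by move=> df dg g0; apply: holoM => //; exact: holoV. Qed.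

Lemma holo_sum (I : Type) (r : seq I) (P : pred I) (f : I -> E -> C) x :
  (forall i, P i -> differentiable (f i) x) ->
  differentiable (fun z => \sum_(i <- r | P i) f i z) x.
Proof.
move=> df; elim: r => [|i r IH].
  rewrite (_ : (fun z => _) = fun=> 0); first exact: holo_cst.
  by apply/funext => z; rewrite big_nil.
case Pi : (P i); last first.
  rewrite (_ : (fun z => _) = fun z => \sum_(j <- r | P j) f j z) //.
  by apply/funext => z; rewrite big_cons Pi.
rewrite (_ : (fun z => _) = fun z => f i z + \sum_(j <- r | P j) f j z); last first.
  by apply/funext => z; rewrite big_cons Pi.
by apply: holoD => //; exact: df.
Qed.

Lemma holo_prod (I : Type) (r : seq I) (P : pred I) (f : I -> E -> C) x :
  (forall i, P i -> differentiable (f i) x) ->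
  differentiable (fun z => \prod_(i <- r | P i) f i z) x.
Proof.
move=> df; elim: r => [|i r IH].
  rewrite (_ : (fun z => _) = fun=> 1); first exact: holo_cst.
  by apply/funext => z; rewrite big_nil.
case Pi : (P i); last first.
  rewrite (_ : (fun z => _) = fun z => \prod_(j <- r | P j) f j z) //.
  by apply/funext => z; rewrite big_cons Pi.
rewrite (_ : (fun z => _) = fun z => f i z * \prod_(j <- r | P j) f j z); last first.
  by apply/funext => z; rewrite big_cons Pi.
by apply: holoM => //; exact: df.
Qed.

Lemma holoX f n x : differentiable f x -> differentiable (fun z => f z ^+ n) x.
Proof.
move=> df; rewrite (_ : (fun z => _) = fun z => \prod_(i < n) f z).
  exact: holo_prod.
by apply/funext => z; rewrite prodr_const card_ord.
Qed.

End holomorphic_algebra.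
End ComplexNorm.

(** * The complex exponential and the mean value property *)

Section MeanValue.
Context {R : realType}.
Local Notation C := (cplx R).
Implicit Types (f g : C -> C) (z p : C).

Definition toC (x y : R) : C := (x +i* y)%C.

Lemma toC_eta z : toC (complex.Re z) (complex.Im z) = z.
Proof. by case: z. Qed.

Lemma diff_mulE f z h : 'd f z h = h * 'd f z 1.
Proof. by rewrite -[h in LHS]mulr1 [LHS](linearZZ _ h). Qed.

Lemma mulr_linear_lemma (c : C) : exists L : {linear C -> C},
  (forall h, L h = h * c) /\ continuous L.
Proof.
have lin : linear (fun h : C => h * c) by move=> k x y; rewrite mulrDl -scalerAl.
pose M := GRing.isLinear.Build _ _ _ _ _ lin.
pose L : {linear C -> C} := HB.pack (fun h : C => h * c) M.
by exists L; split => //= x; apply: mulrr_continuous.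
Qed.

Lemma bound_differentiableC f z (c : C) :
  (forall e : R, 0 < e -> exists2 d : R, 0 < d &
    forall h, nrm h < d -> nrm (f (z + h) - f z - h * c) <= e * nrm h) ->
  differentiable f z /\ 'd f z 1 = c.
Proof.
have [L [LE cL]] := mulr_linear_lemma c; move=> H.
have [|D ->] := bound_differentiable f L z cL.
  by move=> e /H[d d0 hd]; exists d => // h; rewrite LE; exact: hd.
by rewrite LE mul1r.
Qed.

Lemma derive_bound (f : R -> R) (x df : R) : is_derive x 1 f df ->
  forall e : R, 0 < e -> exists2 d : R, 0 < d &
    forall h, `|h| < d -> `|f (x + h) - f x - h * df| <= e * `|h|.
Proof.
move=> [D <-] e e0; have /derivable1_diffP Df := D.
have [_ /eqaddoP H] := (diff_locallyP _ _).1 Df.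
have /nbhs_ballP[d /= d0 hd] := H e e0; exists d => // h hh.
have := hd h; rewrite -ball_normE /= sub0r normrN => /(_ hh).
rewrite /= !fctE /= opprD addrA (addrC h); apply: etrans.
congr (`| _ - _ | <= _).
by rewrite deriveE // -[h in RHS]mulr1 [RHS](linearZZ _ h).
Qed.

Lemma cexpD z p : cexp (z + p) = cexp z * cexp p.
Proof.
case: z p => a b [c d]; rewrite /cexp /= expRD cosD sinD.
by apply: complex_ext; rewrite ?ReM ?ImM /=; ring.
Qed.

Lemma cexp0 : cexp (0 : C) = 1.
Proof. by rewrite /cexp /= expR0 cos0 sin0 !mul1r. Qed.

Lemma nrm_cexp z : nrm (cexp z) = expR (complex.Re z).
Proof.
apply/eqP; rewrite -(@eqrXn2 _ 2) ?nrm_ge0 ?expR_ge0 // nrm_sqr /cexp /=.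
by rewrite !exprMn -mulrDr cos2Dsin2 mulr1.
Qed.

Lemma cexp_neq0 z : cexp z != 0.
Proof. by rewrite -nrm_eq0 nrm_cexp gt_eqF // expR_gt0. Qed.

Lemma cexpN z : cexp (- z) = (cexp z)^-1.
Proof.
apply: (mulfI (cexp_neq0 z)); rewrite -cexpD subrr cexp0 divff //.
exact: cexp_neq0.
Qed.

(** Both components of [cexp h - 1 - h] are rearranged so that each term contains the deviation of a
    real [exp], [sin] or [cos] from its linear part, or is a product of two small quantities. *)
Lemma cexp_near0 (e : R) : 0 < e -> exists2 d : R, 0 < d &
  forall h : C, nrm h < d -> nrm (cexp h - 1 - h) <= e * nrm h.
Proof.
move=> e0.
(* The four pieces [t1] to [t4] below cost [2 + 1 + 3 + 2 = 8] times [e1 * n], within the allowance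
   of [16]. *)
have [e1 [e10 e1le e1e]] : exists e1 : R, [/\ 0 < e1, e1 <= 1 & 16 * e1 <= e].
  exists (Num.min 1 (e / 16)); rewrite lt_min ltr01 divr_gt0 // ge_min lexx.
  by split => //; rewrite mulrC -ler_pdivlMr // ge_min lexx orbT.
have [d1 d10 h1] := derive_bound _ _ _ (is_derive_expR 0) e1 e10.
have [d2 d20 h2] := derive_bound _ _ _ (is_derive_sin 0) e1 e10.
have [d3 d30 h3] := derive_bound _ _ _ (is_derive_cos 0) e1 e10.
exists (Num.min (Num.min d1 d2) (Num.min d3 e1)).
  by rewrite !lt_min d10 d20 d30 e10.
move=> h; rewrite !lt_min => /andP[/andP[H1 H2] /andP[H3 H4]].
have aR := Re_le_nrm h; have aI := Im_le_nrm h.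
set a := complex.Re h in aR *; set b := complex.Im h in aI *.
have := h1 a (le_lt_trans aR H1); have := h2 b (le_lt_trans aI H2).
have := h3 b (le_lt_trans aI H3).
rewrite !add0r expR0 sin0 cos0 !oppr0 mulr0 !mulr1 ?subr0 ?addr0 => h3' h2' h1'.
rewrite (le_trans (nrm_le_ReIm _)) //.
have -> : complex.Re (cexp h - 1 - h) =
    (1 + a) * (cos b - 1) + (expR a - 1 - a) * cos b.
  by rewrite !ReD !ReN /cexp /= -/a -/b; ring.
have -> : complex.Im (cexp h - 1 - h) =
    expR a * (sin b - b) + (expR a - 1) * b.
  by rewrite !ImD !ImN /cexp /= -/a -/b; ring.
set n := nrm h in aR aI H4 *.
have n0 : 0 <= n by exact: nrm_ge0.
have e1n : 0 <= e1 * n by rewrite mulr_ge0 // ltW.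
have e1a : e1 * `|a| <= e1 * n by rewrite ler_wpM2l // ltW.
have e1b : e1 * `|b| <= e1 * n by rewrite ler_wpM2l // ltW.
have t1 : `|(1 + a) * (cos b - 1)| <= 2 * (e1 * n).
  rewrite normrM ler_pM //; last exact: le_trans e1b.
  by rewrite (le_trans (ler_normD _ _)) // normr1; lra.
have t2 : `|(expR a - 1 - a) * cos b| <= e1 * n * 1.
  rewrite normrM ler_pM //; first exact: le_trans e1a.
  by rewrite ler_norml cos_geN1 cos_le1.
have ea : `|expR a - 1| <= `|a| + e1 * `|a|.
  by rewrite -[expR a - 1](subrK a) addrC (le_trans (ler_normD _ _)) // lerD2l.
have ea1 : e1 * `|a| <= 1 * `|a| by rewrite ler_wpM2r.
have t3 : `|expR a * (sin b - b)| <= 3 * (e1 * n).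
  rewrite normrM ler_pM //; last exact: le_trans e1b.
  by rewrite -[expR a](subrK 1) (le_trans (ler_normD _ _)) // normr1; lra.
have t4 : `|(expR a - 1) * b| <= 2 * e1 * n.
  by rewrite normrM ler_pM //; lra.
have := ler_normD ((1 + a) * (cos b - 1)) ((expR a - 1 - a) * cos b).
have := ler_normD (expR a * (sin b - b)) ((expR a - 1) * b).
have : 16 * e1 * n <= e * n by rewrite ler_wpM2r.
lra.
Qed.

Lemma cexp_diff z : differentiable (@cexp R) z /\ 'd (@cexp R) z 1 = cexp z.
Proof.
apply: bound_differentiableC => e e0.
have n0 : 0 < nrm (cexp z) by rewrite nrm_gt0 cexp_neq0.
have [d d0 hd] := cexp_near0 _ (divr_gt0 e0 n0); exists d => // h /hd H.
rewrite cexpD (_ : _ - _ = cexp z * (cexp h - 1 - h)); last by ring.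
by rewrite nrmM -ler_pdivlMl // mulrA (mulrC _ e).
Qed.

Lemma differentiable_cexp z : differentiable (@cexp R) z.
Proof. by case: (cexp_diff z). Qed.

(** The Cauchy-Riemann equations: with these [P] and [Q], the form [P dx + Q dy] is the imaginary
    part of [g dz]. The imaginary part is the useful one because on vertical segments it integrates
    [Re g]. *)
Lemma closed_form_holomorphic g (x0 y0 : R) : differentiable g (toC x0 y0) ->
  closed_form_at (fun x y => complex.Im (g (toC x y)))
                 (fun x y => complex.Re (g (toC x y))) x0 y0.
Proof.
move=> dg; set c := 'd g (toC x0 y0) 1.
exists (complex.Im c), (complex.Re c), (- complex.Im c) => e e0.
have [d d0 hd] := differentiable_bound _ _ dg e e0.
exists (d / 4); first by rewrite divr_gt0.
move=> x y xd yd; pose h := toC (x - x0) (y - y0).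
have xyE : toC x y = toC x0 y0 + h by apply: complex_ext; rewrite /= addrC subrK.
have hh : nrm h <= `|x - x0| + `|y - y0| by apply: nrm_le_ReIm.
have := hd h; rewrite -xyE diff_mulE -/c => /(_ ltac:(lra)).
move=> H; have {}H : nrm (g (toC x y) - g (toC x0 y0) - h * c) <=
    e * (`|x - x0| + `|y - y0|).
  by rewrite (le_trans H) // ler_wpM2l // ltW.
split; apply: le_trans H.
  rewrite [X in `|X|](_ : _ =
    complex.Im (g (toC x y) - g (toC x0 y0) - h * c)); first exact: Im_le_nrm.
  by rewrite !ImD !ImN ImM /=; ring.
rewrite [X in `|X|](_ : _ =
  complex.Re (g (toC x y) - g (toC x0 y0) - h * c)); first exact: Re_le_nrm.
by rewrite !ReD !ReN ReM /=; ring.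
Qed.

Definition circle p (r y : R) : C := p + cexp (toC (ln r) y).

Lemma nrm_circle p (r y : R) : 0 < r -> nrm (circle p r y - p) = r.
Proof. by move=> r0; rewrite addrC addKr nrm_cexp /= lnK. Qed.

Lemma circle_periodic f p (x : R) :
  f (p + cexp (toC x (2 * pi))) = f (p + cexp (toC x 0)).
Proof.
congr (f (p + _)); rewrite /cexp /= -[2 * pi]addr0 mulrDl !mul1r.
by rewrite addr0 -mulr2n cos2pi sin2pi cos0 sin0.
Qed.

Lemma holo_log_coordinate f p (r0 x y : R) :
  (forall z, z != p -> nrm (z - p) < r0 -> differentiable f z) ->
  expR x < r0 -> differentiable (fun z => f (p + cexp z)) (toC x y).
Proof.
move=> df xr; apply: differentiable_comp.
  by apply: holoD; [exact: holo_cst|exact: differentiable_cexp].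
apply: df; last by rewrite addrAC subrr add0r nrm_cexp.
by rewrite -subr_eq0 addrAC subrr add0r cexp_neq0.
Qed.

Lemma Re_circle_continuous f p (r0 r y : R) :
  (forall z, z != p -> nrm (z - p) < r0 -> differentiable f z) ->
  0 < r < r0 -> {for y, continuous (fun y => complex.Re (f (circle p r y)))}.
Proof.
move=> df /andP[r_gt0 rr0].
have := @holo_log_coordinate f p r0 (ln r) y df.
by rewrite lnK // => /(_ rr0) /closed_form_holomorphic /closed_form_continuous[].
Qed.

(* The logarithmic coordinate [z = p + exp (x + i y)] turns circles around [p]
   into segments, and turns holomorphy on a punctured disc into holomorphy on a
   half-plane: nothing but continuity is needed at [p] itself. *)
Lemma mean_value f p (r0 r : R) : {for p, continuous f} ->
  (forall z, z != p -> nrm (z - p) < r0 -> differentiable f z) ->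
  0 < r < r0 ->
  segint (fun y => complex.Re (f (circle p r y))) 0 (2 * pi) =
  complex.Re (f p) * (2 * pi).
Proof.
move=> cf df /andP[r_gt0 rr0].
pose g z := f (p + cexp z).
have dg (x y : R) : expR x < r0 -> differentiable g (toC x y).
  exact: holo_log_coordinate.
have pi0 : 0 <= 2 * pi :> R by rewrite mulr_ge0 // pi_ge0.
pose m x := segint (fun y => complex.Re (g (toC x y))) 0 (2 * pi).
have mE a : a <= ln r -> m a = m (ln r).
  move=> ar.
  have := @circulation_eq0 R (fun x y => complex.Im (g (toC x y)))
    (fun x y => complex.Re (g (toC x y))) a 0 (ln r - a) (2 * pi).
  rewrite subr_ge0 ar pi0 add0r addrC subrK => /(_ isT isT) H.
  have {}H : circulation (fun x y => complex.Im (g (toC x y)))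
    (fun x y => complex.Re (g (toC x y))) a (ln r) 0 (2 * pi) = 0.
    apply: H => {}x {}y /andP[_ {}xr] _; apply: closed_form_holomorphic; apply: dg.
    by rewrite (le_lt_trans _ rr0) // -[leRHS]lnK // ler_expR.
  move: H; rewrite /circulation.
  (* By periodicity the two horizontal sides cancel, so both vertical sides carry the same
     integral. *)
  have -> : (fun x => complex.Im (g (toC x (2 * pi)))) =
            (fun x => complex.Im (g (toC x 0))).
    by apply/funext => x; rewrite /g circle_periodic.
  have aux (u v w : R) : u - v - w + w = 0 -> v = u by lra.
  exact: aux.
apply/eqP; rewrite -subr_eq0 -normr_le0; apply/ler_addgt0Pr => e e0.
rewrite add0r.
have e'0 : 0 < e / (2 * pi) by rewrite divr_gt0 // mulr_gt0 // pi_gt0.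
have [d d0 hd] := (nrm_continuousP _ _).1 cf (e / (2 * pi)) e'0.
(* Moving the left side far enough to the left shrinks its circle into the disc where [f] is within
   [e / (2 * pi)] of [f p]. *)
pose a := Num.min (ln r) (ln (d / 2)).
have ad : expR a < d.
  have : a <= ln (d / 2) by rewrite /a ge_min lexx orbT.
  by rewrite -ler_expR lnK ?posrE ?divr_gt0 //; lra.
have ar : a <= ln r by rewrite /a ge_min lexx.
rewrite -/(m (ln r)) -(mE a ar).
have := @segint_near_affine R (fun y => complex.Re (g (toC a y)))
  (complex.Re (f p)) 0 (e / (2 * pi)) 0 (2 * pi) pi0.
rewrite !mul0r addr0 subr0 divfK ?gt_eqF ?mulr_gt0 ?pi_gt0 //; apply => y _.
  have /closed_form_holomorphic H : differentiable g (toC a y).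
    by apply: dg; rewrite (le_lt_trans _ rr0) // -[leRHS]lnK // ler_expR.
  by have [] := closed_form_continuous _ _ _ _ H.
rewrite mul0r addr0 distrC -ReN -ReD (le_trans (Re_le_nrm _)) // hd //.
by rewrite opprD addrA subrr sub0r nrmN nrm_cexp.
Qed.

(** A uniform gap [d] on the whole circle would make the mean too small. Giving away [d] is harmless
    below, where a quadratic term compensates for it. *)
Lemma mean_value_le f p (r0 r d : R) : {for p, continuous f} ->
  (forall z, z != p -> nrm (z - p) < r0 -> differentiable f z) ->
  0 < r < r0 -> 0 < d ->
  exists2 z, nrm (z - p) = r & complex.Re (f p) - d < complex.Re (f z).
Proof.
move=> cf df rr0 d0; apply: contrapT => H.
have H' y : complex.Re (f (circle p r y)) <= complex.Re (f p) - d.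
  rewrite leNgt; apply/negP => h; apply: H; exists (circle p r y) => //.
  by apply: nrm_circle; case/andP: rr0.
have := mean_value _ _ _ _ cf df rr0.
have pi0 : 0 < 2 * pi :> R by rewrite mulr_gt0 // pi_gt0.
have := @segint_le R (fun y => complex.Re (f (circle p r y)))
  (complex.Re (f p) - d) 0 (2 * pi) (ltW pi0).
rewrite subr0 => /(_ (fun y _ => Re_circle_continuous _ _ _ _ y df rr0)).
move=> /(_ (fun y _ => H' y)) + E; rewrite E ler_pM2r //; lra.
Qed.
End MeanValue.

(** * The maximum principle on discs *)

Section MaximumPrinciple.
Context {R : realType}.
Local Notation C := (cplx R).
Implicit Types (f : C -> C) (z p c : C).

Lemma toC_continuous : continuous (fun q : R * R => toC q.1 q.2).
Proof.
move=> [x y]; apply/nrm_cvgP => e e0.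
have e20 : 0 < e / 2 by rewrite divr_gt0.
near=> q.
have -> : e = e / 2 + e / 2 by field.
apply: le_trans (nrm_le_ReIm _) _; rewrite ReD ImD ReN ImN /=.
apply: lerD.
- near: q; apply: cvgr_dist_le => //; exact: cvg_fst.
- near: q; apply: cvgr_dist_le => //; exact: cvg_snd.
Unshelve. all: by end_near. Qed.

Lemma nrm_continuous (E F : normedModType C) (f : E -> F) (x : E) :
  {for x, continuous f} -> {for x, continuous (fun w => nrm (f w))}.
Proof.
move=> /nrm_continuousP cf; apply/cvgrPdist_le => e e0.
have [d d0 hd] := cf e e0; apply/nrm_nbhsP; exists d => // y /hd xy.
have := nrm_dist (f y) (f x); have := nrm_dist (f x) (f y).
by rewrite (nrmB (f y)) ler_norml => ? ?; apply/andP; split; lra.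
Qed.

Lemma nrm_dist_continuous (c x : C) : {for x, continuous (fun w => nrm (w - c))}.
Proof.
apply: (@nrm_continuous C C (fun w => w - c)); apply/nrm_continuousP => e e0.
by exists e => // y /ltW; rewrite opprB addrA subrK.
Qed.

Lemma closed_disc_compact c (r : R) : compact [set z : C | nrm (z - c) <= r].
Proof.
pose Q := `[complex.Re c - r, complex.Re c + r] `*`
          `[complex.Im c - r, complex.Im c + r].
apply: (@subclosed_compact _ _ ((fun q : R * R => toC q.1 q.2) @` Q)).
- rewrite (_ : mkset _ = (fun z => nrm (z - c)) @^-1` [set x | x <= r]) //.
  apply: preimage_closed; last exact: closed_le.
  by move=> z _; exact: nrm_dist_continuous.
- apply: continuous_compact; first exact/continuous_subspaceT/toC_continuous.
  by apply: compact_setX; exact: segment_compact.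
- move=> z /= zc; exists (complex.Re z, complex.Im z); last exact: toC_eta.
  have := le_trans (Re_le_nrm (z - c)) zc; have := le_trans (Im_le_nrm (z - c)) zc.
  rewrite ReD ImD ReN ImN !ler_norml => /andP[? ?] /andP[? ?].
  by split => /=; rewrite in_itv /=; apply/andP; split; lra.
Qed.

Lemma sqr_combination_continuous (T : topologicalType) (a b : T -> R) (e : R)
    (w : T) : {for w, continuous a} -> {for w, continuous b} ->
  {for w, continuous (fun w => a w ^+ 2 + e * b w ^+ 2)}.
Proof.
move=> ca cb.
have m (f g : T -> R) : {for w, continuous f} -> {for w, continuous g} ->
    {for w, continuous (fun w => f w * g w)}.
  by move=> cf cg; exact: (@cvgM R T (nbhs w) _ f g _ _ cf cg).
apply: (@cvgD R _ T (nbhs w) _ (fun w => a w ^+ 2) _ (a w ^+ 2) _).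
  exact: (m a a).
by apply: (m (fun=> e)); [exact: cvg_cst|exact: (m b b)].
Qed.

Lemma holo_id z : differentiable (fun w : C => w) z.
Proof. exact: ex_diff. Qed.

Lemma holo_subc c z : differentiable (fun w : C => w - c) z.
Proof. by apply: holoB; [exact: holo_id|exact: holo_cst]. Qed.

(* [|f|^2 + eps |z - c|^2] cannot have a maximum inside the disc. *)
Lemma maximum_principle f c (r M : R) : 0 < r -> 0 <= M ->
  (forall z, nrm (z - c) <= r -> {for z, continuous f}) ->
  (forall p, nrm (p - c) < r -> exists2 r0 : R, 0 < r0 &
     forall z, z != p -> nrm (z - p) < r0 -> differentiable f z) ->
  (forall z, nrm (z - c) = r -> nrm (f z) <= M) ->
  forall z, nrm (z - c) <= r -> nrm (f z) <= M.
Proof.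
move=> r_gt0 M0 cf df fM z zc.
rewrite -(@ler_pXn2r _ 2) ?nnegrE ?nrm_ge0 //; apply/ler_addgt0Pr => e e0.
(* On the boundary circle the added term is then exactly [e]. *)
pose ep := e / r ^+ 2.
have ep0 : 0 < ep by rewrite divr_gt0 // exprn_gt0.
pose v (w : C) : R := nrm (f w) ^+ 2 + ep * nrm (w - c) ^+ 2.
pose D := [set w : C | nrm (w - c) <= r].
have cv : {within D, continuous v}.
  apply: continuous_in_subspaceT => w; rewrite inE => /cf cw.
  have c1 : {for w, continuous (fun w => nrm (f w))}.
    exact: nrm_continuous.
  have c2 := nrm_dist_continuous c w.
  exact: (@sqr_combination_continuous C (fun w => nrm (f w)) (fun w => nrm (w - c)) ep w c1 c2).
have D0 : D !=set0 by exists c; rewrite /D /= subrr nrm0 ltW.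
have [p] := compact_EVT_max D0 (closed_disc_compact c r) cv.
rewrite inE => pD pmax.
have {}pmax w : nrm (w - c) <= r -> v w <= v p by move=> wc; apply: pmax; rewrite inE.
suff vp : v p <= M ^+ 2 + e.
  rewrite (le_trans _ vp) // (le_trans _ (pmax z zc)) // /v lerDl.
  by rewrite mulr_ge0 ?exprn_ge0 ?nrm_ge0 // ltW.
have [pr|pr] := eqVneq (nrm (p - c)) r.
  rewrite /v pr /ep divfK ?expf_neq0 ?gt_eqF // lerD2r ler_pXn2r ?nnegrE ?nrm_ge0 //.
  exact: fM.
have {}pr : nrm (p - c) < r by rewrite lt_neqAle pr.
have [r0 r00 dfp] := df p pr.
exfalso; pose conj (w : C) : C := toC (complex.Re w) (- complex.Im w).
(* Expanding both squares around [p] gives [v w - v p = Re (F w) - Re (F p) + |f w - f p|^2 + ep |w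
   - p|^2]. On the circle of radius [rho] the last term is [ep * rho ^+ 2], exactly the loss allowed
   in [mean_value_le], so some [w] has [v w > v p]. *)
pose F (w : C) : C := RtoC 2 * conj (f p) * f w + RtoC (2 * ep) * conj (p - c) * (w - p).
pose rho := Num.min (r0 / 2) (r - nrm (p - c)).
have rho0 : 0 < rho by rewrite lt_min divr_gt0 // subr_gt0.
have rhor0 : rho < r0.
  have : rho <= r0 / 2 by rewrite /rho ge_min lexx.
  lra.
have rhor : rho <= r - nrm (p - c) by rewrite /rho ge_min lexx orbT.
have dF w : {for w, continuous f} -> {for w, continuous F}.
  move=> cw; apply: contD.
    by apply: contM; [exact: cont_cst|].
  apply: contM; first exact: cont_cst.
  exact/holo_cont/holo_subc.
have [||||w wp] := @mean_value_le R F p r0 rho (ep * rho ^+ 2).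
- exact/dF/cf/ltW.
- move=> w wp wr; apply: holoD; (apply: holoM; first exact: holo_cst).
    exact: dfp.
  exact: holo_subc.
- by rewrite rho0.
- by rewrite mulr_gt0 // exprn_gt0.
have wc : w - c = (w - p) + (p - c) by rewrite addrA subrK.
have : nrm (w - p) ^+ 2 = rho ^+ 2 by rewrite wp.
have : v w <= v p by apply: pmax; rewrite wc (le_trans (nrmD _ _)) // wp; lra.
rewrite /v wc /F subrr mulr0 addr0; move: (w - p) (p - c) => h q.
rewrite !nrm_sqr /conj !(ReD, ImD, ReM, ImM) /=.
move: (f w) (f p) h q => [x y] [a b] [s t] [k l] /=.
move=> + <-; have := sqr_ge0 (x - a); have := sqr_ge0 (y - b); clear => *; lra.
Qed.
End MaximumPrinciple.

(** * One-variable identity theorem and Cauchy's estimate *)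

Section Cauchy.
Context {R : realType}.
Local Notation C := (cplx R).
Implicit Types (f : C -> C) (z p c : C).

Lemma holo_near_eq (E : normedModType C) (f g : E -> C) (x : E) (d : R) :
  0 < d -> (forall y, nrm (x - y) < d -> f y = g y) ->
  differentiable g x -> differentiable f x.
Proof.
move=> d0 fg dg; have [] // := @bound_differentiable _ _ _ f ('d g x) x _ _.
  exact: diff_continuous.
move=> e e0; have [d1 d10 hd] := differentiable_bound _ _ dg e e0.
exists (Num.min d d1); first by rewrite lt_min d0.
move=> h; rewrite lt_min => /andP[hd' hd1].
by rewrite !fg ?subrr ?nrm0 //; [exact: hd | rewrite opprD addrA subrr sub0r nrmN].
Qed.

Lemma nrm_bounded_closed_disc f c (r : R) : 0 <= r ->
  (forall z, nrm (z - c) <= r -> {for z, continuous f}) ->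
  exists2 M : R, 0 <= M & forall z, nrm (z - c) <= r -> nrm (f z) <= M.
Proof.
move=> r0 cf; pose D := [set z : C | nrm (z - c) <= r].
have D0 : D !=set0 by exists c; rewrite /D /= subrr nrm0.
have cv : {within D, continuous (fun z => nrm (f z))}.
  by apply: continuous_in_subspaceT => z; rewrite inE => /cf; exact: nrm_continuous.
have [p _ pmax] := compact_EVT_max D0 (closed_disc_compact c r) cv.
exists (nrm (f p)); first exact: nrm_ge0.
by move=> z zc; apply: pmax; rewrite inE.
Qed.

Lemma geometric_le0 (x M q : R) : 0 <= q < 1 ->
  (forall n, x <= M * q ^+ n) -> x <= 0.
Proof.
move=> /andP[q0 q1] H.
have : (fun n => M * q ^+ n) @ \oo --> M * 0.
  by apply: cvgMr => //; apply: cvg_expr; rewrite ger0_norm.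
rewrite mulr0 => cv; rewrite -(cvg_lim _ cv) //.
by apply: limr_ge; [apply/cvg_ex; exists 0|near=> n; exact: H].
Unshelve. all: by end_near. Qed.

(* [f / (z - c)^n] is again holomorphic for every [n]; apply the maximum
   principle to it and let [n] grow. *)
Lemma disc_identity f c (r d : R) : 0 < d ->
  (forall z, nrm (z - c) < r -> differentiable f z) ->
  (forall z, nrm (z - c) < d -> f z = 0) ->
  forall z, nrm (z - c) < r -> f z = 0.
Proof.
move=> d0 df f0 z zr; have [zc|zc] := eqVneq z c.
  by apply: f0; rewrite zc subrr nrm0.
have a0 : 0 < nrm (z - c) by rewrite nrm_gt0 subr_eq0.
set a := nrm (z - c) in zr a0; pose rho := (a + r) / 2.
have arho : a < rho by rewrite /rho; lra.
have rhor : rho < r by rewrite /rho; lra.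
have rho0 : 0 < rho by lra.
have [|M M0 fM] := nrm_bounded_closed_disc f c rho (ltW rho0).
  by move=> w wr; apply/holo_cont/df/(le_lt_trans wr).
apply/eqP; rewrite -nrm_eq0 eq_le nrm_ge0 andbT.
apply: (@geometric_le0 _ M (a / rho)).
  by rewrite divr_ge0 ?ltW //= ltr_pdivrMr // mul1r.
move=> n; pose F w : C := f w / (w - c) ^+ n.
have dF w : nrm (w - c) < r -> differentiable F w.
  move=> wr; have [->|wc] := eqVneq w c.
    (* Near [c] the numerator of [F] is [0], so [F] is [0] there, also at [c] itself. *)
    apply: (@holo_near_eq _ F (fun=> 0) c d d0); last exact: holo_cst.
    by move=> y yd; rewrite /F f0 ?mul0r // nrmB.
  apply: holo_div; first exact: df.
    by apply: holoX; exact: holo_subc.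
  by rewrite expf_neq0 // subr_eq0.
have : nrm (F z) <= M / rho ^+ n.
  apply: (@maximum_principle R F c rho (M / rho ^+ n) rho0).
  - by rewrite divr_ge0 // exprn_ge0 // ltW.
  - by move=> w wr; apply/holo_cont/dF/(le_lt_trans wr).
  - move=> p pr; exists (r - rho); first by rewrite subr_gt0.
    move=> w _ wp; apply: dF.
    have -> : w - c = (w - p) + (p - c) by rewrite addrA subrK.
    by rewrite (le_lt_trans (nrmD _ _)) //; lra.
  - by move=> w wr; rewrite nrmM nrmV nrmX wr ler_pM2r ?invr_gt0 ?exprn_gt0 // fM // wr.
  - exact: ltW.
rewrite nrmM nrmV nrmX -/a ler_pdivrMr ?exprn_gt0 // => H.
by rewrite expr_div_n mulrA mulrAC.
Qed.

(** The maximum principle applied to the difference quotient, completed by the derivative at [c]; on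
    the circle of radius [rho] it is at most [2 * M / rho]. At [c] the quotient is only known to be
    continuous, which is why the mean value and maximum principles ask for holomorphy only in
    punctured discs. *)
Lemma difference_quotient_le f c (r rho M : R) : 0 < rho < r ->
  (forall z, nrm (z - c) < r -> differentiable f z) ->
  (forall z, nrm (z - c) < r -> nrm (f z) <= M) ->
  nrm ('d f c 1) <= 2 * M / rho /\
  forall z, nrm (z - c) <= rho -> nrm (f z - f c) <= 2 * M / rho * nrm (z - c).
Proof.
move=> /andP[rho0 rhor] df fM.
have cc : nrm (c - c) < r by rewrite subrr nrm0; lra.
have M0 : 0 <= M by rewrite (le_trans (nrm_ge0 (f c))) // fM.
pose q z : C := if z == c then 'd f c 1 else (f z - f c) / (z - c).
have dq z : z != c -> nrm (z - c) < r -> differentiable q z.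
  move=> zc zr; apply: (@holo_near_eq _ q (fun z => (f z - f c) / (z - c)) z (nrm (z - c))).
  - by rewrite nrm_gt0 subr_eq0.
  - move=> y; rewrite /q; case: eqP => // ->; by rewrite ltxx.
  - apply: holo_div; [|exact: holo_subc|by rewrite subr_eq0].
    by apply: holoB; [exact: df|exact: holo_cst].
have cq : {for c, continuous q}.
  apply/nrm_continuousP => e e0.
  have [d d0 hd] := differentiable_bound _ _ (df c cc) e e0.
  exists d => // y yd; rewrite /q eqxx; case: eqVneq => [_|yc].
    by rewrite subrr nrm0 ltW.
  have yc0 : y - c != 0 by rewrite subr_eq0.
  rewrite (nrmB c) in yd; have := hd (y - c) yd.
  rewrite (diff_mulE _ _ (y - c)) (addrC c) subrK => H.
  rewrite nrmB (_ : _ - _ = (f y - f c - (y - c) * 'd f c 1) / (y - c)).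
    by rewrite nrmM nrmV ler_pdivrMr ?nrm_gt0.
  by rewrite [in RHS]mulrBl mulrAC divff // mul1r.
have Q z : nrm (z - c) <= rho -> nrm (q z) <= 2 * M / rho.
  apply: (@maximum_principle R q c rho (2 * M / rho) rho0).
  - by rewrite divr_ge0 ?mulr_ge0 // ltW.
  - move=> w wr; have [->//|wc] := eqVneq w c.
    by apply/holo_cont/dq => //; apply: le_lt_trans wr rhor.
  - move=> p pr; have [->|pc] := eqVneq p c.
      by exists r; [lra|move=> w wc wr; exact: dq].
    exists (Num.min (r - rho) (nrm (p - c))).
      by rewrite lt_min subr_gt0 rhor nrm_gt0 subr_eq0.
    move=> w _; rewrite lt_min => /andP[wp1 wp2]; apply: dq.
      by apply: contraTN wp2 => /eqP ->; rewrite nrmB ltxx.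
    have -> : w - c = (w - p) + (p - c) by rewrite addrA subrK.
    by rewrite (le_lt_trans (nrmD _ _)) //; lra.
  - move=> w wr; rewrite /q; case: eqP => [wc|_].
      by move: wr; rewrite wc subrr nrm0 => wr; lra.
    rewrite nrmM nrmV wr ler_pM2r ?invr_gt0 // (le_trans (nrm_sub _ _)) //.
    have := fM w; rewrite wr => /(_ rhor); have := fM c cc; lra.
split.
  by have := Q c; rewrite subrr nrm0 /q eqxx => /(_ (ltW rho0)).
move=> z zr; have [->|zc] := eqVneq z c; first by rewrite !subrr nrm0 mulr0.
have := Q z zr; rewrite /q (negbTE zc) nrmM nrmV ler_pdivrMr //.
by rewrite nrm_gt0 subr_eq0.
Qed.

End Cauchy.

(** * Absolutely convergent complex series *)

Section ComplexSeries.
Context {R : realType}.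
Local Notation C := (cplx R).
Implicit Types (u v : nat -> C) (M : nat -> R).

Definition summing M := exists B, forall n, \sum_(0 <= i < n) M i <= B.

Lemma series_cvg_nonneg M : (forall n, 0 <= M n) -> summing M -> cvgn (series M).
Proof.
move=> M0 [B MB]; apply: nondecreasing_is_cvgn; last first.
  by exists B => _ [n _ <-]; exact: MB.
apply/nondecreasing_seqP => n; rewrite seriesSr lerDl; exact: M0.
Qed.

Lemma summing_tail M (e : R) : (forall n, 0 <= M n) -> summing M -> 0 < e ->
  exists N, forall m, (N <= m)%N -> \sum_(N <= i < m) M i <= e.
Proof.
move=> M0 sM e0; have cM := series_cvg_nonneg _ M0 sM.
have nd : nondecreasing_seq (series M).
  by apply/nondecreasing_seqP => n; rewrite seriesSr lerDl; exact: M0.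
have /cvgrPdist_le /(_ e e0) [N _ HN] := cM.
exists N => m Nm; rewrite -sub_series_geq //.
have := HN N (leqnn N); have := nondecreasing_cvgn_le nd cM m.
have := nondecreasing_cvgn_le nd cM N.
by rewrite ler_norml => ? ? /andP[? ?]; lra.
Qed.

(** A total function of the sequence, with real limits taken componentwise; the value is meaningful
    when the series converges, see [csum_cvg] and [csum_unique]. *)
Definition csum u : C := toC (limn (series (fun n => complex.Re (u n))))
                             (limn (series (fun n => complex.Im (u n)))).

Lemma Re_sum I (r : seq I) (P : pred I) (F : I -> C) :
  complex.Re (\sum_(i <- r | P i) F i) = \sum_(i <- r | P i) complex.Re (F i).
Proof. by elim/big_ind2: _ => // x a y b <- <-; rewrite ReD. Qed.

Lemma Im_sum I (r : seq I) (P : pred I) (F : I -> C) :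
  complex.Im (\sum_(i <- r | P i) F i) = \sum_(i <- r | P i) complex.Im (F i).
Proof. by elim/big_ind2: _ => // x a y b <- <-; rewrite ImD. Qed.

Lemma cvg_ReIm u (a b : R) :
  (fun n => complex.Re (u n)) @ \oo --> a ->
  (fun n => complex.Im (u n)) @ \oo --> b -> u @ \oo --> toC a b.
Proof.
move=> /cvgrPdist_le ca /cvgrPdist_le cb; apply/nrm_cvgP => e e0.
have e20 : 0 < e / 2 by rewrite divr_gt0.
near=> n; rewrite (le_trans (nrm_le_ReIm _)) // (splitr e) ReD ImD ReN ImN /=.
by apply: lerD; near: n; [exact: ca|exact: cb].
Unshelve. all: by end_near. Qed.

Lemma csum_cvg u M : (forall n, nrm (u n) <= M n) -> summing M ->
  series u @ \oo --> csum u.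
Proof.
move=> uM sM.
have M0 n : 0 <= M n by rewrite (le_trans (nrm_ge0 (u n))).
have cM := series_cvg_nonneg _ M0 sM.
have real_cvg (a : nat -> R) : (forall n, `|a n| <= nrm (u n)) -> cvgn (series a).
  move=> ua; apply: normed_cvg; apply: (series_le_cvg _ M0 _ cM) => n /=.
    exact: normr_ge0.
  exact: le_trans (uM n).
apply: cvg_ReIm.
  rewrite (_ : (fun n => _) = series (fun n => complex.Re (u n))).
    by apply: real_cvg => n; exact: Re_le_nrm.
  by apply/funext => n; rewrite /series /= Re_sum.
rewrite (_ : (fun n => _) = series (fun n => complex.Im (u n))).
  by apply: real_cvg => n; exact: Im_le_nrm.
by apply/funext => n; rewrite /series /= Im_sum.
Qed.

Lemma C_cvg_unique u (a b : C) : u @ \oo --> a -> u @ \oo --> b -> a = b.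
Proof. exact: cvg_unique. Qed.

Lemma csum_unique u (l : C) : series u @ \oo --> l -> csum u = l.
Proof.
move=> ul.
have part (p : C -> R) : (forall x y, p x - p y = p (x - y)) ->
    (forall x, `|p x| <= nrm x) -> p \o series u @ \oo --> p l.
  move=> pB pn; apply/cvgrPdist_le => e e0.
  move: ul => /nrm_cvgP/(_ e e0); apply: filterS => n; apply: le_trans.
  by rewrite pB.
apply: complex_ext => /=.
  apply: cvg_lim => //.
  rewrite (_ : series _ = (@complex.Re R) \o series u).
    by apply: part => [x y|x]; [rewrite -ReN -ReD|exact: Re_le_nrm].
  by apply/funext => n; rewrite /series /= Re_sum.
apply: cvg_lim => //.
rewrite (_ : series _ = (@complex.Im R) \o series u).
  by apply: part => [x y|x]; [rewrite -ImN -ImD|exact: Im_le_nrm].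
by apply/funext => n; rewrite /series /= Im_sum.
Qed.

Lemma nrm_lim_le u (l : C) (B : R) : u @ \oo --> l ->
  (exists N, forall n, (N <= n)%N -> nrm (u n) <= B) -> nrm l <= B.
Proof.
move=> /nrm_cvgP ul [N uB]; apply/ler_addgt0Pr => e e0.
have [N1 _ H1] := ul e e0.
have /H1 /= : (N1 <= maxn N N1)%N by rewrite leq_maxr.
have := uB (maxn N N1) (leq_maxl _ _).
have := nrmD (l - u (maxn N N1)) (u (maxn N N1)); rewrite subrK; lra.
Qed.

Lemma csum_le u M (B : R) : (forall n, nrm (u n) <= M n) ->
  (forall n, \sum_(0 <= i < n) M i <= B) -> nrm (csum u) <= B.
Proof.
move=> uM MB; apply: (nrm_lim_le (series u)); first by apply: csum_cvg uM _; exists B.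
exists 0%N => n _; rewrite (le_trans (nrm_sum _ _ _ _)) // (le_trans _ (MB n)) //.
by apply: ler_sum.
Qed.

Lemma cseries_cvgD u v (a b : C) : series u @ \oo --> a -> series v @ \oo --> b ->
  series (fun n => u n + v n) @ \oo --> a + b.
Proof.
move=> ua vb; rewrite (_ : series _ = fun n => series u n + series v n).
  exact: (@cvgD C C _ \oo _ (series u) (series v) _ _ ua vb).
by apply/funext => n; rewrite /series /= big_split.
Qed.

Lemma cseries_cvgZ u (k a : C) : series u @ \oo --> a ->
  series (fun n => k * u n) @ \oo --> k * a.
Proof.
move=> ua; rewrite (_ : series _ = fun n => k * series u n).
  exact: (@cvgM C _ \oo _ (fun=> k) (series u) _ _ (cvg_cst k) ua).
by apply/funext => n; rewrite /series /= mulr_sumr.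
Qed.

End ComplexSeries.

(** * Locally uniform limits of holomorphic functions *)

Section Weierstrass.
Context {R : realType}.
Local Notation C := (cplx R).
Context {E : normedModType C}.
Implicit Types (f : E -> C).

Lemma nrm_ge_lt (x y : R) : 0 <= x -> 0 < y -> exists2 d : R, 0 < d & d * x < y.
Proof.
move=> x0 y0; exists (y / (x + 1)); first by rewrite divr_gt0 // ltr_wpDl.
by rewrite mulrAC ltr_pdivrMr ?ltr_wpDl // ltr_pM2l //; lra.
Qed.

Lemma line_differentiable f (x h : E) (z : C) : differentiable f (x + z *: h) ->
  differentiable (fun w : C => f (x + w *: h)) z /\
  'd (fun w : C => f (x + w *: h)) z 1 = 'd f (x + z *: h) h.
Proof.
move=> df.
have D : is_diff z (fun w : C => x + w *: h) ( *:%R^~ h).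
  rewrite (_ : (fun w => _) = cst x + ( *:%R^~ h)) //.
  by apply: is_diff_eq; rewrite add0r.
have dl : differentiable (fun w : C => x + w *: h) z by exact: ex_diff.
split; first exact: (differentiable_comp dl df).
rewrite -[fun w => _]/(f \o (fun w : C => x + w *: h)) diff_comp //= diff_val /=.
by rewrite scale1r.
Qed.

(** Cauchy's estimate on the complex line through [x] in direction [h], whose parameter runs over a
    disc of radius [r / nrm h]; half of that radius turns the constant [2] into [4]. *)
Lemma ball_difference_le f (x : E) (r M : R) : 0 < r ->
  (forall y, nrm (y - x) < r -> differentiable f y) ->
  (forall y, nrm (y - x) < r -> nrm (f y) <= M) ->
  forall h, nrm h <= r / 2 ->
    nrm (f (x + h) - f x) <= 4 * M / r * nrm h /\
    nrm ('d f x h) <= 4 * M / r * nrm h.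
Proof.
move=> r0 df fM h hr.
have [->|h0] := eqVneq h 0.
  by rewrite addr0 subrr nrm0 mulr0 linear0 nrm0.
have h0' : 0 < nrm h by rewrite nrm_gt0.
pose g (w : C) := f (x + w *: h).
have gr (w : C) : nrm (w - 0) < r / nrm h -> nrm (x + w *: h - x) < r.
  by rewrite subr0 ltr_pdivlMr // addrC addKr nrmZ.
have dg (w : C) : nrm (w - 0) < r / nrm h -> differentiable g w.
  by move=> /gr wr; have [] := line_differentiable f x h w (df _ wr).
have [||d0 d1] := difference_quotient_le g 0 (r / nrm h) (r / 2 / nrm h) M _ dg.
- by rewrite divr_gt0 ?divr_gt0 //= ltr_pM2r ?invr_gt0 //; lra.
- by move=> w /gr; exact: fM.
have e1 : 2 * M / (r / 2 / nrm h) = 4 * M / r * nrm h.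
  by field; rewrite !gt_eqF.
have gx : 'd g 0 1 = 'd f x h.
  have [] := line_differentiable f x h 0; rewrite scale0r addr0 //.
  by apply: df; rewrite subrr nrm0.
rewrite gx e1 in d0; split => //.
have := d1 1; rewrite subr0 nrm1 /g scale1r scale0r addr0 mulr1 e1; apply.
by rewrite ler_pdivlMr // mul1r.
Qed.

(* Cauchy's estimate makes the tail of the series Lipschitz with a small
   constant, so that the limit is differentiable as soon as the terms are. *)
Theorem weierstrass_M_test (V : set E) (f : nat -> E -> C) (F : E -> C)
    (M : nat -> R) : open V ->
  (forall n z, V z -> differentiable (f n) z) ->
  (forall n z, V z -> nrm (f n z) <= M n) -> summing M ->
  (forall z, V z -> series (f^~ z) @ \oo --> F z) ->
  forall z, V z -> differentiable F z.
Proof.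
move=> /nrm_openP oV df fM sM fF x Vx; have [r r0 rV] := oV x Vx.
have M0 n : 0 <= M n by rewrite (le_trans (nrm_ge0 (f n x))) // fM.
have rV' y : nrm (y - x) < r -> V y by rewrite nrmB; exact: rV.
have est n h : nrm h <= r / 2 ->
    nrm (f n (x + h) - f n x) <= 4 * M n / r * nrm h /\
    nrm ('d (f n) x h) <= 4 * M n / r * nrm h.
  by apply: ball_difference_le => // y /rV'; [exact: df|exact: fM].
(* The derivative is linear, so the bound for short [h] extends to all [h] by scaling. *)
have dle n h : nrm ('d (f n) x h) <= 4 * M n / r * nrm h.
  have [->|h0] := eqVneq h 0; first by rewrite linear0 !nrm0 mulr0.
  have h0' : 0 < nrm h by rewrite nrm_gt0.
  have k0 : 0 < r / 2 / nrm h by rewrite !divr_gt0.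
  have [|_] := est n (RtoC (r / 2 / nrm h) *: h).
    by rewrite nrmZ nrm_RtoC gtr0_norm // divfK // gt_eqF.
  by rewrite linearZ /= !nrmZ nrm_RtoC gtr0_norm // mulrCA ler_pM2l.
pose L h := csum (fun n => 'd (f n) x h).
have sumc (c : R) : 0 <= c -> summing (fun n => 4 * M n / r * c).
  move=> c0; have [B MB] := sM; exists (4 / r * c * B) => n.
  rewrite (eq_bigr (fun i => 4 / r * c * M i)); last by move=> i _; ring.
  by rewrite -mulr_sumr ler_wpM2l // mulr_ge0 // divr_ge0 // ltW.
have Lcvg h : series (fun n => 'd (f n) x h) @ \oo --> L h.
  by apply: csum_cvg (fun n => dle n h) _; apply: sumc; exact: nrm_ge0.
have Llin : linear L.
  move=> k a b; apply: csum_unique.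
  rewrite (_ : (fun n => _) = fun n => k * 'd (f n) x a + 'd (f n) x b).
    by apply: cseries_cvgD => //; exact: cseries_cvgZ.
  by apply/funext => n; rewrite linearP.
pose LL : {linear E -> C} := HB.pack L (GRing.isLinear.Build _ _ _ _ _ Llin).
have [B MB] := sM.
have Lle h : nrm (L h) <= 4 / r * B * nrm h.
  apply: csum_le (fun n => dle n h) _ => n.
  rewrite (eq_bigr (fun i => 4 / r * nrm h * M i)); last by move=> i _; ring.
  rewrite -mulr_sumr (mulrAC _ B) ler_wpM2l //.
  by rewrite mulr_ge0 ?nrm_ge0 // divr_ge0 // ltW.
have B0 : 0 <= B by have := MB 0%N; rewrite big_geq.
have K0 : 0 <= 4 / r * B by rewrite mulr_ge0 // divr_ge0 // ltW.
have cL : continuous LL.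
  move=> y; apply/nrm_continuousP => e e0.
  have [d d0 hd] := nrm_ge_lt _ _ K0 e0.
  exists d => // w yw; rewrite -linearB (le_trans (Lle _)) // (le_trans _ (ltW hd)) //.
  by rewrite mulrC ler_wpM2r // ltW.
have [] // := @bound_differentiable _ _ _ F LL x cL => e e0.
have [e1 e10 e1e] : exists2 e1 : R, 0 < e1 & 8 / r * e1 = e / 2.
  exists (e * r / 16); first by rewrite divr_gt0 // mulr_gt0.
  by field; rewrite gt_eqF.
have [N HN] := summing_tail _ _ M0 sM e10.
pose D n h := f n (x + h) - f n x - 'd (f n) x h.
have [d d0 hd] : exists2 d : R, 0 < d &
    forall h, nrm h < d -> nrm (\sum_(0 <= i < N) D i h) <= e / 2 * nrm h.
  elim: N {HN} (e / 2) (divr_gt0 e0 (ltr0n _ 2)) => [|N IH] e2 e20.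
    by exists 1 => // h _; rewrite big_geq // nrm0 mulr_ge0 ?nrm_ge0 // ltW.
  have e40 : 0 < e2 / 2 by rewrite divr_gt0.
  have [d1 d10 h1] := IH _ e40.
  have [d2 d20 h2] := differentiable_bound _ _ (df N x Vx) _ e40.
  exists (Num.min d1 d2); first by rewrite lt_min d10.
  move=> h; rewrite lt_min => /andP[/h1 H1 /h2 H2].
  by rewrite big_nat_recr //= (le_trans (nrmD _ _)) // (splitr e2) mulrDl lerD.
exists (Num.min d (r / 2)); first by rewrite lt_min d0 divr_gt0.
move=> h; rewrite lt_min => /andP[/hd Hh /ltW hr].
have Vxh : V (x + h) by apply: rV'; rewrite addrC addKr; lra.
apply: (nrm_lim_le (series (D^~ h))).
  apply: cseries_cvgD; last first.
    by rewrite -mulN1r; under eq_fun do rewrite -mulN1r; exact: cseries_cvgZ.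
  apply: cseries_cvgD; first exact: fF.
  rewrite -mulN1r; under eq_fun do rewrite -mulN1r; apply: cseries_cvgZ; exact: fF.
exists N => m Nm; rewrite /series /= (big_cat_nat _ Nm) //=.
rewrite (le_trans (nrmD _ _)) // (splitr e) mulrDl lerD //.
rewrite (le_trans (nrm_sum _ _ _ _)) //.
apply: (@le_trans _ _ (\sum_(N <= i < m) 8 / r * nrm h * M i)).
  apply: ler_sum => i _; have [H1 H2] := est i h hr.
  rewrite (le_trans (nrm_sub _ _)) // (le_trans (lerD H1 H2)) //.
  by rewrite (_ : _ + _ = 8 / r * nrm h * M i) //; field; rewrite gt_eqF.
rewrite -mulr_sumr -e1e (mulrAC _ e1) ler_wpM2l ?HN //.
by rewrite mulr_ge0 ?nrm_ge0 // divr_ge0 // ltW.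
Qed.

End Weierstrass.

(** * Meromorphic functions and analytic sets *)

Section IdentityTheorem.
Context {R : realType}.
Local Notation C := (cplx R).
Context {E : normedModType C}.
Implicit Types (V T : set E) (f : E -> C) (x y z a b : E).

Definition convex_set V :=
  forall a b (t : R), V a -> V b -> 0 <= t <= 1 -> V (a + RtoC t *: (b - a)).

(** Connectedness of the segment from [a] to [b], through the supremum of the parameters up to which
    it stays in [T]. This one argument propagates the vanishing of a holomorphic function, the
    inclusion of a line in an analytic set, and the equality of meromorphic functions. *)
Lemma clopen_convex V T a b : convex_set V -> V a -> V b -> T a ->
  (forall x, T x -> exists2 d : R, 0 < d & forall y, nrm (x - y) < d -> T y) ->
  (forall x, V x ->
     (forall d : R, 0 < d -> exists2 y, T y & nrm (x - y) < d) -> T x) -> T b.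
Proof.
move=> cV Va Vb Ta oT cT.
pose g (t : R) := a + RtoC t *: (b - a).
pose K := nrm (b - a) + 1.
have K0 : 0 < K by rewrite ltr_wpDl // nrm_ge0.
have gK s t : nrm (g s - g t) <= `|s - t| * K.
  rewrite /g opprD addrACA subrr add0r -scalerBl -RtoCN -RtoCD nrmZ nrm_RtoC.
  by rewrite ler_wpM2l // /K lerDl.
pose S := [set t : R | 0 <= t <= 1 /\ forall s, 0 <= s <= t -> T (g s)].
have g0 : g 0 = a by rewrite /g RtoC0 scale0r addr0.
have S0 : S 0.
  split; first by rewrite lexx ler01.
  by move=> s; rewrite -eq_le => /eqP <-; rewrite g0.
have supS : has_sup S by split; [exists 0|exists 1 => t [/andP[]]].
pose m := sup S.
have m0 : 0 <= m by apply: ub_le_sup => //; case: supS.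
have m1 : m <= 1 by apply: ge_sup; [exists 0|move=> t [/andP[]]].
have below (s : R) : 0 <= s < m -> T (g s).
  move=> /andP[s0 sm]; have ms : 0 < m - s by rewrite subr_gt0.
  have [t [_ St] st] := sup_adherent ms supS.
  by apply: St; rewrite s0 /= ltW //; move: st; rewrite -/m; lra.
have Tm : T (g m).
  have [m_eq0|m_neq0] := eqVneq m 0; first by rewrite m_eq0 g0.
  apply: cT; first by apply: cV => //; rewrite m0 m1.
  move=> d d0; have mpos : 0 < m by rewrite lt_def m_neq0.
  pose t := Num.max 0 (m - d / (2 * K)).
  have dK : 0 < d / (2 * K) by rewrite divr_gt0 // mulr_gt0.
  have tm : t < m by rewrite /t gt_max mpos ltrBlDr ltrDl.
  have t0 : 0 <= t by rewrite /t le_max lexx.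
  exists (g t); first by apply: below; rewrite t0.
  apply: le_lt_trans (gK _ _) _.
  have mt : `|m - t| <= d / (2 * K).
    rewrite gtr0_norm ?subr_gt0 // lerBlDr addrC -lerBlDr.
    by rewrite /t le_max lexx orbT.
  apply: le_lt_trans (ler_wpM2r (ltW K0) mt) _.
  by rewrite invfM mulrA divfK ?gt_eqF //; lra.
have gb : g 1 = b by rewrite /g RtoC1 scale1r addrC subrK.
have [m_eq1|m_neq1] := eqVneq m 1; first by rewrite -gb -m_eq1.
have {m_neq1}m1' : m < 1 by rewrite lt_def eq_sym m_neq1.
have [d d0 hd] := oT _ Tm.
pose t := Num.min 1 (m + d / (2 * K)).
have dK : 0 < d / (2 * K) by rewrite divr_gt0 // mulr_gt0.
have mt : m < t by rewrite /t lt_min m1' ltrDl.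
have : S t.
  split; first by rewrite (le_trans m0 (ltW mt)) /= /t ge_min lexx.
  move=> s /andP[s0 st]; have [sm|ms] := ltP s m; first by apply: below; rewrite s0.
  apply: hd; apply: le_lt_trans (gK _ _) _.
  have : `|m - s| <= d / (2 * K).
    rewrite distrC ger0_norm ?subr_ge0 // lerBlDr addrC (le_trans st) //.
    by rewrite /t ge_min lexx orbT.
  move=> /(ler_wpM2r (ltW K0)) /le_lt_trans; apply.
  by rewrite invfM mulrA divfK ?gt_eqF //; lra.
by move=> /(ub_le_sup (proj2 supS)); rewrite leNgt mt.
Qed.

Lemma convex_ball x (r : R) : convex_set [set y | nrm (x - y) < r].
Proof.
move=> a b t /= ar br /andP[t0 t1].
have -> : x - (a + RtoC t *: (b - a)) =
    RtoC (1 - t) *: (x - a) + RtoC t *: (x - b).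
  rewrite RtoCD RtoCN RtoC1 scalerBl scale1r -addrA -scalerN -scalerDr.
  by rewrite [- (x - a)]opprB [a - x + _]addrA subrK opprD addrA -[b - a]opprB
    scalerN opprK.
rewrite (le_lt_trans (nrmD _ _)) // !nrmZ !nrm_RtoC !ger0_norm ?subr_ge0 //.
have [->|t0'] := eqVneq t 0; first by rewrite subr0 mul0r addr0 mul1r.
have tp : 0 < t by rewrite lt_def t0'.
have -> : r = (1 - t) * r + t * r by ring.
by rewrite ler_ltD ?ltr_pM2l // ler_wpM2l ?subr_ge0 // ltW.
Qed.

Lemma convex_setT : convex_set setT.
Proof. by []. Qed.

Theorem identity_theorem V f a (d : R) : open V -> convex_set V -> V a -> 0 < d ->
  (forall z, V z -> differentiable f z) ->
  (forall z, nrm (a - z) < d -> f z = 0) -> forall z, V z -> f z = 0.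
Proof.
move=> /nrm_openP oV cV Va d0 df fd b Vb.
pose T := [set x | exists2 d : R, 0 < d & forall y, nrm (x - y) < d -> f y = 0].
suff [e e0 he] : T b by apply: he; rewrite subrr nrm0.
apply: (clopen_convex V T a b) => //; first by exists d.
  move=> x [e e0 he]; exists (e / 2); first by rewrite divr_gt0.
  move=> y xy; exists (e / 2); first by rewrite divr_gt0.
  move=> z yz; apply: he; rewrite -(subrK y x) -addrA.
  by rewrite (le_lt_trans (nrmD _ _)) //; lra.
move=> x Vx cx; have [r r0 rV] := oV x Vx.
(* A good point [y] within [r / 3] of [x] serves every [z] within [r / 3] of [x]: the disc of radius
   [2 * r / 3] around [y] on the line towards [z] contains [z] and stays within [r] of [x]. *)
have r30 : 0 < r / 3 by rewrite divr_gt0.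
have [y [e e0 he] xy] := cx _ r30.
exists (r / 3) => // z xz; have [->|zy] := eqVneq z y.
  by apply: he; rewrite subrr nrm0.
have zy0 : 0 < nrm (z - y) by rewrite nrm_gt0 subr_eq0.
have zy' : nrm (z - y) < 2 * r / 3.
  rewrite -(subrK x z) -addrA (le_lt_trans (nrmD _ _)) // (nrmB z).
  by lra.
pose g (w : C) := f (y + w *: (z - y)).
have -> : f z = g 1 by rewrite /g scale1r addrC subrK.
apply: (@disc_identity R g 0 (2 * r / 3 / nrm (z - y)) (e / nrm (z - y))).
- by rewrite divr_gt0.
- move=> w; rewrite subr0 ltr_pdivlMr // -nrmZ => wr.
  have [] // := line_differentiable f y (z - y) w; apply: df; apply: rV.
  by rewrite opprD addrA (le_lt_trans (nrm_sub _ _)) //; lra.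
- move=> w; rewrite subr0 ltr_pdivlMr // -nrmZ => wr; apply: he.
  by rewrite opprD addrA subrr sub0r nrmN.
- by rewrite subr0 nrm1 ltr_pdivlMr // mul1r.
Qed.

Lemma nonvanishing_dense V f a p (d : R) : open V -> convex_set V ->
  (forall z, V z -> differentiable f z) -> V a -> f a != 0 -> V p -> 0 < d ->
  exists y, [/\ V y, nrm (p - y) < d & f y != 0].
Proof.
move=> oV cV df Va fa Vp d0; apply: contrapT => H.
have [r r0 rV] := (nrm_openP V).1 oV p Vp.
suff : f a = 0 by apply/eqP.
apply: (@identity_theorem V f p (Num.min d r)) => //; first by rewrite lt_min d0.
move=> z; rewrite lt_min => /andP[zd zr]; apply/eqP/negP => /negP fz.
by apply: H; exists z; split => //; exact: rV.
Qed.

End IdentityTheorem.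

(** * Analytic sets, denominators and uniqueness of meromorphic continuation *)

Section AnalyticGeometry.
Context {R : realType}.
Local Notation C := (cplx R).
Implicit Types (V A B : set (cplx3 R)) (f g h : cplx3 R -> C) (p q : cplx3 R).

(* The set of parameters around which the line stays in [B] is clopen. *)
Lemma analytic_set_line B p q (d : R) : analytic_set B -> ~ B p -> 0 < d ->
  exists2 w : C, nrm w < d & ~ B (q + w *: (p - q)).
Proof.
move=> aB Bp d0; apply: contrapT => H.
pose T := [set w : C | exists2 e : R, 0 < e &
  forall z, nrm (w - z) < e -> B (q + z *: (p - q))].
suff [e e0 he] : T 1.
  by apply: Bp; have := he 1; rewrite subrr nrm0 scale1r addrC subrK; exact.
apply: (@clopen_convex R C setT T 0 1) => //.
- exists d => // z; rewrite sub0r nrmN => zd.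
  by apply: contrapT => nB; apply: H; exists z.
- move=> x [e e0 he]; exists (e / 2); first by rewrite divr_gt0.
  move=> y xy; exists (e / 2); first by rewrite divr_gt0.
  move=> z yz; apply: he; rewrite -(subrK y x) -addrA.
  by rewrite (le_lt_trans (nrmD _ _)) //; lra.
move=> x _ cx; have [V [m [F [oV Vx holF BF]]]] := aB (q + x *: (p - q)).
have [r r0 rV] := (nrm_openP V).1 oV _ Vx.
have [e e0 he] := nrm_ge_lt _ _ (nrm_ge0 (p - q)) r0.
have inV z : nrm (x - z) < e -> V (q + z *: (p - q)).
  move=> xz; apply: rV; rewrite opprD addrACA subrr add0r -scalerBl nrmZ.
  by apply: le_lt_trans he; rewrite ler_wpM2r ?nrm_ge0 // ltW.
have [y [e1 e10 he1] xy] := cx e e0.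
exists e => // z xz; apply: (BF _ (inV _ xz)).2 => i; pose g (w : C) := F i (q + w *: (p - q)).
pose D := [set w : C | nrm (x - w) < e].
have [e2 e20 he2] := (nrm_openP D).1 (nrm_open_ball x e) y xy.
apply: (@identity_theorem R C D g y (Num.min e1 e2)) => //.
- exact: nrm_open_ball.
- exact: convex_ball.
- by rewrite lt_min e10.
- move=> w /inV Vw; have [] // := line_differentiable (F i) q (p - q) w.
  exact: holF.
- move=> w; rewrite lt_min => /andP[w1 w2]; rewrite /g.
  exact: (BF _ (inV _ (he2 _ w2))).1 (he1 _ w1) i.
Qed.

Lemma closureP A p : closure A p <->
  forall d : R, 0 < d -> exists2 y, A y & nrm (p - y) < d.
Proof.
split=> [cA d d0|H B /nrm_nbhsP[d d0 hd]].
  have [y [Ay yd]] : A `&` [set y | nrm (p - y) < d] !=set0.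
    by apply: cA; apply/nrm_nbhsP; exists d.
  by exists y.
by have [y Ay /hd By] := H d d0; exists y.
Qed.

Lemma dense_eq0 V f h : open V -> denominator V h ->
  (forall z, V z -> {for z, continuous f}) ->
  (forall z, V z -> h z != 0 -> f z = 0) -> forall z, V z -> f z = 0.
Proof.
move=> oV [hh hd] cf f0 z Vz; apply/eqP; rewrite -nrm_eq0 eq_le nrm_ge0 andbT.
apply/ler_addgt0Pr => e e0; rewrite add0r.
have [d d0 fd] := (nrm_continuousP _ _).1 (cf z Vz) e e0.
have [r r0 rV] := (nrm_openP V).1 oV z Vz.
have m0 : 0 < Num.min d r by rewrite lt_min d0.
have [y /= hy] := (closureP _ _).1 (hd z Vz) _ m0.
rewrite lt_min => /andP[yd yr].
by have := fd y yd; rewrite (f0 y (rV y yr) hy) subr0.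
Qed.

Lemma denominator_sub V V' h : V' `<=` V -> denominator V h -> denominator V' h.
Proof.
by move=> VV [hh hd]; split => z /VV; [exact: hh|exact: hd].
Qed.

Lemma denominator1 V : denominator V (fun=> 1).
Proof.
split => [z _|z Vz]; first exact: holo_cst.
by apply: subset_closure; rewrite /= oner_eq0.
Qed.

(** Near a point where [h1] is nonzero it stays nonzero by continuity, and the density for [h2] then
    provides a point in that neighbourhood. *)
Lemma denominatorM V h1 h2 : open V -> denominator V h1 -> denominator V h2 ->
  denominator V (fun z => h1 z * h2 z).
Proof.
move=> oV [hh1 hd1] [hh2 hd2]; split => [z Vz|z Vz].
  by apply: holoM; [exact: hh1|exact: hh2].
apply/closureP => d d0; have [r r0 rV] := (nrm_openP V).1 oV z Vz.
have m0 : 0 < Num.min d r by rewrite lt_min d0.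
have [y /= hy] := (closureP _ _).1 (hd1 z Vz) _ m0.
rewrite lt_min => /andP[yd yr]; have Vy := rV y yr.
have h1y : 0 < nrm (h1 y) / 2 by rewrite divr_gt0 // nrm_gt0.
have [e e0 he] := (nrm_continuousP _ _).1 (holo_cont _ _ (hh1 y Vy)) _ h1y.
have m1 : 0 < Num.min e (d - nrm (z - y)) by rewrite lt_min e0 subr_gt0.
have [x /= hx] := (closureP _ _).1 (hd2 y Vy) _ m1.
rewrite lt_min => /andP[xe xd]; exists x.
  rewrite /= mulf_neq0 //; apply: contraTneq (he x xe) => ->.
  by rewrite subr0 -ltNge ltr_pdivrMr // mulr2n mulrDr mulr1 ltrDl nrm_gt0.
rewrite -(subrK y z) -addrA (le_lt_trans (nrmD _ _)) //; lra.
Qed.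

Lemma mero_eq_sub V V' f g : V' `<=` V -> mero_eq V f g -> mero_eq V' f g.
Proof.
move=> VV [h hd hE]; exists h; first exact: denominator_sub hd.
by move=> z /VV; exact: hE.
Qed.

Lemma mero_eq_unique V f g1 g2 : open V ->
  (forall z, V z -> {for z, continuous g1}) ->
  (forall z, V z -> {for z, continuous g2}) ->
  mero_eq V f g1 -> mero_eq V f g2 -> forall z, V z -> g1 z = g2 z.
Proof.
move=> oV c1 c2 [h1 d1 E1] [h2 d2 E2] z Vz; apply/eqP; rewrite -subr_eq0; apply/eqP.
move: z Vz; apply: (dense_eq0 V _ _ oV (denominatorM _ _ _ oV d1 d2)).
  by move=> z Vz; apply: contB; [exact: c1|exact: c2].
by move=> z Vz; rewrite mulf_eq0 negb_or => /andP[/E1-E /E2-E']; rewrite -E // -E' // subrr.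
Qed.

Lemma nonzero_denominator V f a : open V -> convex_set V -> holomorphic V f ->
  V a -> f a != 0 -> denominator V f.
Proof.
move=> oV cV hf Va fa; split => // z Vz; apply/closureP => d d0.
have [y [_ yd fy]] := nonvanishing_dense V f a z d oV cV hf Va fa Vz d0.
by exists y.
Qed.

Lemma open_setI_ball V p : open V -> V p -> exists2 r : R, 0 < r &
  [set y | nrm (p - y) < r] `<=` V.
Proof. by move=> /nrm_openP oV /oV[r r0 rV]; exists r. Qed.

(* The set of points near which [f] is represented by [G / Q] is clopen. *)
Theorem meromorphic_continuation_unique f (W U : set (cplx3 R)) G Q a :
  meromorphic f -> open W -> convex_set W -> holomorphic W G -> denominator W Q ->
  open U -> U `<=` W -> U a -> (forall z, U z -> f z = G z / Q z) ->
  forall p, W p -> exists V, [/\ open V, V p, V `<=` W &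
    mero_eq V f (fun z => G z / Q z)].
Proof.
move=> mf oW cW hG dQ oU UW Ua fU p Wp.
pose T := [set p | exists V, [/\ open V, V p, V `<=` W &
    mero_eq V f (fun z => G z / Q z)]].
apply: (clopen_convex W T a p) => //; first exact: UW.
- exists U; split => //; exists (fun=> 1); first exact: denominator1.
  by move=> z Uz _; exact: fU.
- move=> x [V [oV Vx VW mV]]; have [r r0 rV] := (nrm_openP V).1 oV x Vx.
  by exists r => // y /rV Vy; exists V.
move=> x Wx cx; have [V [g [h [oV Vx hg dh [h' dh' fE]]]]] := mf x.
have [r0 r00 r0V] := open_setI_ball V x oV Vx.
have [r1 r10 r1W] := open_setI_ball W x oW Wx.
pose r := Num.min r0 r1.
have r_gt0 : 0 < r by rewrite lt_min r00.
pose D := [set y : cplx3 R | nrm (x - y) < r].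
have DV : D `<=` V by move=> y; rewrite /D /= lt_min => /andP[/r0V].
have DW : D `<=` W by move=> y; rewrite /D /= lt_min => /andP[_ /r1W].
have oD : open D by exact: nrm_open_ball.
have [y [Vy [oVy Vyy VyW [k dk kE]]] xy] := cx r r_gt0.
(* The cross-multiplied difference of the local fraction [g / h] and [G / Q] is holomorphic on all
   of [D]; it vanishes near [y], hence on the ball [D]. *)
pose N z := g z * Q z - G z * h z.
have hN z : D z -> differentiable N z.
  move=> Dz; apply: holoB; apply: holoM.
  - exact/hg/DV.
  - by case: dQ => + _; apply; exact: DW.
  - exact/hG/DW.
  - by case: dh => + _; apply; exact: DV.
have dhD := denominator_sub V D h DV dh.
have dh'D := denominator_sub V D h' DV dh'.
have dQD := denominator_sub W D Q DW dQ.
have N0 z : (Vy `&` D) z -> N z = 0.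
  have oVD : open (Vy `&` D) by exact: openI.
  have VyD : Vy `&` D `<=` D by move=> w [].
  have VyV : Vy `&` D `<=` Vy by move=> w [].
  pose H w := k w * (h' w * (h w * Q w)).
  apply: (dense_eq0 _ N H oVD).
  - exact: (denominatorM _ _ _ oVD (denominator_sub _ _ _ VyV dk)
      (denominatorM _ _ _ oVD (denominator_sub _ _ _ VyD dh'D)
      (denominatorM _ _ _ oVD (denominator_sub _ _ _ VyD dhD)
        (denominator_sub _ _ _ VyD dQD)))).
  - by move=> w [_ Dw]; apply/holo_cont/hN.
  - move=> w [Vw Dw]; rewrite /H !mulf_eq0 !negb_or => /and4P[k0 h'0 h0 Q0].
    have := kE w Vw k0; rewrite (fE w (DV _ Dw) h'0) /N => /eqP.
    by rewrite eqr_div // => /eqP ->; rewrite mulrC subrr.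
have N0D z : D z -> N z = 0.
  have [d d0 hd] := (nrm_openP (Vy `&` D)).1 (openI oVy oD) y (conj Vyy xy).
  apply: (identity_theorem D N y d) => //; first exact: convex_ball.
  by move=> w /hd; exact: N0.
exists D; split => //; first by rewrite /D /= subrr nrm0.
exists (fun w => h' w * (h w * Q w)).
  exact: (denominatorM _ _ _ oD dh'D (denominatorM _ _ _ oD dhD dQD)).
move=> z Dz; rewrite !mulf_eq0 !negb_or => /and3P[h'0 h0 Q0].
rewrite (fE z (DV _ Dz) h'0); apply/eqP; rewrite eqr_div //.
by rewrite -subr_eq0; apply/eqP; exact: N0D.
Qed.

End AnalyticGeometry.

(** * Polar divisors supported on hyperplanes *)

Section PolarModel.
Context {R : realType}.
Local Notation C := (cplx R).
Implicit Types (V W A B : set (cplx3 R)) (f g h : cplx3 R -> C) (p q z : cplx3 R).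

Definition affine_form (l : cplx3 R -> C) :=
  [/\ forall z, differentiable l z,
      exists z, l z != 0,
      forall p, exists v, 'd l p v <> 0
    & forall p q w, l (q + w *: (p - q)) = l q + w * (l p - l q)].

(* On [dom S] only the finitely many forms indexed by [idx S] can vanish, and [f]
   is [num S] divided by their product. The field [num_neq0] provides on every
   hyperplane a point [p] where the numerator does not vanish, and a point [q] that
   lies on no other hyperplane. *)
Record polar_model (f : cplx3 R -> C) (I : eqType) := PolarModel {
  form : I -> cplx3 R -> C;
  active : pred I;
  dom : nat -> set (cplx3 R);
  idx : nat -> seq I;
  num : nat -> cplx3 R -> C;
  form_affine : forall i, affine_form (form i);
  dom_open : forall S, open (dom S);
  dom_convex : forall S, convex_set (dom S);
  idx_uniq : forall S, uniq (idx S);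
  idx_active : forall S i, i \in idx S -> active i;
  form_neq0 : forall S i z, active i -> dom S z -> i \notin idx S -> form i z != 0;
  dom_cover : forall z, exists S, dom S z;
  idx_cover : forall z i, active i -> exists2 S, dom S z & i \in idx S;
  num_holo : forall S, holomorphic (dom S) (num S);
  num_mero : forall S z, dom S z -> exists V, [/\ open V, V z, V `<=` dom S &
    mero_eq V f (fun w => num S w / \prod_(i <- idx S) form i w)];
  num_neq0 : forall i, active i -> exists S p q,
    [/\ dom S p /\ dom S q, i \in idx S, form i p = 0 /\ form i q = 0,
        num S p != 0 & forall j, active j -> j != i -> form j q != 0] }.

Lemma analytic_setI A B : analytic_set A -> analytic_set B -> analytic_set (A `&` B).
Proof.
move=> aA aB p; have [V [m [F [oV Vp hF AF]]]] := aA p.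
have [W [n [G [oW Wp hG BG]]]] := aB p.
exists (V `&` W), (m + n)%N,
  (fun k => match fintype.split k with inl i => F i | inr j => G j end).
split; [exact: openI|by []|by move=> k z [Vz Wz]; case: (fintype.split k) => i;
  [exact: hF|exact: hG]|].
move=> z [Vz Wz]; split=> [[Az Bz] k|H].
  by case: (fintype.split k) => i; [exact: (AF z Vz).1|exact: (BG z Wz).1].
split; [apply: (AF z Vz).2 => i|apply: (BG z Wz).2 => i].
  by have := H (lshift n i); rewrite (unsplitK (inl i)).
by have := H (rshift m i); rewrite (unsplitK (inr i)).
Qed.

Lemma analytic_zero_set A : (forall p, exists V h, [/\ open V, V p,
    holomorphic V h & forall z, V z -> (A z <-> h z = 0)]) -> analytic_set A.
Proof.
move=> H p; have [V [h [oV Vp hh Ah]]] := H p.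
exists V, 1%N, (fun=> h); split => // z Vz; split; first by move/(Ah z Vz).
by move/(_ ord0)/(Ah z Vz).
Qed.

Lemma analytic_complement_open A p : analytic_set A -> ~ A p ->
  exists2 d : R, 0 < d & forall y, nrm (p - y) < d -> ~ A y.
Proof.
move=> aA nA; have [V [m [F [oV Vp hF AF]]]] := aA p.
have [i Fi] : exists i, F i p != 0.
  apply: contrapT => H; apply/nA/AF => // i.
  by apply/eqP/negP => /negP ?; apply: H; exists i.
have n0 : 0 < nrm (F i p) / 2 by rewrite divr_gt0 // nrm_gt0.
have [e e0 he] := (nrm_continuousP _ _).1 (holo_cont _ _ (hF i p Vp)) _ n0.
have [r r0 rV] := open_setI_ball V p oV Vp.
exists (Num.min e r); first by rewrite lt_min e0.
move=> y; rewrite lt_min => /andP[/he ye /rV Vy] /(AF y Vy)/(_ i) Fy.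
by move: ye; rewrite Fy subr0; have := n0; lra.
Qed.

Lemma diff_eq0_near f p (d : R) : 0 < d ->
  (forall y, nrm (p - y) < d -> f y = 0) -> forall v, 'd f p v = 0.
Proof.
move=> d0 f0 v.
have [||_ ->] // := @bound_differentiable _ _ _ f \0 p.
  by move=> z; exact: cst_continuous.
move=> e e0; exists d => // h hd.
rewrite !f0 ?subrr ?nrm0 ?mulr_ge0 ?nrm_ge0 // ?ltW //.
by rewrite opprD addrA subrr sub0r nrmN.
Qed.

(** If [f] had a holomorphic representative [k], then [g = u * k] near [p], forcing [g p = 0] since
    [u p = 0]. The nonzero differential of [u] ensures that [u] is a denominator, so that the two
    representations can be compared. *)
Lemma pole_not_regular f Z p : Z p -> pole_of_order_at f Z 1 p -> ~ regular_at f p.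
Proof.
move=> Zp [V [u [g [[oV Vp] [hu hg] [uZ [v dv]] gp mf]]]] [W [k [oW Wp hk mk]]].
have up : u p = 0 by apply/uZ.
have [r r0 rD] := open_setI_ball (V `&` W) p (openI oV oW) (conj Vp Wp).
pose D := [set y : cplx3 R | nrm (p - y) < r].
have oD : open D by exact: nrm_open_ball.
have DV : D `<=` V by move=> z /rD[].
have DW : D `<=` W by move=> z /rD[].
have Dp : D p by rewrite /D /= subrr nrm0.
have [a Da ua] : exists2 a, D a & u a != 0.
  apply: contrapT => H; apply: dv; apply: (diff_eq0_near u p r r0) => y yr.
  by apply/eqP/negP => /negP ua; apply: H; exists y.
have du : denominator D u.
  apply: (nonzero_denominator D u a oD _ _ Da ua); first exact: convex_ball.
  by move=> z /DV/hu.
have [h1 d1 E1] := mero_eq_sub _ _ _ _ DV mf.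
have [h2 d2 E2] := mero_eq_sub _ _ _ _ DW mk.
have N0 : forall z, D z -> g z - u z * k z = 0.
  apply: (dense_eq0 D _ (fun z => u z * (h1 z * h2 z)) oD).
  - exact: (denominatorM _ _ _ oD du (denominatorM _ _ _ oD d1 d2)).
  - move=> z Dz; apply/holo_cont/holoB; first exact/hg/DV.
    by apply: holoM; [exact/hu/DV|exact/hk/DW].
  - move=> z Dz; rewrite !mulf_eq0 !negb_or => /and3P[u0 h10 h20].
    by rewrite -(E2 z Dz h20) (E1 z Dz h10) expr1 mulrC divfK // subrr.
by move: (N0 p Dp); rewrite up mul0r subr0 => /eqP; rewrite (negbTE gp).
Qed.

Section Components.
Context (f : cplx3 R -> C) (I : eqType) (M : polar_model f I).

Local Notation form := (form f I M).
Local Notation active := (active f I M).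
Local Notation dom := (dom f I M).
Local Notation idx := (idx f I M).
Local Notation num := (num f I M).

Definition hyperplane i := [set z | form i z = 0].

Definition cofactor S i z := \prod_(j <- idx S | j != i) form j z.

Lemma idx_prodE S i z : i \in idx S ->
  \prod_(j <- idx S) form j z = form i z * cofactor S i z.
Proof. by move=> iS; rewrite (bigD1_seq i) ?idx_uniq. Qed.

Lemma form_holo i z : differentiable (form i) z.
Proof. by case: (form_affine f I M i). Qed.

Lemma cofactor_holo S i z : differentiable (cofactor S i) z.
Proof. by apply: holo_prod => j _; exact: form_holo. Qed.

Lemma form_denominator V i : denominator V (form i).
Proof.
have [d [a fa] _ _] := form_affine f I M i.
apply: denominator_sub (nonzero_denominator setT (form i) a openT (@convex_setT _ _) _ _ fa) => //.
Qed.

Lemma cofactor_neq0P S i z : dom S z ->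
  (cofactor S i z = 0 <-> exists j, [/\ active j, j != i & form j z = 0]).
Proof.
move=> Sz; split.
  move=> /eqP; rewrite /cofactor prodf_seq_eq0 => /hasP[j jS /andP[ji /eqP j0]].
  by exists j; split => //; exact: idx_active jS.
move=> [j [aj ji j0]]; apply/eqP; rewrite /cofactor prodf_seq_eq0.
have jS : j \in idx S.
  by apply: contraT => /(form_neq0 f I M S j z aj Sz); rewrite j0 eqxx.
by apply/hasP; exists j => //; rewrite ji j0 eqxx.
Qed.

Lemma local_pole S i z : dom S z -> i \in idx S -> cofactor S i z != 0 ->
  exists V, [/\ open V, V z, V `<=` dom S,
    holomorphic V (fun w => num S w / cofactor S i w)
    & mero_eq V f (fun w => (num S w / cofactor S i w) / form i w)].
Proof.
move=> Sz iS cz; have [V [oV Vz VS mV]] := num_mero f I M S z Sz.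
have n0 : 0 < nrm (cofactor S i z) / 2 by rewrite divr_gt0 // nrm_gt0.
have [e e0 he] := (nrm_continuousP _ _).1 (holo_cont _ _ (cofactor_holo S i z)) _ n0.
pose B := [set y : cplx3 R | nrm (z - y) < e].
exists (V `&` B); split => //.
- by apply: openI => //; exact: nrm_open_ball.
- by split => //; rewrite /B /= subrr nrm0.
- by move=> w [/VS].
- move=> w [/VS Sw Bw]; apply: holo_div; [exact: num_holo|exact: cofactor_holo|].
  apply: contraTneq (he w Bw) => ->.
  by rewrite subr0 -ltNge ltr_pdivrMr // mulr2n mulrDr mulr1 ltrDl nrm_gt0.
- have [h dh hE] := mero_eq_sub _ (V `&` B) _ _ (fun w => @proj1 _ _) mV.
  exists h => // w Vw hw; rewrite (hE w Vw hw) (idx_prodE S i w iS) -mulrA; congr (_ * _).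
  by rewrite invfM mulrC.
Qed.

Lemma local_residue S i z : dom S z -> i \in idx S -> cofactor S i z != 0 ->
  exists V, [/\ open V, V z,
    holomorphic V (fun w => num S w / cofactor S i w)
    & mero_eq V (fun w => form i w * f w) (fun w => num S w / cofactor S i w)].
Proof.
move=> Sz iS cz; have [V [oV Vz VS hV [h dh hE]]] := local_pole S i z Sz iS cz.
exists V; split => //; exists (fun w => form i w * h w).
  by apply: denominatorM => //; exact: form_denominator.
move=> w Vw; rewrite mulf_eq0 negb_or => /andP[fi /(hE w Vw) ->].
by rewrite mulrC divfK.
Qed.

(** Points on another hyperplane, or zeros of a holomorphic representative of [form i * f]. No index
    [S] enters, so this is one set on all of the space; on a [dom S] with [i] in [idx S] it is the
    zero set of [cofactor S i * num S], hence analytic. *)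
Definition exceptional i := [set z |
  (exists j, [/\ active j, j != i & form j z = 0]) \/
  exists V g, [/\ open V, V z, holomorphic V g,
    mero_eq V (fun w => form i w * f w) g & g z = 0]].

Lemma exceptionalE S i z : dom S z -> i \in idx S ->
  (exceptional i z <-> cofactor S i z * num S z = 0).
Proof.
move=> Sz iS; split.
  move=> [H|[V [g [oV Vz hg mg gz]]]].
    by rewrite ((cofactor_neq0P S i z Sz).2 H) mul0r.
  have [->|cz] := eqVneq (cofactor S i z) 0; first by rewrite mul0r.
  have [W [oW Wz hW mW]] := local_residue S i z Sz iS cz.
  have VWV : V `&` W `<=` V by move=> w [].
  have VWW : V `&` W `<=` W by move=> w [].
  have := @mero_eq_unique R (V `&` W) _ _ _ (openI oV oW) _ _
    (mero_eq_sub _ _ _ _ VWV mg) (mero_eq_sub _ _ _ _ VWW mW) z (conj Vz Wz).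
  rewrite gz => /(_ _ _)/esym/eqP; rewrite mulf_eq0 invr_eq0 (negbTE cz) orbF.
  move=> H; apply/eqP; rewrite mulf_eq0; apply/orP; right; apply: H.
    by move=> w [/hg dg _]; exact: holo_cont.
  by move=> w [_ /hW dW]; exact: holo_cont.
move=> /eqP; rewrite mulf_eq0; case: eqVneq => [/(cofactor_neq0P S i z Sz)|cz /eqP nz].
  by left.
right; have [W [oW Wz hW mW]] := local_residue S i z Sz iS cz.
by exists W, (fun w => num S w / cofactor S i w); split => //; rewrite nz mul0r.
Qed.

Lemma exceptional_analytic i : active i -> analytic_set (exceptional i).
Proof.
move=> ai; apply: analytic_zero_set => p; have [S Sp iS] := idx_cover f I M p i ai.
exists (dom S), (fun w => cofactor S i w * num S w); split => //.
- exact: dom_open.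
- move=> z Sz; apply: holoM; [exact: cofactor_holo|exact: num_holo].
- by move=> z Sz; exact: exceptionalE.
Qed.

Lemma hyperplane_line i p q w : hyperplane i p -> hyperplane i q ->
  hyperplane i (q + w *: (p - q)).
Proof.
have [_ _ _ l] := form_affine f I M i.
by rewrite /hyperplane /= l => -> ->; rewrite subrr mulr0 addr0.
Qed.

Lemma union_analytic (J : pred I) :
  analytic_set [set z | exists j, [/\ active j, J j & form j z = 0]].
Proof.
apply: analytic_zero_set => p; have [S Sp] := dom_cover f I M p.
exists (dom S), (fun z => \prod_(j <- idx S | J j) form j z); split => //.
- exact: dom_open.
- by move=> z _; apply: holo_prod => j _; exact: form_holo.
move=> z Sz; split.
  move=> [j [aj Jj j0]]; apply/eqP; rewrite prodf_seq_eq0; apply/hasP.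
  exists j; last by rewrite Jj j0 eqxx.
  by apply: contraT => /(form_neq0 f I M S j z aj Sz); rewrite j0 eqxx.
move=> /eqP; rewrite prodf_seq_eq0 => /hasP[j jS /andP[Jj /eqP j0]].
by exists j; split => //; exact: idx_active jS.
Qed.

Lemma hyperplane_analytic i : analytic_set (hyperplane i).
Proof.
apply: analytic_zero_set => p; exists setT, (form i); split => //.
  exact: openT.
by move=> z _; exact: form_holo.
Qed.

(** On the line from [p] to [q] inside the hyperplane, the cofactor is nonzero at [q], hence at
    points arbitrarily close to [p], and close enough to [p] the numerator is nonzero too. *)
Lemma generic_point i : active i -> exists2 r, hyperplane i r & ~ exceptional i r.
Proof.
move=> ai; have [S [p [q [[Sp Sq] iS [fp fq] np jq]]]] := num_neq0 f I M i ai.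
pose line (w : C) := p + w *: (q - p).
pose D := [set w : C | dom S (line w)].
have line0 : line 0 = p by rewrite /line scale0r addr0.
have line1 : line 1 = q by rewrite /line scale1r addrC subrK.
have oD : open D.
  apply/nrm_openP => w Dw; have [r r0 rV] := (nrm_openP _).1 (dom_open f I M S) _ Dw.
  have [e e0 he] := nrm_ge_lt _ _ (nrm_ge0 (q - p)) r0.
  exists e => // v wv; apply: rV; rewrite /line opprD addrACA subrr add0r -scalerBl nrmZ.
  by apply: le_lt_trans he; rewrite ler_wpM2r ?nrm_ge0 // ltW.
have cD : convex_set D.
  move=> a b t Da Db t01; rewrite /D /=.
  have -> : line (a + RtoC t *: (b - a)) = line a + RtoC t *: (line b - line a).
    rewrite /line [- (p + _)]opprD [p + b *: _ + _]addrACA subrr add0r -scalerBl scalerA.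
    by rewrite -addrA -scalerDl.
  exact: (dom_convex f I M S).
have dline (g : cplx3 R -> C) w : differentiable g (line w) -> differentiable (g \o line) w.
  by move=> dg; have [] := line_differentiable g p (q - p) w dg.
have cof1 : cofactor S i (line 1) != 0.
  rewrite line1; apply/eqP => /(cofactor_neq0P S i q Sq)[j [aj ji j0]].
  by have := jq j aj ji; rewrite j0 eqxx.
have n0 : 0 < nrm (num S p) / 2 by rewrite divr_gt0 // nrm_gt0.
have D0 : D 0 by rewrite /D /= line0.
have dn0 : differentiable (num S \o line) 0.
  by apply: dline; rewrite line0; exact: num_holo.
have [e e0 he] := (nrm_continuousP _ _).1 (holo_cont _ _ dn0) _ n0.
have [||y [Dy y0 cy]] :=
  @nonvanishing_dense R C D (cofactor S i \o line) 1 0 e oD cD _ _ cof1 D0 e0.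
- by move=> w _; apply: dline; exact: cofactor_holo.
- by rewrite /D /= line1.
exists (line y); first by apply: hyperplane_line.
move=> /(exceptionalE S i _ Dy iS) /eqP; rewrite mulf_eq0 (negbTE cy) /= => /eqP ny.
have := he y y0; rewrite /= ny subr0 line0.
by rewrite leNgt ltr_pdivrMr // mulr2n mulrDr mulr1 ltrDl nrm_gt0 np.
Qed.

Lemma nonexceptional_dense i q (d : R) : active i -> hyperplane i q -> 0 < d ->
  exists y, [/\ hyperplane i y, ~ exceptional i y & nrm (q - y) < d].
Proof.
move=> ai Hq d0; have [r Hr nr] := generic_point i ai.
have [e e0 he] := nrm_ge_lt _ _ (nrm_ge0 (r - q)) d0.
have [w we nw] := analytic_set_line _ r q e (exceptional_analytic i ai) nr e0.
exists (q + w *: (r - q)); split => //; first exact: hyperplane_line.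
rewrite opprD addrA subrr sub0r nrmN nrmZ.
by apply: le_lt_trans he; rewrite ler_wpM2r ?nrm_ge0 // ltW.
Qed.

(** Take [a] outside [B1] and [b] outside [B2]. The line from [b] to [a] stays in the hyperplane;
    near [b] it avoids [B2], and it contains points arbitrarily close to [b] that avoid [B1]. *)
Lemma hyperplane_irreducible i : active i -> irreducible_analytic (hyperplane i).
Proof.
move=> ai; split; first exact: hyperplane_analytic.
  by have [r Hr _] := generic_point i ai; exists r.
move=> B1 B2 aB1 aB2 HB; apply: contrapT => /not_orP[n1 n2].
have sub (B B' : set (cplx3 R)) : hyperplane i = B `|` B' -> hyperplane i <> B ->
    exists2 a, hyperplane i a & ~ B a.
  move=> E nB; apply: contrapT => H; apply: nB; rewrite eqEsubset; split => z Hz.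
    by apply: contrapT => nz; apply: H; exists z.
  by rewrite E; left.
have [a Ha na] := sub _ _ HB n1.
have [b Hb nb] : exists2 b, hyperplane i b & ~ B2 b by apply: (sub _ B1); rewrite 1?setUC.
have [d d0 hd] := analytic_complement_open B2 b aB2 nb.
have [e e0 he] := nrm_ge_lt _ _ (nrm_ge0 (a - b)) d0.
have [w we nw] := analytic_set_line _ a b e aB1 na e0.
have := hyperplane_line i a b w Ha Hb; rewrite HB => -[//|]; apply: hd.
rewrite opprD addrA subrr sub0r nrmN nrmZ.
by apply: le_lt_trans he; rewrite ler_wpM2r ?nrm_ge0 // ltW.
Qed.

Lemma hyperplane_pole i z : active i -> hyperplane i z -> ~ exceptional i z ->
  pole_of_order_at f (hyperplane i) 1 z.
Proof.
move=> ai Hz nz; have [S Sz iS] := idx_cover f I M z i ai.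
have : cofactor S i z * num S z != 0 by apply/eqP => /(exceptionalE S i z Sz iS).
rewrite mulf_eq0 negb_or => /andP[cz numz].
have [V [oV Vz VS hV mV]] := local_pole S i z Sz iS cz.
have [_ _ dv _] := form_affine f I M i.
exists V, (form i), (fun w => num S w / cofactor S i w); split => //.
- by split => // w _; exact: form_holo.
- by rewrite mulf_neq0 // invr_neq0.
Qed.

Lemma regular_at_open p : regular_at f p -> exists2 d : R, 0 < d &
  forall y, nrm (p - y) < d -> regular_at f y.
Proof.
move=> [V [g [oV Vp hg mg]]]; have [r r0 rV] := open_setI_ball V p oV Vp.
by exists r => // y /rV Vy; exists V, g.
Qed.

(** Regularity is an open condition, so a regular point of the hyperplane would have regular
    non-exceptional points of the hyperplane next to it, and those are simple poles. *)
Lemma hyperplane_polar i : active i -> hyperplane i `<=` polar_set f.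
Proof.
move=> ai q Hq /regular_at_open[d d0 hd].
have [y [Hy ny qy]] := nonexceptional_dense i q d ai Hq d0.
by apply: (pole_not_regular f (hyperplane i) y Hy) (hd y qy); exact: hyperplane_pole.
Qed.

Lemma polar_hyperplane z : polar_set f z -> exists2 i, active i & hyperplane i z.
Proof.
move=> nz; apply: contrapT => H; apply: nz; have [S Sz] := dom_cover f I M z.
have [V [oV Vz VS mV]] := num_mero f I M S z Sz.
pose Q w := \prod_(i <- idx S) form i w.
have Qz : Q z != 0.
  apply/eqP => /eqP; rewrite /Q prodf_seq_eq0 => /hasP[i iS /eqP i0].
  by apply: H; exists i => //; exact: idx_active iS.
have dQ w : differentiable Q w by apply: holo_prod => i _; exact: form_holo.
have n0 : 0 < nrm (Q z) / 2 by rewrite divr_gt0 // nrm_gt0.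
have [e e0 he] := (nrm_continuousP _ _).1 (holo_cont _ _ (dQ z)) _ n0.
pose B := [set y : cplx3 R | nrm (z - y) < e].
exists (V `&` B), (fun w => num S w / Q w); split.
- by apply: openI => //; exact: nrm_open_ball.
- by split => //; rewrite /B /= subrr nrm0.
- move=> w [/VS Sw Bw]; apply: holo_div; [exact: num_holo|exact: dQ|].
  apply: contraTneq (he w Bw) => ->.
  by rewrite subr0 -ltNge ltr_pdivrMr // mulr2n mulrDr mulr1 ltrDl nrm_gt0.
- by apply: mero_eq_sub mV => w [].
Qed.

Lemma irreducible_in_union (J K : pred I) Y : irreducible_analytic Y ->
  (forall y, Y y -> exists j, [/\ active j, J j || K j & form j y = 0]) ->
  Y `<=` [set z | exists j, [/\ active j, J j & form j z = 0]] \/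
  Y `<=` [set z | exists j, [/\ active j, K j & form j z = 0]].
Proof.
move=> [aY _ irr] YP.
have [] := irr _ _ (analytic_setI _ _ aY (union_analytic J))
  (analytic_setI _ _ aY (union_analytic K)) _.
- rewrite -setIUr; apply/esym/setIidPl => z /YP[j [aj /orP[Jj|Kj] jz]].
    by left; exists j.
  by right; exists j.
- by move=> E; left; rewrite E => z [].
- by move=> E; right; rewrite E => z [].
Qed.

(** Fix a point of [Y] in [dom S]. The hyperplanes indexed by [idx S] and the remaining ones form
    two analytic unions, and the second misses that point, so [Y] lies in the first. That union is
    finite, and induction on the list isolates one hyperplane. *)
Lemma irreducible_in_hyperplane Y : irreducible_analytic Y -> Y `<=` polar_set f ->
  exists2 i, active i & Y `<=` hyperplane i.
Proof.
move=> iY YP; have [_ [z Yz] _] := iY; have [S Sz] := dom_cover f I M z.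
have : Y `<=` [set z | exists j, [/\ active j, j \in idx S & form j z = 0]].
  have [|//|H] := irreducible_in_union (mem (idx S)) (predC (mem (idx S))) Y iY.
    by move=> y /YP /polar_hyperplane[j aj jy]; exists j; split => //=; exact: orbN.
  have [j [aj jS j0]] := H z Yz.
  by have := form_neq0 f I M S j z aj Sz jS; rewrite j0 eqxx.
elim: (idx S) => [H|j s IH H]; first by have [? []] := H z Yz.
have [y /H[k [ak]]||] := irreducible_in_union (pred1 j) (mem s) Y iY.
- by rewrite inE => kj k0; exists k.
- move=> H1; have [k [ak /eqP kj _]] := H1 z Yz; exists j; first by rewrite -kj.
  by move=> y /H1[k' [_ /eqP <-]].
- exact: IH.
Qed.

Lemma hyperplane_inj i j : active i -> active j ->
  hyperplane i `<=` hyperplane j -> i = j.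
Proof.
move=> ai aj ij; have [r Hr nr] := generic_point i ai.
by apply: contrapT => /eqP nij; apply: nr; left; exists j; rewrite eq_sym; split => //; exact: ij.
Qed.

Theorem polar_components Z : polar_component f Z <->
  exists2 i, active i & Z = hyperplane i.
Proof.
split=> [[iZ ZP maxZ]|[i ai ->]].
  have [i ai Zi] := irreducible_in_hyperplane Z iZ ZP; exists i => //.
  by apply/esym/maxZ => //; [exact: hyperplane_irreducible|exact: hyperplane_polar].
split; [exact: hyperplane_irreducible|exact: hyperplane_polar|].
move=> Y iY YP iY'; have [j aj Yj] := irreducible_in_hyperplane Y iY YP.
have ij : i = j by apply: hyperplane_inj => // z /iY'/Yj.
by rewrite eqEsubset; split => //; rewrite ij.
Qed.

Theorem hyperplane_generically_simple i : active i ->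
  generically_simple f (hyperplane i).
Proof.
move=> ai; exists (exceptional i); split; first exact: exceptional_analytic.
  by have [r Hr nr] := generic_point i ai => /(_ r Hr).
by move=> p; exact: hyperplane_pole.
Qed.

End Components.
End PolarModel.

(** * Euler-Maclaurin summation *)

Section BernoulliNumbers.
Context {R : realType}.

Fixpoint bernoulli_list (n : nat) : seq R :=
  if n is m.+1 then
    let s := bernoulli_list m in
    rcons s (if m is k.+1
             then (- s`_k - \sum_(1 <= i < k.+1) s`_i * s`_(k.+1 - i)) / k.+2%:R
             else 1)
  else [::].

(* [bern n] is the Bernoulli number [B_n] (with [B_1 = -1/2]) divided by [n!]. The
   defining recursion is Euler's quadratic one, the coefficient form of the
   equation [x b' = b - x b - b^2] satisfied by [b = x / (e^x - 1)]; it makes the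
   signs of the [bern n] visible. *)
Definition bern (n : nat) : R := (bernoulli_list n.+1)`_n.

Lemma size_bernoulli_list n : size (bernoulli_list n) = n.
Proof. by elim: n => //= n IH; rewrite size_rcons IH. Qed.

Lemma nth_bernoulli_list n i : (i < n)%N -> (bernoulli_list n)`_i = bern i.
Proof.
elim: n => // n IH; rewrite ltnS leq_eqVlt => /predU1P[->//|lt_in].
by rewrite [bernoulli_list _]/= nth_rcons size_bernoulli_list lt_in IH.
Qed.

Lemma bern0 : bern 0 = 1. Proof. by []. Qed.

Lemma bernS n : bern n.+1 * n.+2%:R =
  - bern n - \sum_(1 <= i < n.+1) bern i * bern (n.+1 - i).
Proof.
rewrite /bern [bernoulli_list n.+2]/= -/(bernoulli_list n.+1) nth_rcons.
rewrite size_bernoulli_list ltnn eqxx divfK ?pnatr_eq0 // -/(bern n).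
congr (_ - _); apply: eq_big_nat => i /andP[i0 lt_in].
by rewrite !nth_bernoulli_list //; lia.
Qed.

Lemma bern1 : bern 1 = - 2^-1.
Proof.
apply: (mulIf (_ : 2%:R != 0 :> R)); first by rewrite pnatr_eq0.
by rewrite bernS big_geq // bern0 subr0 mulNr mulVf // pnatr_eq0.
Qed.

Lemma bern2 : bern 2 = 12^-1.
Proof.
apply: (mulIf (_ : 3%:R != 0 :> R)); first by rewrite pnatr_eq0.
by rewrite bernS big_nat1 subn1 bern1; field.
Qed.

(* The terms [i = 1] and [i = n + 2] of the recursion cancel against [- bern (n + 2)]. *)
Lemma bernSSS n : bern n.+3 * n.+4%:R =
  - \sum_(2 <= i < n.+2) bern i * bern (n.+3 - i).
Proof.
rewrite bernS big_nat_recr //= big_ltn // subSS subn0 subSnn bern1.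
set s := \sum_(_ <= _ < _) _; rewrite (_ : s = \sum_(2 <= i < n.+2) bern i * bern (n.+3 - i)) //.
by field.
Qed.

(** For an odd total index every product in [bernSSS] has a factor of odd index at least [3], which
    vanishes by induction. *)
Lemma bern_odd n : odd n -> (2 < n)%N -> bern n = 0.
Proof.
elim/ltn_ind: n => -[|[|[|n]]] // IH odd_n _.
apply: (mulIf (_ : n.+4%:R != 0 :> R)); first by rewrite pnatr_eq0.
rewrite bernSSS mul0r big1_seq ?oppr0 // => i; rewrite mem_index_iota => /andP[_ /andP[i2 lt_i]].
case odd_i : (odd i).
  by rewrite IH ?mul0r //; lia.
by rewrite (IH (n.+3 - i)%N) ?mulr0 //; lia.
Qed.

(** In [bernSSS] the products of odd index vanish and, by induction, those of even index all have
    the same sign, so nothing cancels; the product with [i = 2] is nonzero. *)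
Lemma bern_even_sign m : 0 < (-1) ^+ m * bern (m.+1).*2.
Proof.
elim/ltn_ind: m => -[_|m IH].
  by rewrite expr0 mul1r bern2 invr_gt0.
have -> : (m.+2).*2 = (m.*2.+1).+3 by rewrite !doubleS.
rewrite -(pmulr_lgt0 _ (ltr0Sn R (m.*2.+1).+3)) -mulrA bernSSS.
rewrite mulrN -mulNr -mulN1r -exprS mulr_sumr.
have t0 i : (2 <= i < (m.*2.+1).+2)%N ->
    0 <= (-1) ^+ m.+2 * (bern i * bern ((m.*2.+1).+3 - i)).
  move=> i_in; case odd_i : (odd i).
    by rewrite bern_odd ?mul0r ?mulr0 //; lia.
  have [j ij] : exists j, i = j.+1.*2 by exists i./2.-1; lia.
  have -> : ((m.*2.+1).+3 - i = (m - j).+1.*2)%N by lia.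
  have -> : (-1) ^+ m.+2 = (-1) ^+ j * (-1) ^+ (m - j) :> R.
    by rewrite -exprD subnKC ?exprS ?mulN1r ?opprK //; lia.
  rewrite ij mulrACA mulr_ge0 // ltW // IH //; lia.
rewrite big_ltn // ltr_pwDl //; last first.
  by rewrite big_seq sumr_ge0 // => i; rewrite mem_index_iota => i_in; apply: t0; lia.
have -> : ((m.*2.+1).+3 - 2 = m.+1.*2)%N by lia.
rewrite (_ : (-1) ^+ m.+2 = (-1) ^+ m :> R); last by rewrite !exprS !mulN1r opprK.
by rewrite mulrCA mulr_gt0 ?IH // bern2 invr_gt0.
Qed.

Lemma bern_even_neq0 m : bern m.*2 != 0.
Proof.
case: m => [|m]; first by rewrite bern0 oner_eq0.
by have := bern_even_sign m; apply: contraTneq => ->; rewrite mulr0 ltxx.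
Qed.

Lemma bern_neq0 k : bern k != 0 <-> k = 1%N \/ ~~ odd k.
Proof.
split=> [bk|[->|k_even]].
- case odd_k : (odd k); [left|by right].
  case: k odd_k bk => [|[|[|k]]] // odd_k.
  by rewrite bern_odd // eqxx.
- by rewrite bern1 oppr_eq0 invr_eq0 pnatr_eq0.
- by rewrite -(even_halfK k_even) bern_even_neq0.
Qed.

(** The identity [x / (e^x - 1) * ((e^x - 1) / x) = 1], coefficient by coefficient. Modulo [x ^ N]
    the truncations satisfy [x G' = G - x G - G^2] and [x E' = 1 + x E - E], so [D = G E - 1]
    satisfies [x D' = - G D]. As [G] has constant term [1], this reads [(n + 1) D_n = 0] once the
    lower coefficients vanish. *)
Lemma bern_conv L : \sum_(k < L.+1) bern k / ((L.+1 - k)`!)%:R = (L == 0%N)%:R.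
Proof.
pose N := L.+1.
pose G := \poly_(i < N) bern i; pose E := \poly_(i < N) (i.+1`!%:R : R)^-1.
pose cong (p q : {poly R}) := forall n, (n < N)%N -> p`_n = q`_n.
have congM p q p' q' : cong p p' -> cong q q' -> cong (p * q) (p' * q').
  move=> cp cq n nN; rewrite !coefM; apply: eq_bigr => -[i /= i_n] _.
  by rewrite cp ?cq // (leq_ltn_trans _ nN) // ?leq_subr.
have coefXD (p : {poly R}) n : ('X * p^`())`_n = n%:R * p`_n.
  by rewrite coefXM; case: n => [|n]; rewrite ?mul0r // coef_deriv mulr_natl.
have dG : cong ('X * G^`()) (G - 'X * G - G * G).
  move=> n nN; rewrite coefXD !coefB coefXM coefM.
  have Gc i : (i <= n)%N -> G`_i = bern i by move=> i_n; rewrite coef_poly (leq_ltn_trans i_n).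
  rewrite (eq_bigr (fun i : 'I_n.+1 => bern i * bern (n - i))); last first.
    by move=> [i /= i_n] _; rewrite !Gc ?leq_subr.
  rewrite Gc //; case: n nN Gc => [|n] nN Gc.
    by rewrite big_ord1 subnn bern0 /=; ring.
  rewrite /= Gc // -(big_mkord xpredT (fun i => bern i * bern (n.+1 - i))).
  rewrite big_nat_recr //= big_ltn // subn0 subnn bern0.
  have := bernS n; rewrite -[n.+2%:R]natr1 mulrDr mulr1 (mulrC (bern n.+1)).
  by move: (\sum_(_ <= _ < _) _) (_ * _) => a b H; lra.
have dE : cong ('X * E^`()) (1 + 'X * E - E).
  move=> n nN; rewrite coefXD coefB coefD coefXM coef1 coef_poly nN.
  case: n nN => [|n] nN; first by rewrite /= mul0r invr1; ring.
  rewrite /= coef_poly (ltnW nN) add0r (factS n.+1) natrM invfM.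
  rewrite -[n.+2%:R]natr1; field.
  by rewrite nat1r natr1 !pnatr_eq0 -lt0n fact_gt0.
pose D := G * E - 1.
have dD : cong ('X * D^`()) (- (G * D)).
  have -> : 'X * D^`() = ('X * G^`()) * E + G * ('X * E^`()).
    by rewrite /D derivB derivM -[1]/(1%:P) derivC; ring.
  have -> : - (G * D) = (G - 'X * G - G * G) * E + G * (1 + 'X * E - E).
    by rewrite /D; ring.
  by move=> n nN; rewrite !coefD; congr (_ + _); apply: congM.
have D0 n : (n < N)%N -> D`_n = 0.
  elim/ltn_ind: n => n IH nN.
  have := dD n nN; rewrite coefXD coefN coefM big_ord_recl subn0 coef_poly bern0 mul1r.
  rewrite big1 ?addr0; last first.
    by move=> [i /= i_n] _; rewrite IH ?mulr0 //= /bump; lia.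
  move=> H; apply: (mulfI (_ : n.+1%:R != 0 :> R)); first by rewrite pnatr_eq0.
  by rewrite mulr0 -natr1 mulrDl H mul1r addNr.
have := D0 L (ltnSn L); rewrite /D coefB coef1 => /eqP; rewrite subr_eq0 => /eqP <-.
rewrite coefM; apply: eq_bigr => -[i /= i_L] _.
rewrite !coef_poly i_L; have -> : (L - i < N)%N by rewrite /N; lia.
by rewrite subSn.
Qed.

End BernoulliNumbers.

(** * Complex powers of integers and derivatives along the real line *)

Section Powers.
Context {R : realType}.
Local Notation C := (cplx R).
Implicit Types (s a : C) (n : nat) (x y t : R).

Lemma npowND n s (r : C) : npowN n (s + r) = npowN n s * npowN n r.
Proof. by rewrite /npowN opprD mulrDl cexpD. Qed.

Lemma npowN0 n : npowN n (0 : C) = 1.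
Proof. by rewrite /npowN oppr0 mul0r cexp0. Qed.

Lemma npowN_1 s : npowN 1 s = 1.
Proof. by rewrite /npowN ln1 mulr0 cexp0. Qed.

Lemma nrm_npowN n s : nrm (npowN n s) = expR (- complex.Re s * ln n%:R).
Proof. by rewrite /npowN nrm_cexp; congr expR; case: s => a b /=; ring. Qed.

Lemma npowN_natr n (k : nat) : (0 < n)%N -> npowN n (k%:R : C) = (n%:R ^+ k)^-1.
Proof.
move=> n0; rewrite /npowN mulNr cexpN; congr (_^-1).
elim: k => [|k IH]; first by rewrite mul0r cexp0.
rewrite exprS -IH -[k.+1%:R]nat1r mulrDl cexpD mul1r; congr (_ * _).
rewrite /cexp /= cos0 sin0 mulr1 mulr0 lnK ?posrE ?ltr0n //.
exact: RtoC_nat.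
Qed.

(** Writing the exponent as a difference of naturals lets one bound cover growth ([q = 0]) and decay
    ([p = 0]). *)
Lemma nrm_npowN_le n s (p q : nat) : (0 < n)%N ->
  q%:R - p%:R <= complex.Re s -> nrm (npowN n s) <= n%:R ^+ p / n%:R ^+ q.
Proof.
move=> n0 h; rewrite nrm_npowN.
have nE (k : nat) : n%:R ^+ k = expR (k%:R * ln n%:R) :> R.
  by rewrite expRM_natl lnK // posrE ltr0n.
rewrite !nE -expRN -expRD ler_expR -mulrBl.
by rewrite ler_wpM2r ?ln_ge0 ?ler1n //; lra.
Qed.

Lemma npowN_holo n s : differentiable (fun z : C => npowN n z) s.
Proof.
apply: (@differentiable_comp _ _ _ _ (fun z : C => - z * RtoC (ln n%:R)) (@cexp R)).
  by apply: holoM; [apply: holoN; exact: holo_id|exact: holo_cst].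
exact: differentiable_cexp.
Qed.

(** The derivative of a complex function of a real variable, spelled out because the source is a
    normed module over [R] and the target one over [cplx R]. *)
Definition cderiv (h : R -> C) x (dh : C) := forall e : R, 0 < e ->
  exists2 d : R, 0 < d & forall t, `|t| < d ->
    nrm (h (x + t) - h x - RtoC t * dh) <= e * `|t|.

Lemma bound_is_derive (f : R -> R) x (df : R) :
  (forall e : R, 0 < e -> exists2 d : R, 0 < d & forall t, `|t| < d ->
     `|f (x + t) - f x - t * df| <= e * `|t|) -> is_derive x 1 f df.
Proof.
move=> H.
have cv : (fun h : R => h^-1 *: (f (h *: (1 : R) + x) - f x)) @ 0^' --> df.
  apply/cvgrPdist_le => e e0; have [d d0 hd] := H e e0.
  near=> h.
  have h0 : h != 0 by near: h; exact: nbhs_dnbhs_neq.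
  have hd' : `|h| < d.
    near: h; apply: dnbhs0_lt => //.
  rewrite /GRing.scale /= mulr1 (addrC h) distrC.
  rewrite (_ : _ - df = h^-1 * (f (x + h) - f x - h * df)); last by field.
  rewrite normrM normfV ler_pdivrMl ?normr_gt0 // [leRHS]mulrC; exact: hd.
apply: DeriveDef; first by apply/cvg_ex; exists df.
exact: cvg_lim cv.
Unshelve. all: by end_near. Qed.

Lemma cderiv_Re h x dh : cderiv h x dh ->
  is_derive x 1 (fun t => complex.Re (h t)) (complex.Re dh).
Proof.
move=> H; apply: bound_is_derive => e /H[d d0 hd]; exists d => // t /hd.
apply: le_trans; apply: etrans (Re_le_nrm _); congr (`| _ | <= _).
by rewrite !ReD !ReN ReM /=; ring.
Qed.

Lemma cderiv_Im h x dh : cderiv h x dh ->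
  is_derive x 1 (fun t => complex.Im (h t)) (complex.Im dh).
Proof.
move=> H; apply: bound_is_derive => e /H[d d0 hd]; exists d => // t /hd.
apply: le_trans; apply: etrans (Im_le_nrm _); congr (`| _ | <= _).
by rewrite !ImD !ImN ImM /=; ring.
Qed.

Lemma mean_value_bound (f df : R -> R) x (B : R) : 0 <= x ->
  (forall y, 0 <= y <= x -> is_derive y 1 f (df y)) ->
  (forall y, 0 <= y <= x -> `|df y| <= B) -> `|f x - f 0| <= B * x.
Proof.
move=> x0 dfE dB.
have [||y yx ->] := @MVT_segment R f df 0 x x0.
- by move=> y; rewrite in_itv /= => /andP[y0 yx]; apply: dfE; rewrite !ltW.
- apply: continuous_in_subspaceT => y; rewrite inE /= in_itv /= => /dfE[D _].
  by apply: differentiable_continuous; apply/derivable1_diffP.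
rewrite subr0 normrM (ger0_norm x0) ler_wpM2r // dB //.
Qed.

Lemma cderiv_mean_value (h dh : R -> C) x (B : R) : 0 <= x ->
  (forall y, 0 <= y <= x -> cderiv h y (dh y)) ->
  (forall y, 0 <= y <= x -> nrm (dh y) <= B) -> nrm (h x - h 0) <= 2 * B * x.
Proof.
move=> x0 dhE dB; rewrite (le_trans (nrm_le_ReIm _)) // ReD ImD ReN ImN.
have -> : 2 * B * x = B * x + B * x by ring.
apply: lerD.
  apply: (mean_value_bound (fun y => complex.Re (h y)) (fun y => complex.Re (dh y)) x B x0) => y yx.
    exact/cderiv_Re/dhE.
  exact: le_trans (Re_le_nrm _) (dB y yx).
apply: (mean_value_bound (fun y => complex.Im (h y)) (fun y => complex.Im (dh y)) x B x0) => y yx.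
  exact/cderiv_Im/dhE.
exact: le_trans (Im_le_nrm _) (dB y yx).
Qed.

Lemma cderivD h g x dh dg : cderiv h x dh -> cderiv g x dg ->
  cderiv (fun y => h y + g y) x (dh + dg).
Proof.
move=> H G e e0; have e20 : 0 < e / 2 by rewrite divr_gt0.
have [d1 d10 h1] := H _ e20; have [d2 d20 h2] := G _ e20.
exists (Num.min d1 d2); first by rewrite lt_min d10.
move=> t; rewrite lt_min => /andP[/h1 H1 /h2 H2].
rewrite (_ : _ - _ = (h (x + t) - h x - RtoC t * dh) +
  (g (x + t) - g x - RtoC t * dg)); last by ring.
by rewrite (le_trans (nrmD _ _)) // (splitr e) mulrDl lerD.
Qed.

Lemma cderiv_scale (c : C) (f : R -> R) x (df : R) : is_derive x 1 f df ->
  cderiv (fun y => c * RtoC (f y)) x (c * RtoC df).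
Proof.
move=> /derive_bound H e e0.
have [k k0 ke] := nrm_ge_lt _ _ (nrm_ge0 c) e0.
have [d d0 hd] := H k k0; exists d => // t /hd td.
rewrite (_ : _ - _ = c * RtoC (f (x + t) - f x - t * df)); last first.
  by rewrite !RtoCD !RtoCN RtoCM; ring.
rewrite nrmM nrm_RtoC (le_trans (ler_wpM2l (nrm_ge0 c) td)) //.
by rewrite mulrA ler_wpM2r // mulrC ltW.
Qed.

Lemma cderiv_sum (I : Type) (r : seq I) (h : I -> R -> C) x (dh : I -> C) :
  (forall i, cderiv (h i) x (dh i)) ->
  cderiv (fun y => \sum_(i <- r) h i y) x (\sum_(i <- r) dh i).
Proof.
move=> H; elim: r => [|i r IH].
  move=> e e0; exists 1 => // t _; rewrite !big_nil mulr0 !subr0 nrm0.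
  by rewrite mulr_ge0 // ltW.
rewrite big_cons (_ : (fun y => _) = fun y => h i y + \sum_(j <- r) h j y).
  exact: cderivD.
by apply/funext => y; rewrite big_cons.
Qed.

Lemma cderiv_comp (F : C -> C) (f : R -> R) x (df : R) :
  differentiable F (RtoC (f x)) -> is_derive x 1 f df ->
  cderiv (fun y => F (RtoC (f y))) x (RtoC df * 'd F (RtoC (f x)) 1).
Proof.
move=> dF /derive_bound H e e0; set D := 'd F _ 1.
pose L := `|df| + 1.
have L0 : 0 < L by rewrite ltr_wpDl.
have e1 : 0 < e / 2 / L by rewrite !divr_gt0.
have [d1 d10 h1] := differentiable_bound _ _ dF _ e1.
have e20 : 0 < e / 2 by rewrite divr_gt0.
have [k k0 ke] := nrm_ge_lt _ _ (nrm_ge0 D) e20.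
have m0 : 0 < Num.min k 1 by rewrite lt_min k0 ltr01.
have [d2 d20 h2] := H _ m0.
exists (Num.min d2 (d1 / L)); first by rewrite lt_min d20 divr_gt0.
move=> t; rewrite lt_min => /andP[/h2 t2 td1].
pose u := f (x + t) - f x.
have t1 : `|u - t * df| <= `|t|.
  by rewrite (le_trans t2) // ler_piMl // ge_min lexx orbT.
have tk : `|u - t * df| <= k * `|t|.
  by rewrite (le_trans t2) // ler_wpM2r // ge_min lexx.
have uL : `|u| <= L * `|t|.
  rewrite -[u](subrK (t * df)) (le_trans (ler_normD _ _)) // /L mulrDl mul1r.
  by rewrite addrC lerD // normrM mulrC.
have ud : nrm (RtoC u) < d1.
  by rewrite nrm_RtoC (le_lt_trans uL) // mulrC -ltr_pdivlMr.
have := h1 _ ud; rewrite -RtoCD /u (addrC (f x)) subrK -/u diff_mulE -/D => H1.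
rewrite (_ : _ - _ = (F (RtoC (f (x + t))) - F (RtoC (f x)) - RtoC u * D) +
   RtoC (u - t * df) * D); last by rewrite !RtoCD !RtoCN RtoCM; ring.
rewrite (le_trans (nrmD _ _)) // (splitr e) mulrDl lerD //.
  rewrite (le_trans H1) // nrm_RtoC (le_trans (ler_wpM2l (ltW e1) uL)) //.
  by rewrite mulrA divfK // gt_eqF.
rewrite nrmM nrm_RtoC (le_trans (ler_wpM2r (nrm_ge0 D) tk)) //.
by rewrite mulrAC ler_wpM2r // ltW.
Qed.

End Powers.

(** * Taylor remainder of the binomial series *)

Section BinomialRemainder.
Context {R : realType}.
Local Notation C := (cplx R).
Implicit Types (s a : C) (n k i : nat) (x y : R).

Definition rising a k : C := \prod_(i < k) (a + i%:R).

Lemma rising0 a : rising a 0 = 1. Proof. by rewrite /rising big_ord0. Qed.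

Lemma risingS a k : rising a k.+1 = a * rising (a + 1) k.
Proof.
rewrite /rising big_ord_recl addr0; congr (_ * _); apply: eq_bigr => i _.
by rewrite lift0 -addrA nat1r.
Qed.

Lemma risingD a k i : rising a (k + i) = rising a k * rising (a + k%:R) i.
Proof.
rewrite /rising big_split_ord /=; congr (_ * _); apply: eq_bigr => j _.
by rewrite natrD addrA.
Qed.

Lemma rising_holo k a : differentiable (rising^~ k) a.
Proof.
apply: holo_prod => i _; apply: holoD; [exact: holo_id|exact: holo_cst].
Qed.

Lemma rising_bounded (S : R) k : exists2 B : R, 0 <= B &
  forall a, nrm a <= S -> nrm (rising a k) <= B.
Proof.
elim: k => [|k [B B0 HB]].
  by exists 1 => // a _; rewrite rising0 nrm1.
exists (B * (`|S| + k%:R)); first by rewrite mulr_ge0 // addr_ge0.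
move=> a aS; rewrite /rising big_ord_recr /= nrmM ler_pM ?nrm_ge0 //.
  exact: HB.
rewrite (le_trans (nrmD _ _)) // nrm_nat lerD2r (le_trans aS) //; exact: ler_norm.
Qed.

Definition one_sub_pow a x : C := cexp (- a * RtoC (ln (1 - x))).

Definition binomial_remainder a k x : C :=
  one_sub_pow a x - \sum_(i < k) rising a i / i`!%:R * RtoC (x ^+ i).

Lemma one_sub_pow0 a : one_sub_pow a 0 = 1.
Proof. by rewrite /one_sub_pow subr0 ln1 mulr0 cexp0. Qed.

Lemma binomial_remainder0 a k : binomial_remainder a k.+1 0 = 0.
Proof.
rewrite /binomial_remainder one_sub_pow0 big_ord_recl rising0 fact0 expr0.
rewrite big1 => [|i _]; last by rewrite expr0n mulr0.
by rewrite divr1 mulr1 addr0 subrr.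
Qed.

Lemma cderiv_one_sub_pow a x : x < 1 ->
  cderiv (one_sub_pow a) x (a * one_sub_pow (a + 1) x).
Proof.
move=> x1; have x10 : 0 < 1 - x by rewrite subr_gt0.
have D : is_derive x 1 (fun y : R => ln (1 - y)) (- (1 - x)^-1).
  have D1 : is_derive x 1 (fun y : R => 1 - y) (-1).
    apply: bound_is_derive => e e0; exists 1 => // t _.
    by rewrite (_ : _ - _ = 0) ?normr0 ?mulr_ge0 ?(ltW e0) //; ring.
  have D2 := is_derive1_ln x10.
  have := @is_derive1_comp R (@ln R) (fun y => 1 - y) x _ _ D2 D1.
  by rewrite mulrN1.
pose F (z : C) := cexp (- a * z).
have [dF F1] : differentiable F (RtoC (ln (1 - x))) /\
    'd F (RtoC (ln (1 - x))) 1 = - a * one_sub_pow a x.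
  have [d1 d2] := cexp_diff (- a * RtoC (ln (1 - x))).
  have FE : F = fun z => cexp (0 + z *: - a).
    by apply/funext => z; rewrite add0r /F; congr cexp; rewrite mulrC.
  have zE : 0 + RtoC (ln (1 - x)) *: - a = - a * RtoC (ln (1 - x)).
    by rewrite add0r; exact: mulrC.
  have [D1 D2] := line_differentiable (@cexp R) 0 (- a) (RtoC (ln (1 - x)))
    (differentiable_cexp _).
  by rewrite FE; split; [exact: D1|rewrite D2 zE diff_mulE d2].
have := cderiv_comp F (fun y => ln (1 - y)) x _ dF D.
rewrite F1; congr (cderiv _ _ _).
rewrite /one_sub_pow opprD mulrDl cexpD mulN1r cexpN.
have -> : cexp (RtoC (ln (1 - x))) = RtoC (1 - x).
  by rewrite /cexp /= cos0 sin0 mulr1 mulr0 lnK.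
rewrite RtoCN mulNr (mulNr a) mulrN opprK.
have -> : RtoC (1 - x)^-1 = (RtoC (1 - x))^-1 by rewrite /RtoC fmorphV.
by rewrite mulrC -mulrA.
Qed.

Lemma cderiv_binomial_remainder a k x : x < 1 ->
  cderiv (binomial_remainder a k.+1) x (a * binomial_remainder (a + 1) k x).
Proof.
move=> x1.
pose g i y : C := - (rising a i / i`!%:R) * RtoC (y ^+ i).
have -> : binomial_remainder a k.+1 =
    fun y => one_sub_pow a y + \sum_(i < k.+1) g i y.
  apply/funext => y; rewrite /binomial_remainder -sumrN; congr (_ + _).
  by apply: eq_bigr => i _; rewrite /g mulNr.
have -> : a * binomial_remainder (a + 1) k x = a * one_sub_pow (a + 1) x +
    \sum_(i < k.+1) - (rising a i / i`!%:R) * RtoC (i%:R * x ^+ i.-1).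
  rewrite mulrBr mulr_sumr; congr (_ + _).
  rewrite big_ord_recl mul0r mulr0 add0r -sumrN; apply: eq_bigr => i _.
  rewrite lift0 /= risingS factS natrM RtoCM RtoC_nat; field.
  by rewrite nat1r !pnatr_eq0 -lt0n fact_gt0.
apply: cderivD; first exact: cderiv_one_sub_pow.
apply: cderiv_sum => i; apply: cderiv_scale.
apply: DeriveDef; first exact: exprn_derivable.
by rewrite exp_derive /GRing.scale /= mulr1.
Qed.

(** The derivative of a remainder is [a] times the remainder of one order less at [a + 1], so the
    bound is integrated from [0]; this is why [S] grows by [1] in the induction. The range
    [x <= 1 / 2] suits [x = 1 / n] with [n >= 2]. *)
Lemma binomial_remainder_bound (S : R) k : exists2 B : R, 0 <= B &
  forall a x, nrm a <= S -> 0 <= x <= 1 / 2 ->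
    nrm (binomial_remainder a k x) <= B * x ^+ k.
Proof.
elim: k S => [|k IH] S.
  exists (expR (`|S| * ln 2)); first exact: expR_ge0.
  move=> a x aS /andP[x0 x1].
  rewrite /binomial_remainder big_ord0 subr0 expr0 mulr1 nrm_cexp ler_expR.
  have -> : complex.Re (- a * RtoC (ln (1 - x))) = - complex.Re a * ln (1 - x).
    by rewrite ReM ReN /= mulr0 subr0.
  rewrite (le_trans (ler_norm _)) // normrM normrN ler_pM //.
    rewrite (le_trans (Re_le_nrm _)) // (le_trans aS) //; exact: ler_norm.
  rewrite ler0_norm; last by apply: ln_le0; lra.
  have x1' : 0 < 1 - x by lra.
  rewrite -lnV ?posrE // ler_ln ?posrE ?invr_gt0 // -div1r ler_pdivrMr //; lra.
have [B B0 HB] := IH (`|S| + 1).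
exists (2 * (`|S| * B)); first by rewrite !mulr_ge0.
move=> a x aS /andP[x0 x1].
have H := @cderiv_mean_value R (binomial_remainder a k.+1)
  (fun y => a * binomial_remainder (a + 1) k y) x (`|S| * (B * x ^+ k)) x0.
rewrite -[binomial_remainder _ _ _]subr0 -(binomial_remainder0 a k).
apply: le_trans (H _ _) _.
- by move=> y /andP[y0 yx]; apply: cderiv_binomial_remainder; lra.
- move=> y /andP[y0 yx]; rewrite nrmM ler_pM ?nrm_ge0 //.
    by rewrite (le_trans aS) // ler_norm.
  rewrite (le_trans (HB _ _ _ _)) //; first 1 last.
  + by apply/andP; split; lra.
  + by rewrite ler_wpM2l // lerXn2r // nnegrE //.
  + by rewrite (le_trans (nrmD _ _)) // nrm1 lerD2r (le_trans aS) // ler_norm.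
- by rewrite exprSr !mulrA.
Qed.

End BinomialRemainder.

(** * Euler-Maclaurin formula for the tails of the zeta series *)

Section EulerMaclaurin.
Context {R : realType}.
Local Notation C := (cplx R).
Implicit Types (s a : C) (n k i j m N K : nat) (x y : R).

Definition bernC k : C := RtoC (bern k).

(* [bernC k * rising (s - 1) k / (s - 1)] is the [k]-th Euler-Maclaurin coefficient
   of [sum_(n > m) n^-s]; multiplying by [s - 1] makes everything entire. *)
Definition em_coef k s : C := bernC k * rising (s - 1) k.

Definition em_main K m s : C :=
  \sum_(k < K.+1) em_coef k s * npowN m (s - 1 + k%:R).

(** The failure of [em_main] to telescope at [n]: it would be [0] if [em_main K m s] were exactly
    [s - 1] times the sum of [n ^ -s] over [n > m]. *)
Definition em_error K n s : C :=
  (s - 1) * npowN n s - (em_main K n.-1 s - em_main K n s).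

Lemma npowN_pred n a : (1 < n)%N ->
  npowN n.-1 a = npowN n a * one_sub_pow a (n%:R^-1).
Proof.
move=> n1; rewrite /npowN /one_sub_pow -cexpD -mulrDr -RtoCD; congr (cexp (_ * RtoC _)).
have n0 : 0 < n%:R :> R by rewrite ltr0n; lia.
have i1 : n%:R^-1 < 1 :> R by rewrite invf_lt1 // ltr1n.
rewrite -lnM ?posrE ?subr_gt0 // mulrBr mulr1 divff ?gt_eqF //; congr ln.
by rewrite -[n in RHS](prednK (ltnW n1)) -natr1 addrK.
Qed.

Lemma sum_triangle (F : nat -> nat -> C) N :
  \sum_(k < N) \sum_(i < N - k) F k (k + i)%N =
  \sum_(l < N) \sum_(k < l.+1) F k l.
Proof.
transitivity (\sum_(k < N) \sum_(l < N | (k <= l)%N) F k l).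
  apply: eq_bigr => k _.
  rewrite -(big_mkord xpredT (fun i => F k (k + i)%N)).
  rewrite (eq_bigr (fun i => F k (i + k)%N)); last by move=> i _; rewrite addnC.
  rewrite -(big_addn 0 N k xpredT (F k)) add0n (big_nat_widenl k 0) // big_mkord.
  by apply: eq_bigl => i.
rewrite (exchange_big_dep xpredT) //=; apply: eq_bigr => l _.
by rewrite (big_ord_widen N (fun k => F k l)).
Qed.

(** Since [rising (s - 1) k * rising (s - 1 + k) i = rising (s - 1) (k + i)], collecting powers of
    [1 / n] leaves, as coefficient of [n ^ -l], [rising (s - 1) (l + 1)] times the sum in
    [bern_conv], which is [0] unless [l = 0]. *)
Lemma em_main_identity K n s : (0 < n)%N ->
  \sum_(k < K.+1) em_coef k s * (n%:R / n%:R ^+ k) *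
    (\sum_(i < K.+2 - k) rising (s - 1 + k%:R) i / i`!%:R * RtoC (n%:R^-1 ^+ i) - 1)
  = s - 1.
Proof.
move=> n0; have n0' : n%:R != 0 :> C by rewrite pnatr_eq0 -lt0n.
pose F k l : C := bernC k * RtoC ((l.+1 - k)`!%:R^-1) * (rising (s - 1) l.+1 / n%:R ^+ l).
transitivity (\sum_(k < K.+1) \sum_(i < K.+1 - k) F k (k + i)%N).
  apply: eq_bigr => k _; have kK := ltn_ord k.
  rewrite subSn ?(ltnW kK) // big_ord_recl rising0 fact0 divr1 expr0 mulr1 addrC addKr.
  rewrite mulr_sumr; apply: eq_bigr => i _; rewrite lift0 /F /em_coef.
  have -> : ((k + i).+1 - k = i.+1)%N by lia.
  rewrite -addnS risingD exprD.
  rewrite [RtoC (_ ^+ _)](_ : _ = (n%:R ^+ i.+1)^-1); last first.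
    by rewrite /RtoC rmorphXn fmorphV exprVn rmorph_nat.
  rewrite [RtoC _^-1](_ : _ = (i.+1`!%:R)^-1); last by rewrite /RtoC fmorphV rmorph_nat.
  rewrite exprS; field.
  by rewrite !expf_neq0 //= pnatr_eq0 -lt0n fact_gt0.
rewrite sum_triangle.
rewrite (eq_bigr (fun l : 'I_K.+1 =>
  (rising (s - 1) l.+1 / n%:R ^+ l) * RtoC (l == 0%N :> nat)%:R)); last first.
  move=> l _; rewrite -bern_conv.
  rewrite (_ : RtoC _ = \sum_(k < l.+1) RtoC (bern k / (l.+1 - k)`!%:R)).
    by rewrite mulr_sumr; apply: eq_bigr => k _; rewrite RtoCM mulrC.
  exact: rmorph_sum.
rewrite big_ord_recl /= expr0 divr1 RtoC1 mulr1 big1 ?addr0; last first.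
  by move=> i _; rewrite RtoC0 mulr0.
by rewrite risingS rising0 mulr1.
Qed.

Lemma em_errorE K n s : (1 < n)%N -> em_error K n s =
  - (npowN n s * \sum_(k < K.+1) em_coef k s * (n%:R / n%:R ^+ k) *
      binomial_remainder (s - 1 + k%:R) (K.+2 - k) (n%:R^-1)).
Proof.
move=> n1; have n0' : n%:R != 0 :> C by rewrite pnatr_eq0; lia.
have pw k : npowN n (s - 1 + k%:R) = npowN n s * (n%:R / n%:R ^+ k).
  have -> : npowN n s = npowN n (s - 1) / n%:R.
    have e1 : npowN n (1 : C) = n%:R^-1 := npowN_natr n 1 (ltnW n1).
    by have := npowND n (s - 1) 1; rewrite subrK e1.
  by rewrite npowND npowN_natr ?(ltnW n1) // mulrA divfK.
rewrite /em_error -sumrB -{1}(@em_main_identity K n s (ltnW n1)).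
rewrite mulr_suml -sumrB mulr_sumr -sumrN; apply: eq_bigr => k _.
by rewrite npowN_pred // pw /binomial_remainder; ring.
Qed.

Lemma sum_bounded (T : Type) (P : T -> Prop) (F : nat -> T -> C) (w : T -> R) N :
  (forall p, 0 <= w p) ->
  (forall k, (k < N)%N -> exists2 c : R, 0 <= c &
     forall p, P p -> nrm (F k p) <= c * w p) ->
  exists2 c : R, 0 <= c & forall p, P p -> nrm (\sum_(k < N) F k p) <= c * w p.
Proof.
move=> w0; elim: N => [|N IH] H.
  by exists 0 => // p _; rewrite big_ord0 nrm0 mul0r.
have [k kN|c c0 hc] := IH; first by apply: H; rewrite ltnW.
have [d d0 hd] := H N (ltnSn N); exists (c + d); first exact: addr_ge0.
move=> p Pp; rewrite big_ord_recr /= (le_trans (nrmD _ _)) // mulrDl.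
by rewrite lerD ?hc ?hd.
Qed.

(** By [em_errorE] only binomial remainders are left. The [k]-th one has order [K + 2 - k] and
    prefactor [n ^ (1 - k)], so each contributes [n ^ - (K + 1)], uniformly for bounded [s]. *)
Lemma em_error_bound K (S : R) : exists2 c : R, 0 <= c & forall n s, (1 < n)%N ->
  nrm s <= S -> nrm (em_error K n s) <= c * nrm (npowN n s) / n%:R ^+ K.+1.
Proof.
have coef_bd k : exists2 c : R, 0 <= c & forall s, nrm s <= S -> nrm (em_coef k s) <= c.
  have [B B0 HB] := @rising_bounded R (S + 1) k.
  exists (nrm (bernC k) * B); first by rewrite mulr_ge0 ?nrm_ge0.
  move=> s sS; rewrite nrmM ler_wpM2l ?nrm_ge0 // HB // (le_trans (nrm_sub _ _)) //.
  by rewrite nrm1 lerD2r.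
have term_bd k : exists2 c : R, 0 <= c & forall n s, (1 < n)%N -> (k < K.+1)%N -> nrm s <= S ->
    nrm (em_coef k s * (n%:R / n%:R ^+ k) *
      binomial_remainder (s - 1 + k%:R) (K.+2 - k) (n%:R^-1)) <= c / n%:R ^+ K.+1.
  have [c1 c10 h1] := coef_bd k.
  have [c2 c20 h2] := @binomial_remainder_bound R (S + 1 + k%:R) (K.+2 - k).
  exists (c1 * c2); first exact: mulr_ge0.
  move=> n s n1 kK sS.
  have n0 : 0 < n%:R :> R by rewrite ltr0n; lia.
  have b2 : nrm (binomial_remainder (s - 1 + k%:R) (K.+2 - k) (n%:R^-1 : R)) <=
      c2 * n%:R^-1 ^+ (K.+2 - k).
    apply: h2.
      rewrite (le_trans (nrmD _ _)) // nrm_nat lerD2r (le_trans (nrm_sub _ _)) //.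
      by rewrite nrm1 lerD2r.
    by rewrite invr_ge0 ltW //= div1r lef_pV2 ?posrE // ler_nat.
  have -> : c1 * c2 / n%:R ^+ K.+1 =
      c1 * (n%:R / n%:R ^+ k) * (c2 * n%:R^-1 ^+ (K.+2 - k)).
    rewrite mulrACA; congr (_ * _); rewrite exprVn -mulrA -invfM -exprD.
    rewrite subnKC; last by lia.
    by rewrite [in RHS]exprS invfM mulrA divff ?mul1r // gt_eqF.
  rewrite nrmM; apply: ler_pM b2; rewrite ?nrm_ge0 //.
  rewrite (nrmM (em_coef k s)) (nrmM n%:R) nrmV nrmX !nrm_nat ler_wpM2r ?h1 //.
have [c c0 hc] : exists2 c : R, 0 <= c & forall n s, (1 < n)%N -> nrm s <= S ->
    nrm (\sum_(k < K.+1) em_coef k s * (n%:R / n%:R ^+ k) *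
      binomial_remainder (s - 1 + k%:R) (K.+2 - k) (n%:R^-1)) <= c / n%:R ^+ K.+1.
  have [||c c0 hc] := @sum_bounded (nat * C)%type (fun p => (1 < p.1)%N /\ nrm p.2 <= S)
    (fun k p => em_coef k p.2 * (p.1%:R / p.1%:R ^+ k) *
       binomial_remainder (p.2 - 1 + k%:R) (K.+2 - k) (p.1%:R^-1))
    (fun p => p.1%:R ^- K.+1) K.+1.
  - by move=> p; rewrite invr_ge0 exprn_ge0.
  - move=> k kK; have [c c0 hc] := term_bd k; exists c => // -[n s] [/= n1 sS].
    exact: hc.
  - by exists c => // n s n1 sS; exact: (hc (n, s)).
exists c => // n s n1 sS; rewrite em_errorE // nrmN nrmM [c * _]mulrC -mulrA.
by rewrite ler_wpM2l ?nrm_ge0 // hc.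
Qed.

(** A telescoping series with sum [1], the common majorant of all the series below. *)
Definition majorant j : R := (j.+1%:R * j.+2%:R)^-1.

Lemma majorant_ge0 j : 0 <= majorant j.
Proof. by rewrite invr_ge0 mulr_ge0. Qed.

Lemma sum_majorant_le1 N : \sum_(0 <= j < N) majorant j <= 1.
Proof.
have -> : \sum_(0 <= j < N) majorant j = 1 - N.+1%:R^-1.
  elim: N => [|N IH]; first by rewrite big_geq // invr1 subrr.
  rewrite big_nat_recr //= IH /majorant -[N.+2%:R]natr1 -[N.+1%:R]natr1; field.
  by rewrite -?nat1r ?natr1 ?nat1r !pnatr_eq0.
by rewrite lerBlDr lerDl invr_ge0.
Qed.

Lemma summing_majorant (c : R) : 0 <= c -> summing (fun j => c * majorant j).
Proof.
move=> c0; exists (c * 1) => N; rewrite -mulr_sumr ler_wpM2l //.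
exact: sum_majorant_le1.
Qed.

Definition em_tail K m s : C := csum (fun j => em_error K (m.+1 + j) s).

(** With [n = m + 1 + j], the bound [n ^ (B - K - 1)] is split as [n ^ - (K - B - 1) * n ^ -2]: the
    first factor gives the decay in [m], the second the summability in [j]. *)
Lemma em_error_majorant K (S : R) (B : nat) : (B < K)%N ->
  exists2 c : R, 0 <= c & forall m j s, (0 < m)%N -> nrm s <= S ->
    - B%:R <= complex.Re s ->
    nrm (em_error K (m.+1 + j) s) <= c / m%:R ^+ (K - B.+1) * majorant j.
Proof.
move=> BK; have [c c0 hc] := em_error_bound K S; exists c => // m j s m0 sS sB.
set n := (m.+1 + j)%N; have n1 : (1 < n)%N by rewrite /n; lia.
rewrite (le_trans (hc n s n1 sS)) //.
have n0 : 0 < n%:R :> R by rewrite ltr0n; lia.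
have hn : nrm (npowN n s) <= n%:R ^+ B.
  by have := @nrm_npowN_le R n s B 0 (ltnW n1); rewrite expr0 divr1 sub0r; apply.
apply: (@le_trans _ _ (c * n%:R ^+ B / n%:R ^+ K.+1)).
  by rewrite ler_wpM2r ?invr_ge0 ?exprn_ge0 // ?(ltW n0) // ler_wpM2l.
have -> : c * n%:R ^+ B / n%:R ^+ K.+1 = c * (n%:R ^+ (K - B.+1))^-1 * (n%:R ^+ 2)^-1.
  have -> : (K.+1 = B + ((K - B.+1) + 2))%N by lia.
  rewrite [in LHS]exprD invfM mulrA mulfK ?expf_neq0 ?gt_eqF //.
  by rewrite exprD invfM mulrA.
have m0' : 0 < m%:R :> R by rewrite ltr0n.
apply: ler_pM; rewrite ?mulr_ge0 ?invr_ge0 ?exprn_ge0 ?(ltW n0) //.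
  rewrite ler_wpM2l // lef_pV2 ?posrE ?exprn_gt0 // lerXn2r ?nnegrE ?ler0n //.
  by rewrite ler_nat /n; lia.
rewrite lef_pV2 ?posrE ?exprn_gt0 // ?mulr_gt0 // expr2 ler_pM // ler_nat /n; lia.
Qed.

Lemma em_tail_bound K (S : R) (B : nat) : (B < K)%N ->
  exists2 c : R, 0 <= c & forall m s, (0 < m)%N -> nrm s <= S ->
    - B%:R <= complex.Re s ->
    series (fun j => em_error K (m.+1 + j) s) @ \oo --> em_tail K m s /\
    nrm (em_tail K m s) <= c / m%:R ^+ (K - B.+1).
Proof.
move=> BK; have [c c0 hc] := em_error_majorant K S B BK.
exists c => // m s m0 sS sB.
have cm : 0 <= c / m%:R ^+ (K - B.+1) by rewrite divr_ge0 // exprn_ge0.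
have hb j := hc m j s m0 sS sB; split.
  exact: csum_cvg hb (summing_majorant _ cm).
apply: csum_le hb _ => N; rewrite -mulr_sumr -[leRHS]mulr1 ler_wpM2l //.
exact: sum_majorant_le1.
Qed.

Lemma em_coef_holo k s : differentiable (em_coef k) s.
Proof.
apply: holoM; first exact: holo_cst.
apply: (@differentiable_comp _ _ _ _ (fun z : C => z - 1) (rising^~ k)).
  exact: holo_subc.
exact: rising_holo.
Qed.

Lemma em_main_holo K m s : differentiable (em_main K m) s.
Proof.
apply: holo_sum => k _; apply: holoM; first exact: em_coef_holo.
apply: (@differentiable_comp _ _ _ _ (fun z : C => z - 1 + k%:R) (fun z => npowN m z)).
  by apply: holoD; [exact: holo_subc|exact: holo_cst].
exact: npowN_holo.
Qed.

Lemma em_error_holo K n s : differentiable (em_error K n) s.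
Proof.
apply: holoB; last by apply: holoB; exact: em_main_holo.
by apply: holoM; [exact: holo_subc|exact: npowN_holo].
Qed.

Definition em_domain (S : R) (B : nat) : set C :=
  [set s : C | nrm s < S /\ - B%:R < complex.Re s].

Lemma em_domain_open (S : R) (B : nat) : open (em_domain S B).
Proof.
apply/nrm_openP => s [sS sB].
exists (Num.min (S - nrm s) (complex.Re s + B%:R)).
  by rewrite lt_min subr_gt0 sS -ltrBlDr sub0r.
move=> t; rewrite lt_min => /andP[t1 t2]; split.
  by have := nrm_dist t s; rewrite nrmB; lra.
have := le_trans (ler_norm _) (Re_le_nrm (s - t)); rewrite ReD ReN; lra.
Qed.

Lemma em_tail_holo K m (B : nat) s : (0 < m)%N -> (B < K)%N ->
  - B%:R < complex.Re s -> differentiable (em_tail K m) s.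
Proof.
move=> m0 BK sB; pose S := nrm s + 1.
have [c c0 hc] := em_error_majorant K S B BK.
have cm : 0 <= c / m%:R ^+ (K - B.+1) by rewrite divr_ge0 // exprn_ge0.
have hb j z : em_domain S B z ->
    nrm (em_error K (m.+1 + j) z) <= c / m%:R ^+ (K - B.+1) * majorant j.
  by move=> [/ltW zS /ltW zB]; exact: hc.
apply: (@weierstrass_M_test R C (em_domain S B)
  (fun j z => em_error K (m.+1 + j) z) (em_tail K m) _
  (em_domain_open S B) _ hb (summing_majorant _ cm)).
- by move=> j z _; exact: em_error_holo.
- by move=> z Dz; apply: csum_cvg (fun j => hb j z Dz) (summing_majorant _ cm).
- by split => //; rewrite /S ltrDl.
Qed.

Lemma csum0 : csum (fun _ : nat => 0 : C) = 0.
Proof.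
apply: csum_unique; rewrite (_ : series _ = fun=> 0); first exact: cvg_cst.
by apply/funext => n; rewrite /series /= big1.
Qed.

Lemma em_coef1 k : em_coef k 1 = (k == 0%N)%:R.
Proof.
rewrite /em_coef subrr; case: k => [|k]; first by rewrite rising0 mulr1.
by rewrite risingS mul0r mulr0.
Qed.

(** At [s = 1] all coefficients but the first vanish and [em_main] is the constant [1], so every
    error is [0]. This removes the remainders at the test points. *)
Lemma em_tail1 K m : em_tail K m 1 = 0.
Proof.
rewrite -csum0; congr csum; apply/funext => j.
have em n : em_main K n 1 = 1.
  rewrite /em_main big_ord_recl em_coef1 mul1r subrr addr0 npowN0 big1 ?addr0 //.
  by move=> k _; rewrite em_coef1 mul0r.
by rewrite /em_error !em !subrr mul0r subrr.
Qed.

Lemma em_partial_sum K m N s :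
  \sum_(0 <= j < N) em_error K (m.+1 + j) s =
  (s - 1) * \sum_(0 <= j < N) npowN (m.+1 + j) s -
  (em_main K m s - em_main K (m + N) s).
Proof.
elim: N => [|N IH]; first by rewrite !big_geq // addn0 mulr0 !subrr.
by rewrite !big_nat_recr //= IH /em_error addSn /= addnS mulrDr; ring.
Qed.

End EulerMaclaurin.

(** * The Euler-Zagier sum *)

Section ConvergentRegion.
Context {R : realType}.
Local Notation C := (cplx R).
Implicit Types (s a b : C) (n k i j m N K : nat) (x y : R).

Lemma seq_cvg_cst (x : C) : (fun _ : nat => x) @ \oo --> x.
Proof. exact: cvg_cst. Qed.

Lemma seq_cvgD (u v : nat -> C) (x y : C) : u @ \oo --> x -> v @ \oo --> y ->
  (fun n => u n + v n) @ \oo --> x + y.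
Proof. by move=> ux vy; exact: (@cvgD C C _ \oo _ u v _ _ ux vy). Qed.

Lemma seq_cvgB (u v : nat -> C) (x y : C) : u @ \oo --> x -> v @ \oo --> y ->
  (fun n => u n - v n) @ \oo --> x - y.
Proof. by move=> ux vy; exact: (@cvgB C C _ \oo _ u v _ _ ux vy). Qed.

Lemma seq_cvgM (u v : nat -> C) (x y : C) : u @ \oo --> x -> v @ \oo --> y ->
  (fun n => u n * v n) @ \oo --> x * y.
Proof. by move=> ux vy; exact: (@cvgM C _ \oo _ u v _ _ ux vy). Qed.

Lemma seq_cvg_shift (u : nat -> C) (x : C) k :
  (fun n => u (n + k)%N) @ \oo --> x <-> u @ \oo --> x.
Proof. by have <- := cvg_shiftn k u (nbhs x); split. Qed.

Lemma cvg_to0 (u : nat -> C) (c : R) : 0 <= c ->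
  (forall n, (0 < n)%N -> nrm (u n) <= c / n%:R) -> u @ \oo --> (0 : C).
Proof.
move=> c0 H; apply/nrm_cvgP => e e0; near=> n.
have n0 : (0 < n)%N by near: n; exact: nbhs_infty_gt.
rewrite sub0r nrmN (le_trans (H n n0)) // ler_pdivrMr ?ltr0n // mulrC -ler_pdivrMr //.
by near: n; exact: nbhs_infty_ger.
Unshelve. all: by end_near. Qed.

Lemma nrm_npowN_inv n s (q : nat) : (0 < n)%N -> q%:R <= complex.Re s ->
  nrm (npowN n s) <= (n%:R ^+ q)^-1.
Proof.
move=> n0 h; have := @nrm_npowN_le R n s 0 q n0.
by rewrite subr0 expr0 div1r; apply.
Qed.

Lemma em_main_cvg0 K b : 2 <= complex.Re b -> em_main K ^~ b @ \oo --> (0 : C).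
Proof.
move=> b2; pose c := \sum_(k < K.+1) nrm (em_coef k b).
apply: (@cvg_to0 _ c); first by apply: sumr_ge0 => k _; exact: nrm_ge0.
move=> n n0; rewrite (le_trans (nrm_sum _ _ _ _)) // /c mulr_suml.
apply: ler_sum => k _; rewrite nrmM ler_wpM2l ?nrm_ge0 //.
have := @nrm_npowN_inv n (b - 1 + k%:R) 1 n0; rewrite expr1; apply.
have -> : complex.Re (b - 1 + k%:R) = complex.Re b - 1 + k%:R.
  by rewrite !ReD ReN -RtoC_nat.
have : 0 <= k%:R :> R by []; lra.
Qed.

Definition tail_sum K m b : C := (em_main K m b + em_tail K m b) / (b - 1).

Lemma Re_neq1 b : 2 <= complex.Re b -> b - 1 != 0.
Proof.
by move=> b2; rewrite subr_eq0; apply: contraTneq b2 => ->; rewrite -ltNge /= ltr1n.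
Qed.

Lemma tail_sum_cvg K m b : (0 < K)%N -> (0 < m)%N -> 2 <= complex.Re b ->
  series (fun j => npowN (m.+1 + j) b) @ \oo --> tail_sum K m b.
Proof.
move=> K0 m0 b2; have b1 := Re_neq1 b b2.
have [c c0 hc] := em_tail_bound K (nrm b) 0 K0.
have [|cv _] := hc m b m0 (lexx _); first by rewrite oppr0; lra.
have E N : series (fun j => npowN (m.+1 + j) b) N =
    (series (fun j => em_error K (m.+1 + j) b) N + em_main K m b -
     em_main K (m + N) b) / (b - 1).
  rewrite /series /= em_partial_sum; field; exact: b1.
rewrite (funext E) /tail_sum (addrC (em_main K m b)) -[X in X / _]subr0.
have c3 : (fun N => em_main K (m + N) b) @ \oo --> (0 : C).
  have := (seq_cvg_shift _ _ m).2 (em_main_cvg0 K b b2).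
  by rewrite (_ : (fun n => _) = fun N => em_main K (m + N) b) //; apply/funext => n; rewrite addnC.
apply: seq_cvgM (seq_cvg_cst _); apply: seq_cvgB c3.
exact: seq_cvgD cv (seq_cvg_cst _).
Qed.

Lemma tail_sum_rec K m b : (0 < K)%N -> (0 < m)%N -> 2 <= complex.Re b ->
  tail_sum K m b = npowN m.+1 b + tail_sum K m.+1 b.
Proof.
move=> K0 m0 b2; have h0 := tail_sum_cvg K m b K0 m0 b2.
have h1 := tail_sum_cvg K m.+1 b K0 isT b2.
apply: (C_cvg_unique _ _ _ h0); apply: (seq_cvg_shift _ _ 1).1.
have -> : (fun n => series (fun j => npowN (m.+1 + j) b) (n + 1)%N) =
   fun n => npowN m.+1 b + series (fun j => npowN (m.+2 + j) b) n.
  apply/funext => n; rewrite addn1 /series /= big_nat_recl // addn0; congr (_ + _).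
  by apply: eq_bigr => i _; rewrite addnS addSn.
exact: seq_cvgD (seq_cvg_cst _) h1.
Qed.

Lemma tail_sum_cvg0 K b : (0 < K)%N -> 2 <= complex.Re b ->
  (fun m => tail_sum K m.+1 b) @ \oo --> (0 : C).
Proof.
move=> K0 b2; have h := tail_sum_cvg K 1 b K0 isT b2.
have -> : (fun m => tail_sum K m.+1 b) =
    fun m => tail_sum K 1 b - series (fun j => npowN (2 + j) b) m.
  apply/funext => m; elim: m => [|m IH]; first by rewrite /series /= big_geq // subr0.
  by rewrite seriesSr opprD addrA -IH (tail_sum_rec K m.+1) // addrAC subrr add0r.
rewrite -[X in _ --> X](subrr (tail_sum K 1 b)).
exact: seq_cvgB (seq_cvg_cst _) h.
Qed.

Lemma tail_sum_le K m b : (0 < K)%N -> (0 < m)%N -> 2 <= complex.Re b ->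
  nrm (tail_sum K m b) <= 1.
Proof.
move=> K0 m0 b2; apply: (nrm_lim_le _ _ _ (tail_sum_cvg K m b K0 m0 b2)).
exists 0%N => N _; rewrite (le_trans (nrm_sum _ _ _ _)) //.
apply: le_trans (sum_majorant_le1 N); apply: ler_sum => j _.
rewrite (le_trans (@nrm_npowN_inv (m.+1 + j) b 2 _ b2)) //.
rewrite lef_pV2 ?posrE ?mulr_gt0 ?exprn_gt0 ?ltr0n // expr2 ler_pM // ler_nat; lia.
Qed.

(* [T m] is the tail [c m.+1 + c m.+2 + ...]. *)
Lemma abel_summation (a c T : nat -> C) (M : nat -> R) :
  (forall m, (0 < m)%N -> T m = c m.+1 + T m.+1) ->
  (fun m => T m.+1) @ \oo --> (0 : C) ->
  (forall m, (0 < m)%N -> nrm (T m) <= 1) ->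
  (forall j, nrm (a j.+1) <= M j) -> summing M ->
  (fun N => \sum_(1 <= n < N) c n * \sum_(1 <= i < n) a i) @ \oo -->
    csum (fun j => a j.+1 * T j.+1).
Proof.
move=> Trec T0 T1 aM sM.
(* Summation by parts; the boundary term is a convergent partial sum times a tail tending to [0]. *)
have E N : \sum_(1 <= n < N.+2) c n * \sum_(1 <= i < n) a i =
    series (fun j => a j.+1 * T j.+1) N.+1 - series (fun j => a j.+1) N.+1 * T N.+1.
  rewrite /series /=; elim: N => [|N IH].
    by rewrite !big_nat1 big_geq // mulr0 subrr.
  rewrite big_nat_recr //= IH big_add1 /=.
  rewrite [in RHS]big_nat_recr //= [\sum_(0 <= k < N.+2) a k.+1]big_nat_recr //=.
  rewrite (Trec N.+1) //; ring.
have aT j : nrm (a j.+1 * T j.+1) <= M j.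
  by rewrite nrmM -[leRHS]mulr1 ler_pM ?nrm_ge0 // T1.
have c1 := csum_cvg _ _ aT sM; have c2 := csum_cvg _ _ aM sM.
apply: (seq_cvg_shift _ _ 2).1.
rewrite (_ : (fun n => _) = fun N => series (fun j => a j.+1 * T j.+1) N.+1 -
    series (fun j => a j.+1) N.+1 * T N.+1); last first.
  by apply/funext => N; rewrite addn2 E.
rewrite -[X in _ --> X]subr0 -[X in _ - X](mulr0 (csum (fun j => a j.+1))).
have shift1 (u : nat -> C) (l : C) : u @ \oo --> l -> (fun n => u n.+1) @ \oo --> l.
  move=> ul; have := (seq_cvg_shift _ _ 1).2 ul.
  by rewrite (_ : (fun n => u (n + 1)%N) = fun n => u n.+1) //; apply/funext => n; rewrite addn1.
exact: seq_cvgB (shift1 _ _ c1) (seq_cvgM _ _ _ _ (shift1 _ _ c2) T0).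
Qed.

End ConvergentRegion.

(** * Rearranging the multiple series in the region of convergence *)

Section ConvergentFormula.
Context {R : realType}.
Local Notation C := (cplx R).
Implicit Types (a b : C) (n k i j m N K : nat).

Lemma inv_sqr_le_majorant j : (j.+1%:R ^+ 2)^-1 <= 2 * majorant j :> R.
Proof.
rewrite /majorant -[2]invrK -invfM lef_pV2 ?posrE ?mulr_gt0 ?invr_gt0 ?exprn_gt0 //.
rewrite -[j.+2%:R]natr1 -[j.+1%:R]natr1; have : 0 <= j%:R :> R by [].
by nra.
Qed.

Lemma nrm_npowN_majorant j a : 2 <= complex.Re a ->
  nrm (npowN j.+1 a) <= 2 * majorant j.
Proof.
by move=> a2; rewrite (le_trans (@nrm_npowN_inv R j.+1 a 2 isT a2)) // inv_sqr_le_majorant.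
Qed.

Lemma summing_2majorant : summing (fun j => 2 * majorant j : R).
Proof. exact: summing_majorant. Qed.

Lemma cseries_cvg_sum N (u : nat -> nat -> C) (l : nat -> C) :
  (forall k, (k < N)%N -> series (u k) @ \oo --> l k) ->
  series (fun n => \sum_(k < N) u k n) @ \oo --> \sum_(k < N) l k.
Proof.
elim: N => [|N IH] H.
  rewrite big_ord0 (_ : series _ = fun=> 0); first exact: seq_cvg_cst.
  by apply/funext => n; rewrite /series /= big1 // => i _; rewrite big_ord0.
rewrite big_ord_recr /= (_ : (fun n => _) = fun n => \sum_(k < N) u k n + u N n).
  by apply: cseries_cvgD; [apply: IH => k kN; apply: H; rewrite ltnW|exact: H].
by apply/funext => n; rewrite big_ord_recr.
Qed.

Lemma tail_sum_expand K (u : nat -> C) (M : nat -> R) b : (0 < K)%N ->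
  2 <= complex.Re b -> (forall j, nrm (u j) <= M j) -> summing M ->
  (b - 1) * csum (fun j => u j * tail_sum K j.+1 b) =
  \sum_(k < K.+1) em_coef k b * csum (fun j => u j * npowN j.+1 (b - 1 + k%:R)) +
  csum (fun j => u j * em_tail K j.+1 b).
Proof.
move=> K0 b2 uM sM; have b1 := Re_neq1 b b2.
have [c c0 hc] := em_tail_bound K (nrm b) 0 K0.
have M0 j : 0 <= M j by rewrite (le_trans (nrm_ge0 (u j))).
have cp k : series (fun j => u j * npowN j.+1 (b - 1 + k%:R)) @ \oo -->
    csum (fun j => u j * npowN j.+1 (b - 1 + k%:R)).
  apply: csum_cvg _ sM => j; rewrite nrmM -[leRHS]mulr1 ler_pM ?nrm_ge0 //.
  have := @nrm_npowN_inv R j.+1 (b - 1 + k%:R) 0 isT; rewrite expr0 invr1; apply.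
  have -> : complex.Re (b - 1 + k%:R) = complex.Re b - 1 + k%:R.
    by rewrite !ReD ReN -RtoC_nat.
  have : 0 <= k%:R :> R by []; lra.
have ct : series (fun j => u j * em_tail K j.+1 b) @ \oo -->
    csum (fun j => u j * em_tail K j.+1 b).
  apply: (csum_cvg _ (fun j => c * M j)) => [j|].
    rewrite nrmM mulrC ler_pM ?nrm_ge0 //.
    have [|_ h] := hc j.+1 b isT (lexx _); first by rewrite oppr0; lra.
    rewrite (le_trans h) // ler_pdivrMr ?exprn_gt0 // ler_peMr //.
    by rewrite exprn_ege1 // ler1n.
  have [B MB] := sM; exists (c * B) => n; rewrite -mulr_sumr ler_wpM2l //.
rewrite -[RHS](divfK b1) mulrC; congr (_ * _); apply: csum_unique.
rewrite mulrC (_ : (fun j => _) = fun j => (b - 1)^-1 *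
   (\sum_(k < K.+1) em_coef k b * (u j * npowN j.+1 (b - 1 + k%:R)) +
    u j * em_tail K j.+1 b)).
  apply: cseries_cvgZ; apply: cseries_cvgD ct.
  by apply: (cseries_cvg_sum K.+1 (fun k j => em_coef k b * (u j * npowN j.+1 (b - 1 + k%:R)))
    (fun k => em_coef k b * csum (fun j => u j * npowN j.+1 (b - 1 + k%:R)))) => k _;
    exact: cseries_cvgZ.
apply/funext => j; rewrite /tail_sum /em_main mulrA [LHS]mulrC; congr (_ * _).
rewrite mulrDr mulr_sumr; congr (_ + _); apply: eq_bigr => k _; exact: mulrCA.
Qed.

(** This is [(a - 1) zeta (a)]: the term [n = 1] contributes [a - 1], and Euler-Maclaurin gives the
    tail beyond it. *)
Definition zeta_num K a : C := (a - 1) + em_main K 1 a + em_tail K 1 a.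

Definition double_err K a b : C := csum (fun j => npowN j.+1 a * em_tail K j.+1 b).

Definition inner_sum n a : C := \sum_(1 <= i < n) npowN i a.

Definition triple_err K a b c : C :=
  csum (fun j => npowN j.+1 b * inner_sum j.+1 a * em_tail K j.+1 c).

Lemma zeta_numE K a : (0 < K)%N -> 2 <= complex.Re a ->
  (a - 1) * csum (fun j => npowN j.+1 a) = zeta_num K a.
Proof.
move=> K0 a2; have a1 := Re_neq1 a a2.
have H : csum (fun j => npowN j.+1 a) = 1 + tail_sum K 1 a.
  apply: csum_unique; apply: (seq_cvg_shift _ _ 1).1.
  rewrite (_ : (fun n => _) = fun n => 1 + series (fun j => npowN (2 + j) a) n).
    exact: seq_cvgD (seq_cvg_cst _) (tail_sum_cvg K 1 a K0 isT a2).
  apply/funext => n; rewrite addn1 /series /= big_nat_recl // npowN_1.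
  by congr (_ + _); apply: eq_bigr.
rewrite H /tail_sum /zeta_num; field; exact: a1.
Qed.

Lemma zeta_num1 K : zeta_num K 1 = 1.
Proof.
rewrite /zeta_num em_tail1 subrr add0r addr0 /em_main big_ord_recl em_coef1 mul1r.
rewrite npowN_1 big1 ?addr0 // => k _; by rewrite em_coef1 mul0r.
Qed.

Lemma nrm_inner_sum n a : 0 <= complex.Re a -> nrm (inner_sum n.+1 a) <= n%:R.
Proof.
move=> a0; rewrite (le_trans (nrm_sum _ _ _ _)) // big_add1 /=.
apply: (@le_trans _ _ (\sum_(0 <= i < n) 1)); last by rewrite sumr_const_nat subn0.
apply: ler_sum => i _; have := @nrm_npowN_inv R i.+1 a 0 isT a0.
by rewrite expr0 invr1.
Qed.

(** The inner sum costs one power of [j + 1], so exponent [4] leaves more than enough for the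
    quadratic majorant. *)
Lemma nrm_triple_coef a b j : 0 <= complex.Re a -> 4 <= complex.Re b ->
  nrm (npowN j.+1 b * inner_sum j.+1 a) <= 2 * majorant j.
Proof.
move=> a0 b4; apply: le_trans (inv_sqr_le_majorant j).
rewrite nrmM.
have h1 := @nrm_npowN_inv R j.+1 b 4 isT b4.
have h2 : nrm (inner_sum j.+1 a) <= j.+1%:R.
  by rewrite (le_trans (nrm_inner_sum j a a0)) // ler_nat.
rewrite (le_trans (ler_pM (nrm_ge0 _) (nrm_ge0 _) h1 h2)) //.
rewrite (exprS _ 3) invfM mulrAC mulVf ?mul1r ?pnatr_eq0 //.
by rewrite lef_pV2 ?posrE ?exprn_gt0 // ler_weXn2l // ler1n.
Qed.

(** Abel summation exchanges the two sums: the sum over smaller indices becomes a tail over larger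
    ones, to which Euler-Maclaurin applies again. *)
Lemma csum_inner K a b (c : C) : (0 < K)%N -> 2 <= complex.Re a -> 4 <= complex.Re b ->
  2 <= complex.Re (b + c) -> 0 <= complex.Re c ->
  csum (fun j => npowN j.+1 b * inner_sum j.+1 a * npowN j.+1 c) =
  csum (fun j => npowN j.+1 a * tail_sum K j.+1 (b + c)).
Proof.
move=> K0 a2 b4 bc2 c0.
have H := @abel_summation R (fun n => npowN n a) (fun n => npowN n (b + c))
  (fun m => tail_sum K m (b + c)) _ (fun m hm => tail_sum_rec K m _ K0 hm bc2)
  (tail_sum_cvg0 K _ K0 bc2) (fun m hm => tail_sum_le K m _ K0 hm bc2)
  (fun j => nrm_npowN_majorant j a a2) summing_2majorant.
apply: (C_cvg_unique _ _ _ _ ((seq_cvg_shift _ _ 1).2 H)).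
rewrite (_ : (fun n => _) = series (fun j => npowN j.+1 b * inner_sum j.+1 a * npowN j.+1 c)).
  apply: csum_cvg _ summing_2majorant => j; rewrite nrmM -[leRHS]mulr1.
  rewrite ler_pM ?nrm_ge0 ?nrm_triple_coef //; first by lra.
  by have := @nrm_npowN_inv R j.+1 c 0 isT c0; rewrite expr0 invr1.
apply/funext => N; rewrite addn1 big_add1 /series /=; apply: eq_bigr => j _.
by rewrite npowND /inner_sum mulrAC.
Qed.

Lemma ez3_sum K (s : cplx3 R) : (0 < K)%N -> 2 <= complex.Re (s1 s) ->
  4 <= complex.Re (s2 s) -> 2 <= complex.Re (s3 s) ->
  ez3_partial_sum s @ \oo -->
  csum (fun j => npowN j.+1 (s2 s) * inner_sum j.+1 (s1 s) * tail_sum K j.+1 (s3 s)).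
Proof.
move=> K0 a2 b4 c2.
have a0 : 0 <= complex.Re (s1 s) by lra.
have := @abel_summation R (fun n => npowN n (s2 s) * inner_sum n (s1 s))
  (fun n => npowN n (s3 s))
  (fun m => tail_sum K m (s3 s)) _ (fun m hm => tail_sum_rec K m _ K0 hm c2)
  (tail_sum_cvg0 K _ K0 c2) (fun m hm => tail_sum_le K m _ K0 hm c2)
  (fun j => nrm_triple_coef _ _ j a0 b4) summing_2majorant.
rewrite (_ : (fun N => _) = ez3_partial_sum s) //.
apply/funext => N; rewrite /ez3_partial_sum; apply: eq_bigr => n3 _.
rewrite mulr_sumr; apply: eq_bigr => n2 _; rewrite /inner_sum mulr_sumr mulr_sumr.
by apply: eq_bigr => n1 _; rewrite /ez3_term; ring.
Qed.

End ConvergentFormula.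

(** * The triple zeta function as numerator over linear forms *)

Section TripleZetaFormula.
Context {R : realType}.
Local Notation C := (cplx R).
Local Notation I := (option (nat + nat)).
Implicit Types (s : cplx3 R) (n k i j l m K : nat).

(* Summing over [n_3] by Euler-Maclaurin, the [k]-th term leaves a double sum whose
   inner exponent is [tau k = t - 1 + k]; summing that over [n_2], the [j]-th term
   leaves a Riemann zeta value at [omega k j = w - 2 + k + j]. *)
Definition tau k s : C := s2 s + s3 s - 1 + k%:R.

Definition omega k j s : C := s1 s + (tau k s - 1 + j%:R).

(* The hyperplanes are [s_3 = 1] for [None], [t = 2 - k] for [Some (inl k)] and
   [w = 3 - l] for [Some (inr l)]. *)
Definition zform (i : I) s : C :=
  match i with
  | None => s3 s - 1
  | Some (inl k) => tau k s - 1
  | Some (inr l) => s1 s + s2 s + s3 s - 3 + l%:R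
  end.

Definition zactive (i : I) : bool :=
  if i is Some (inl k) then bern k != 0 :> R else true.

Definition zidxT K : seq I := [seq Some (inl k) | k <- iota 0 K.+1 & bern k != 0 :> R].

(** The range goes up to [2 * K] because the index is [k + j] with [k, j <= K]. *)
Definition zidxW K : seq I := [seq Some (inr l) | l <- iota 0 (2 * K).+1].

Definition zidx K : seq I := None :: zidxT K ++ zidxW K.

(** The triple zeta function times all forms of [zidx K]: each summand keeps the forms that its own
    denominator does not cancel. *)
Definition znum K s : C :=
  \sum_(k < K.+1) em_coef k (s3 s) *
    (\prod_(i <- zidxT K | i != Some (inl (k : nat))) zform i s) *
    (\sum_(j < K.+1) em_coef j (tau k s) * zeta_num K (omega k j s) *
       (\prod_(i <- zidxW K | i != Some (inr (k + j)%N)) zform i s) +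
     double_err K (s1 s) (tau k s) * \prod_(i <- zidxW K) zform i s) +
  triple_err K (s1 s) (s2 s) (s3 s) *
    ((\prod_(i <- zidxT K) zform i s) * \prod_(i <- zidxW K) zform i s).

Lemma omega_form k j s : omega k j s - 1 = zform (Some (inr (k + j)%N)) s.
Proof. by rewrite /omega /tau /= natrD; ring. Qed.

Lemma zidxT_uniq K : uniq (zidxT K).
Proof. by rewrite map_inj_uniq ?filter_uniq ?iota_uniq // => x y []. Qed.

Lemma zidxW_uniq K : uniq (zidxW K).
Proof. by rewrite map_inj_uniq ?iota_uniq // => x y []. Qed.

Lemma mem_zidxT K k : (Some (inl k) \in zidxT K) = (bern k != 0 :> R) && (k <= K)%N.
Proof.
rewrite mem_map => [|x y []//]; by rewrite mem_filter mem_iota.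
Qed.

Lemma mem_zidxW K l : (Some (inr l) \in zidxW K) = (l <= 2 * K)%N.
Proof. by rewrite mem_map => [|x y []//]; rewrite mem_iota. Qed.

Lemma mem_zidxT_inr K l : Some (inr l) \notin zidxT K.
Proof. by apply/mapP => -[]. Qed.

Lemma mem_zidxW_inl K k : Some (inl k) \notin zidxW K.
Proof. by apply/mapP => -[]. Qed.

Lemma zidx_uniq K : uniq (zidx K).
Proof.
rewrite /= cat_uniq zidxT_uniq zidxW_uniq andbT mem_cat negb_or.
apply/andP; split; first by apply/andP; split; apply/mapP => -[].
by apply/hasPn => _ /mapP[l _ ->]; exact: mem_zidxT_inr.
Qed.

Lemma em_coef_inactive k (a : C) : bern k = 0 :> R -> em_coef k a = 0.
Proof. by move=> b0; rewrite /em_coef /bernC b0 mul0r. Qed.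

Lemma zetaZ_formula K s (f : C) : (0 < K)%N ->
  4 <= complex.Re (s1 s) -> 4 <= complex.Re (s2 s) -> 4 <= complex.Re (s3 s) ->
  ez3_partial_sum s @ \oo --> f ->
  f * \prod_(i <- zidx K) zform i s = znum K s.
Proof.
move=> K0 a4 b4 c4 cf.
have a2 : 2 <= complex.Re (s1 s) by lra.
have c2 : 2 <= complex.Re (s3 s) by lra.
have a0 : 0 <= complex.Re (s1 s) by lra.
have t2 k : 2 <= complex.Re (tau k s).
  rewrite /tau !ReD ReN -RtoC_nat /=; have : 0 <= k%:R :> R by []; lra.
have w2 k j : 2 <= complex.Re (omega k j s).
  have := t2 k; rewrite /omega !ReD ReN -[j%:R]RtoC_nat /=.
  have : 0 <= j%:R :> R by []; lra.
have fE := C_cvg_unique _ _ _ cf (ez3_sum K s K0 a2 b4 c2).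
have := tail_sum_expand K _ _ _ K0 c2 (fun j => nrm_triple_coef _ _ j a0 b4) summing_2majorant.
rewrite -fE => E1.
(* The double zeta value left by the [k]-th Euler-Maclaurin term in [n_3]. *)
pose Z k := csum (fun j => npowN j.+1 (s2 s) * inner_sum j.+1 (s1 s) *
  npowN j.+1 (s3 s - 1 + k%:R)).
have ZE k : (tau k s - 1) * Z k =
    \sum_(j < K.+1) em_coef j (tau k s) * csum (fun i => npowN i.+1 (omega k j s)) +
    double_err K (s1 s) (tau k s).
  have tE : s2 s + (s3 s - 1 + k%:R) = tau k s by rewrite /tau; ring.
  have c0 : 0 <= complex.Re (s3 s - 1 + k%:R).
    rewrite !ReD ReN -RtoC_nat /=; have : 0 <= k%:R :> R by []; lra.
  have bc2 : 2 <= complex.Re (s2 s + (s3 s - 1 + k%:R)) by rewrite tE.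
  rewrite /Z (csum_inner K _ _ _ K0 a2 b4 bc2 c0) tE.
  rewrite (tail_sum_expand K _ _ _ K0 (t2 k) (fun j => nrm_npowN_majorant j (s1 s) a2)
    summing_2majorant); congr (_ + _).
  apply: eq_bigr => j _; congr (_ * csum _); apply/funext => i.
  by rewrite -npowND.
rewrite /zidx big_cons big_cat /= mulrA (mulrC f) E1 mulrDl.
rewrite /znum; congr (_ + _).
rewrite mulr_suml; apply: eq_bigr => k _; rewrite -/(Z k).
(* For a vanishing Bernoulli number the product contains no form to cancel the denominator, but the
   term itself is [0]. *)
have [b0|b0] := eqVneq (bern k : R) 0; first by rewrite em_coef_inactive // !mul0r.
have kT : Some (inl (k : nat)) \in zidxT K by rewrite mem_zidxT b0 -ltnS ltn_ord.
rewrite (bigD1_seq _ kT (zidxT_uniq K)) /=.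
rewrite [LHS](_ : _ = em_coef k (s3 s) *
  (\prod_(i <- zidxT K | i != Some (inl (k : nat))) zform i s) *
  (((tau k s - 1) * Z k) * \prod_(i <- zidxW K) zform i s)); last by ring.
rewrite ZE mulrDl; congr (_ * (_ + _)); rewrite mulr_suml; apply: eq_bigr => j _.
have jW : Some (inr (k + j)%N) \in zidxW K.
  by rewrite mem_zidxW; have := ltn_ord k; have := ltn_ord j; lia.
rewrite (bigD1_seq _ jW (zidxW_uniq K)) /= -(zeta_numE K (omega k j s)) //.
rewrite -[s1 s + s2 s + s3 s - 3 + _]/(zform (Some (inr (k + j)%N)) s) -omega_form.
ring.
Qed.

End TripleZetaFormula.

Lemma norm_coord_le (K : numDomainType) m n (A : 'M[K]_(m, n)) i j : `|A i j| <= `|A|.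
Proof.
rewrite [leRHS]/Num.norm /= mx_normE -[leLHS]nngE num_le.
exact: (@le_bigmax _ _ _ _ (fun ij => `|A ij.1 ij.2|%:nng) (i, j)).
Qed.

(** * Holomorphy of the numerator on balls *)

Section TripleZetaModel.
Context {R : realType}.
Local Notation C := (cplx R).
Local Notation I := (option (nat + nat)).
Implicit Types (s : cplx3 R) (n k i j l m K : nat).

Lemma nrm_coord s (j : 'I_3) : nrm (s 0 j : C) <= nrm s.
Proof. by rewrite -RtoC_le -!nrmE; exact: norm_coord_le. Qed.

Lemma s1_holo s : differentiable (@s1 R) s.
Proof. exact: differentiable_coord. Qed.

Lemma s2_holo s : differentiable (@s2 R) s.
Proof. exact: differentiable_coord. Qed.

Lemma s3_holo s : differentiable (@s3 R) s.
Proof. exact: differentiable_coord. Qed.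

Lemma tau_holo k s : differentiable (tau k) s.
Proof.
apply: holoD; last exact: holo_cst.
apply: holoB; last exact: holo_cst.
by apply: holoD; [exact: s2_holo|exact: s3_holo].
Qed.

Lemma omega_holo k j s : differentiable (omega k j) s.
Proof.
apply: holoD; first exact: s1_holo.
apply: holoD; last exact: holo_cst.
by apply: holoB; [exact: tau_holo|exact: holo_cst].
Qed.

Lemma holo_comp (g : C -> C) (h : cplx3 R -> C) s : differentiable h s ->
  differentiable g (h s) -> differentiable (fun z => g (h z)) s.
Proof. by move=> dh dg; exact: (differentiable_comp dh dg). Qed.

Lemma zform_holo (i : I) s : differentiable (zform i) s.
Proof.
case: i => [[k|l]|] /=.
- by apply: holoB; [exact: tau_holo|exact: holo_cst].
- apply: holoD; last exact: holo_cst.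
  apply: holoB; last exact: holo_cst.
  by apply: holoD; [apply: holoD; [exact: s1_holo|exact: s2_holo]|exact: s3_holo].
- by apply: holoB; [exact: s3_holo|exact: holo_cst].
Qed.

Definition cball (r : nat) : set (cplx3 R) := [set s | nrm s < r%:R].

Lemma cball_open r : open (cball r).
Proof.
rewrite (_ : cball r = [set s : cplx3 R | nrm (0 - s) < r%:R]); first exact: nrm_open_ball.
by apply/funext => s; rewrite /cball /= sub0r nrmN.
Qed.

Lemma cball_convex r : convex_set (cball r).
Proof.
rewrite (_ : cball r = [set s : cplx3 R | nrm (0 - s) < r%:R]); first exact: convex_ball.
by apply/funext => s; rewrite /cball /= sub0r nrmN.
Qed.

Lemma Re_coord r s (j : 'I_3) : cball r s -> - r%:R < complex.Re (s 0 j).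
Proof.
move=> sr; have := Re_le_nrm (s 0 j : C); have := nrm_coord s j.
by move: sr; rewrite /cball /= ler_norml => ? ? /andP[]; lra.
Qed.

Lemma Re_tau r k s : cball r s -> - (2 * r).+1%:R < complex.Re (tau k s).
Proof.
move=> sr; have := Re_coord r s 1 sr; have := Re_coord r s 2 sr.
rewrite /tau /s2 /s3 !ReD ReN -RtoC_nat /= -[(2 * r).+1%:R]natr1 natrM.
have : 0 <= k%:R :> R by []; lra.
Qed.

Lemma nrm_tau r k s : cball r s -> nrm (tau k s) <= (2 * r).+1%:R + k%:R.
Proof.
move=> sr; rewrite /tau (le_trans (nrmD _ _)) // nrm_nat lerD2r.
rewrite (le_trans (nrm_sub _ _)) // nrm1 -natr1 lerD2r (le_trans (nrmD _ _)) //.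
have := nrm_coord s 1; have := nrm_coord s 2; move: sr; rewrite /cball /= natrM.
by rewrite /s2 /s3; lra.
Qed.

Lemma Re_omega r k j s : cball r s -> - (3 * r).+2%:R < complex.Re (omega k j s).
Proof.
move=> sr; have := Re_coord r s 0 sr; have := Re_tau r k s sr.
rewrite /omega /s1 !ReD ReN -[j%:R]RtoC_nat /= -[(2 * r).+1%:R]natr1.
rewrite -[(3 * r).+2%:R]natr1 -[(3 * r).+1%:R]natr1 !natrM.
have : 0 <= j%:R :> R by []; lra.
Qed.

Lemma zeta_num_holo K (B : nat) (a : C) : (B < K)%N -> - B%:R < complex.Re a ->
  differentiable (zeta_num K) a.
Proof.
move=> BK aB; apply: holoD; last exact: (em_tail_holo K 1 _ _ isT BK aB).
by apply: holoD; [exact: holo_subc|exact: em_main_holo].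
Qed.

Lemma inv_pow_majorant j (p q : nat) : (p.+2 <= q)%N ->
  j.+1%:R ^+ p / j.+1%:R ^+ q <= 2 * majorant j :> R.
Proof.
move=> pq; apply: le_trans (inv_sqr_le_majorant j).
have j0 : 0 < j.+1%:R :> R by [].
have -> : (q = p + (q - p))%N by lia.
rewrite exprD invfM mulrA divff ?mul1r ?expf_neq0 ?gt_eqF //.
by rewrite lef_pV2 ?posrE ?exprn_gt0 // ler_weXn2l ?ler1n //; lia.
Qed.

Lemma npowN_cball r s (i : 'I_3) n : cball r s -> (0 < n)%N ->
  nrm (npowN n (s 0 i)) <= n%:R ^+ r.
Proof.
move=> sr n0; have := @nrm_npowN_le R n (s 0 i) r 0 n0.
by rewrite expr0 divr1 sub0r; apply; rewrite ltW // Re_coord.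
Qed.

(** On the ball of radius [r] the power grows at most like [n ^ r] and [Re (tau k)] exceeds
    [- (2 r + 1)], so the remainder decays like [n ^ - (K - 2 r - 2)]. The quadratic majorant
    requires [K - 2 r - 2 >= r + 2], that is [K >= 3 r + 4]. *)
Lemma double_err_holo r K k s : (3 * r + 4 <= K)%N -> cball r s ->
  differentiable (fun z => double_err K (s1 z) (tau k z)) s.
Proof.
move=> rK sr; have BK : ((2 * r).+1 < K)%N by lia.
have [c c0 hc] := em_tail_bound K ((2 * r).+1%:R + k%:R : R) (2 * r).+1 BK.
have bd j z : cball r z ->
    nrm (npowN j.+1 (s1 z) * em_tail K j.+1 (tau k z)) <= c * 2 * majorant j.
  move=> zr; have [_ h] := hc j.+1 (tau k z) isT (nrm_tau r k z zr) (ltW (Re_tau r k z zr)).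
  have hp := npowN_cball r z 0 j.+1 zr isT.
  rewrite nrmM (le_trans (ler_pM (nrm_ge0 _) (nrm_ge0 _) hp h)) // mulrCA -mulrA ler_wpM2l //.
  by apply: inv_pow_majorant; lia.
have c2 : 0 <= c * 2 by rewrite mulr_ge0.
apply: (@weierstrass_M_test R _ (cball r)
  (fun j z => npowN j.+1 (s1 z) * em_tail K j.+1 (tau k z)) _ _
  (cball_open r) _ bd (summing_majorant _ c2) _ s sr).
  move=> j z zr; apply: holoM.
    by apply: holo_comp; [exact: s1_holo|exact: npowN_holo].
  by apply: holo_comp; [exact: tau_holo|exact: (em_tail_holo K j.+1 _ _ isT BK (Re_tau r k z zr))].
by move=> z zr; apply: csum_cvg (fun j => bd j z zr) (summing_majorant _ c2).
Qed.

Lemma inner_sum_cball r s n : cball r s -> nrm (inner_sum n.+1 (s1 s)) <= n.+1%:R ^+ r.+1.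
Proof.
move=> sr; apply: le_trans (nrm_sum _ _ _ _) _; rewrite big_add1 /=.
apply: (@le_trans _ _ (\sum_(0 <= i < n) n.+1%:R ^+ r)); last first.
  rewrite sumr_const_nat subn0 exprS -(mulr_natl _ n); apply: ler_wpM2r; last by rewrite ler_nat.
  exact: exprn_ge0.
rewrite big_seq [leRHS]big_seq; apply: ler_sum => i; rewrite mem_index_iota => /andP[_ iN].
apply: le_trans (npowN_cball r s 0 i.+1 sr isT) _.
by apply: lerXn2r; rewrite ?nnegrE ?ler_nat // ltnW.
Qed.

(** Here the growth is [n ^ (2 r + 1)], one power coming from the inner sum, against a decay
    [n ^ - (K - r - 1)]; the condition is again [K >= 3 r + 4]. *)
Lemma triple_err_holo r K s : (3 * r + 4 <= K)%N -> cball r s ->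
  differentiable (fun z => triple_err K (s1 z) (s2 z) (s3 z)) s.
Proof.
move=> rK sr; have BK : (r < K)%N by lia.
have [c c0 hc] := em_tail_bound K (r%:R : R) r BK.
have bd j z : cball r z ->
    nrm (npowN j.+1 (s2 z) * inner_sum j.+1 (s1 z) * em_tail K j.+1 (s3 z)) <=
    c * 2 * majorant j.
  move=> zr; have [|_ h] := hc j.+1 (s3 z) isT _ (ltW (Re_coord r z 2 zr)).
    by rewrite (le_trans (nrm_coord z 2)) // ltW.
  have hp := npowN_cball r z 1 j.+1 zr isT.
  have hq := inner_sum_cball r z j zr.
  have hpq := ler_pM (nrm_ge0 _) (nrm_ge0 _) hp hq.
  rewrite !nrmM (le_trans (ler_pM _ (nrm_ge0 _) hpq h)) ?mulr_ge0 ?nrm_ge0 //.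
  rewrite mulrCA -mulrA ler_wpM2l // -exprD.
  by apply: inv_pow_majorant; lia.
have c2 : 0 <= c * 2 by rewrite mulr_ge0.
apply: (@weierstrass_M_test R _ (cball r)
  (fun j z => npowN j.+1 (s2 z) * inner_sum j.+1 (s1 z) * em_tail K j.+1 (s3 z)) _ _
  (cball_open r) _ bd (summing_majorant _ c2) _ s sr).
  move=> j z zr; apply: holoM.
    apply: holoM; first by apply: holo_comp; [exact: s2_holo|exact: npowN_holo].
    apply: holo_sum => n _.
    by apply: holo_comp; [exact: s1_holo|exact: npowN_holo].
  by apply: holo_comp; [exact: s3_holo|exact: (em_tail_holo K j.+1 _ _ isT BK (Re_coord r z 2 zr))].
by move=> z zr; apply: csum_cvg (fun j => bd j z zr) (summing_majorant _ c2).
Qed.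

Lemma znum_holo r K s : (3 * r + 4 <= K)%N -> cball r s -> differentiable (znum K) s.
Proof.
move=> rK sr; have pr (t : seq I) (P : pred I) :
    differentiable (fun z => \prod_(i <- t | P i) zform i z) s.
  by apply: holo_prod => i _; exact: zform_holo.
apply: holoD; last first.
  by apply: holoM; [exact: triple_err_holo sr|apply: holoM; exact: pr].
apply: holo_sum => k _; apply: holoM.
  by apply: holoM; [apply: holo_comp; [exact: s3_holo|exact: em_coef_holo]|exact: pr].
apply: holoD; last by apply: holoM; [exact: double_err_holo sr|exact: pr].
apply: holo_sum => j _; apply: holoM; last exact: pr.
apply: holoM; first by apply: holo_comp; [exact: tau_holo|exact: em_coef_holo].
apply: holo_comp; first exact: omega_holo.
by apply: zeta_num_holo (Re_omega r k j s sr); lia.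
Qed.

End TripleZetaModel.

(** * Nonvanishing of the numerator at test points *)

Section NonvanishingNumerators.
Context {R : realType}.
Local Notation C := (cplx R).
Local Notation I := (option (nat + nat)).
Local Notation zidxT := (@zidxT R).
Implicit Types (s : cplx3 R) (n k i j l m K : nat) (a b c : C).

Definition point3 a b c : cplx3 R := \row_(i < 3) [:: a; b; c]`_i.

Lemma s1_point3 a b c : s1 (point3 a b c) = a. Proof. by rewrite /s1 mxE. Qed.
Lemma s2_point3 a b c : s2 (point3 a b c) = b. Proof. by rewrite /s2 mxE. Qed.
Lemma s3_point3 a b c : s3 (point3 a b c) = c. Proof. by rewrite /s3 mxE. Qed.
Definition point3E := (s1_point3, s2_point3, s3_point3).

Lemma double_err1 K a : double_err K a 1 = 0.
Proof.
rewrite -csum0 /double_err; congr csum; apply/funext => j.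
by rewrite em_tail1 mulr0.
Qed.

Lemma triple_err1 K a b : triple_err K a b 1 = 0.
Proof.
rewrite -csum0 /triple_err; congr csum; apply/funext => j.
by rewrite em_tail1 mulr0.
Qed.

Lemma rising_nat_neq0 n k : rising (n.+1%:R : C) k != 0.
Proof. by apply/prodf_neq0 => i _; rewrite -natrD pnatr_eq0. Qed.

Lemma bernC_neq0 k : (bernC k != 0 :> C) = (bern k != 0 :> R).
Proof. by rewrite /bernC -RtoC0 (inj_eq RtoC_inj). Qed.

Lemma prod_zidxT0 K k s (P : pred I) : bern k != 0 :> R -> (k <= K)%N -> P (Some (inl k)) ->
  zform (Some (inl k)) s = 0 -> \prod_(i <- zidxT K | P i) zform i s = 0.
Proof.
move=> bk kK Pk s0; apply/eqP; rewrite prodf_seq_eq0; apply/hasP.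
by exists (Some (inl k)); [rewrite mem_zidxT bk|rewrite Pk s0 eqxx].
Qed.

Lemma prod_zidxW0 K l s (P : pred I) : (l <= 2 * K)%N -> P (Some (inr l)) ->
  zform (Some (inr l)) s = 0 -> \prod_(i <- zidxW K | P i) zform i s = 0.
Proof.
move=> lK Pl s0; apply/eqP; rewrite prodf_seq_eq0; apply/hasP.
by exists (Some (inr l)); [rewrite mem_zidxW|rewrite Pl s0 eqxx].
Qed.

Lemma zformT_sub k k' s : zform (Some (inl k')) s = zform (Some (inl k)) s + (k'%:R - k%:R).
Proof. by rewrite /= /tau; ring. Qed.

Lemma zformW_sub l l' s : zform (Some (inr l')) s = zform (Some (inr l)) s + (l'%:R - l%:R).
Proof. by rewrite /=; ring. Qed.

Lemma prod_zidxT_neq0 K k s : zform (Some (inl k)) s = 0 ->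
  \prod_(i <- zidxT K | i != Some (inl k)) zform i s != 0.
Proof.
move=> s0; rewrite prodf_seq_neq0; apply/allP => _ /mapP[k' _ ->].
apply/implyP => kk; rewrite (zformT_sub k) s0 add0r subr_eq0 eqr_nat.
by apply: contraNneq kk => ->.
Qed.

Lemma prod_zidxW_neq0 K l s : zform (Some (inr l)) s = 0 ->
  \prod_(i <- zidxW K | i != Some (inr l)) zform i s != 0.
Proof.
move=> s0; rewrite prodf_seq_neq0; apply/allP => _ /mapP[l' _ ->].
apply/implyP => ll; rewrite (zformW_sub l) s0 add0r subr_eq0 eqr_nat.
by apply: contraNneq ll => ->.
Qed.

(* On [tau k = 1] with [s1 = 1] the inner double sum reduces to [zeta_num 1 = 1]. *)
Lemma inner_num K k s : s1 s = 1 -> tau k s = 1 ->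
  \sum_(j < K.+1) em_coef j (tau k s) * zeta_num K (omega k j s) *
     (\prod_(i <- zidxW K | i != Some (inr (k + j)%N)) zform i s) +
  double_err K (s1 s) (tau k s) * (\prod_(i <- zidxW K) zform i s) =
  \prod_(i <- zidxW K | i != Some (inr k)) zform i s.
Proof.
move=> s11 t1; rewrite t1 double_err1 mul0r addr0 big_ord_recl [X in _ + X]big1 ?addr0 => [|j _].
  rewrite em_coef1 mul1r [(k + _)%N]addn0 /omega s11 t1.
  by rewrite subrr !addr0 zeta_num1 mul1r.
by rewrite em_coef1 !mul0r.
Qed.

(** At this point the forms of [t = 2 - k] and [w = 3 - k] both vanish. Every other index keeps the
    first form as a factor, as does the triple remainder, so only the [k]-th term survives, and
    [inner_num] evaluates it. *)
Lemma znum_neq0T K k : bern k != 0 :> R -> (k <= K)%N ->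
  znum K (point3 1 (- k%:R) 2) != 0.
Proof.
move=> bk kK; set s := point3 _ _ _.
have t1 : tau k s = 1 by rewrite /tau !point3E; ring.
have T0 : zform (Some (inl k)) s = 0 by rewrite /= t1 subrr.
have W0 : zform (Some (inr k)) s = 0 by rewrite /= !point3E; ring.
have PT0 := prod_zidxT0 K k s xpredT bk kK isT T0.
rewrite /znum [X in _ + X](_ : _ = 0) ?addr0; last by rewrite PT0 mul0r mulr0.
have kK1 : (k < K.+1)%N by [].
rewrite (big_only1 (Ordinal kK1)) //= => [|k' kk' _]; last first.
  rewrite (prod_zidxT0 K k) ?mulr0 ?mul0r //.
  by apply: contraNneq kk' => -[] kk'; apply/eqP/val_inj.
rewrite inner_num // ?point3E //.
rewrite !mulf_neq0 ?prod_zidxT_neq0 ?prod_zidxW_neq0 ?bernC_neq0 //.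
by rewrite (_ : 2 - 1 = 1%:R :> C) ?rising_nat_neq0 //; ring.
Qed.

(** At exponent [s3 = 1] only the coefficient [k = 0] is nonzero and the triple remainder vanishes;
    then [tau 0 = 1] and [inner_num] applies. *)
Lemma znum_neq0S K : znum K (point3 1 1 1) != 0.
Proof.
set s := point3 _ _ _.
have t1 : tau 0 s = 1 by rewrite /tau !point3E; ring.
have T0 : zform (Some (inl 0%N)) s = 0 by rewrite /= t1 subrr.
have W0 : zform (Some (inr 0%N)) s = 0 by rewrite /= !point3E; ring.
have s3E : s3 s = 1 by exact: s3_point3.
rewrite /znum s3E triple_err1 mul0r addr0.
rewrite big_ord_recl [X in _ + X]big1 ?addr0 => [|k _]; last first.
  by rewrite em_coef1 !mul0r.
rewrite inner_num ?point3E // em_coef1 mul1r.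
by rewrite mulf_neq0 ?prod_zidxT_neq0 ?prod_zidxW_neq0.
Qed.

Lemma bernC_mul_odd k j : odd (k + j) -> k <> 1%N -> j <> 1%N -> bernC k * bernC j = 0 :> C.
Proof.
move=> okj k1 j1; rewrite /bernC; case/boolP: (odd k) => ok.
  by rewrite (@bern_odd R k ok) ?mul0r //; case: k ok k1 {okj} => [|[|[|]]].
have oj : odd j by move: okj; rewrite oddD (negbTE ok).
by rewrite (@bern_odd R j oj) ?mulr0 //; case: j oj j1 {okj} => [|[|[|]]].
Qed.

(* For odd [l] only [(k, j) = (1, l - 1)] and [(l - 1, 1)] contribute. *)
Lemma bern_convolution_odd K m : (m.*2.+3 <= K)%N ->
  \sum_(k < K.+1) \sum_(j < K.+1 | (k + j)%N == m.*2.+3)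
    bernC k * bernC j / k.+1%:R = bernC 1 * bernC m.*2.+2 * (2^-1 + m.*2.+3%:R^-1) :> C.
Proof.
move=> lK; set l := m.*2.+3.
have inner k : (k <= l)%N ->
   \sum_(j < K.+1 | (k + j)%N == l) bernC k * bernC j / k.+1%:R =
   bernC k * bernC (l - k) / k.+1%:R :> C.
  move=> kl; have jK : (l - k < K.+1)%N by lia.
  rewrite (big_only1 (Ordinal jK)) //=; first by apply/eqP; lia.
  move=> j jn /eqP kj; case/eqP: jn; apply: val_inj => /=; lia.
have k1 : (1 < K.+1)%N by lia.
have k2 : (m.*2.+2 < K.+1)%N by lia.
rewrite (bigD1 (Ordinal k1)) //= [X in _ + X](bigD1 (Ordinal k2)) //=
  [X in _ + (_ + X)]big1 ?addr0.
  rewrite !inner /l; [|lia..].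
  by rewrite subn1 subSnn /= mulrDr [bernC m.*2.+2 * _]mulrC.
move=> k /andP[kn1 kn2]; apply: big1 => j /eqP kj.
have {}kn1 : (k : nat) <> 1%N by move=> E; case/eqP: kn1; apply: val_inj.
have {}kn2 : (k : nat) <> m.*2.+2 by move=> E; case/eqP: kn2; apply: val_inj.
have ol : odd l by rewrite /l /= odd_double.
rewrite bernC_mul_odd ?mul0r ?kj // => j1.
by apply: kn2; move: kj; rewrite j1 addn1 => -[].
Qed.

(** Terms with [k + j <> l], and both remainders, keep the vanishing form of [w = 3 - l]. Since
    [tau k = k + 2], the two rising factorials of a surviving term combine to [rising 1 l], and the
    omitted form [tau k - 1 = k + 1] becomes the weight [1 / (k + 1)]. By [bern_convolution_odd] the
    weights of the two remaining pairs add up to [1 / 2 + 1 / l]. *)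
Lemma znum_neq0W K m : (m.*2.+3 <= K)%N ->
  znum K (point3 (- m.*2.+3%:R) 1 2) != 0.
Proof.
move=> lK; set l := m.*2.+3; set s := point3 _ _ _.
have tE k : tau k s = k.+2%:R by rewrite /tau !point3E -!natr1; ring.
have W0 : zform (Some (inr l)) s = 0 by rewrite /= !point3E; ring.
have l2K : (l <= 2 * K)%N by rewrite /l; lia.
have PW00 := prod_zidxW0 K l s xpredT l2K isT W0.
have s3E : s3 s = 2 by exact: s3_point3.
rewrite /znum [X in _ + X](_ : _ = 0) ?addr0; last by rewrite PW00 !mulr0.
pose PT : C := \prod_(i <- zidxT K) zform i s.
pose PW : C := \prod_(i <- zidxW K | i != Some (inr l)) zform i s.
have PT0 : PT != 0.
  rewrite prodf_seq_neq0; apply/allP => _ /mapP[k _ ->] /=.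
  by rewrite tE -natr1 addrK pnatr_eq0.
have PW0 : PW != 0 by exact: prod_zidxW_neq0.
have -> : \sum_(k < K.+1) em_coef k (s3 s) *
    (\prod_(i <- zidxT K | i != Some (inl (k : nat))) zform i s) *
    (\sum_(j < K.+1) em_coef j (tau k s) * zeta_num K (omega k j s) *
       (\prod_(i <- zidxW K | i != Some (inr (k + j)%N)) zform i s) +
     double_err K (s1 s) (tau k s) * \prod_(i <- zidxW K) zform i s) =
    PT * PW * rising 1 l *
    \sum_(k < K.+1) \sum_(j < K.+1 | (k + j)%N == l) bernC k * bernC j / k.+1%:R.
  rewrite mulr_sumr; apply: eq_bigr => k _; rewrite PW00 mulr0 addr0.
  rewrite [in RHS]big_mkcond !mulr_sumr; apply: eq_bigr => j _.
  case: eqP => [kj|/eqP kj]; last first.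
    rewrite (prod_zidxW0 K l) ?mulr0 //=.
    by apply: contraNneq kj => -[->].
  rewrite kj -/PW; have -> : omega k j s = 1.
    by apply/eqP; rewrite -subr_eq0 omega_form kj W0.
  rewrite zeta_num1 mulr1 s3E tE /em_coef.
  have [b0|b0] := eqVneq (bern k : R) 0; first by rewrite /bernC b0 !(mul0r, mulr0).
  have kT : Some (inl (k : nat)) \in zidxT K by rewrite mem_zidxT b0 -ltnS ltn_ord.
  rewrite /PT (bigD1_seq _ kT (zidxT_uniq K)) /= tE.
  have -> : k.+2%:R - 1 = k.+1%:R :> C by rewrite -natr1 addrK.
  rewrite -kj risingD (_ : 2 - 1 = 1 :> C); last by ring.
  rewrite (_ : 1 + k%:R = k.+1%:R :> C) ?nat1r //.
  by field; rewrite nat1r pnatr_eq0.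
rewrite bern_convolution_odd //.
rewrite !mulf_neq0 // ?bernC_neq0 ?(rising_nat_neq0 0) //.
- by rewrite bern1 oppr_eq0 invr_eq0 pnatr_eq0.
- by apply/bern_neq0; right; rewrite /= odd_double.
Qed.

End NonvanishingNumerators.

(** * Absolute convergence in a product of half-planes *)

Section AbsoluteConvergence.
Context {R : realType}.
Local Notation C := (cplx R).
Implicit Types (s : cplx3 R) (n : nat).

Let G n : R := 2 * majorant n.-1.

Let G_ge0 n : 0 <= G n.
Proof. by rewrite mulr_ge0 // majorant_ge0. Qed.

(** As [0.-1 = 0], the term [G 0] repeats [G 1]; it costs at most [2], and the rest at most [2]. *)
Lemma nneseries_majorant_lty : (\sum_(n <oo) (G n)%:E < +oo)%E.
Proof.
apply: (@le_lt_trans _ _ 4%:E); last exact: ltry.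
apply: lime_le; first by apply: is_cvg_nneseries => n _ _; rewrite lee_fin G_ge0.
apply: nearW => -[|n]; first by rewrite big_geq // lee_fin.
rewrite sumEFin lee_fin big_nat_recl //= -mulr_sumr /G /=.
have := @sum_majorant_le1 R 1; rewrite big_nat1 => h1.
by have := @sum_majorant_le1 R n; lra.
Qed.

Lemma esum_majorant : exists2 S : R, 0 <= S & forall c : R, 0 <= c ->
  \esum_(n in [set: nat]) (c * G n)%:E = (c * S)%:E.
Proof.
have S0 : (0 <= \sum_(n <oo) (G n)%:E)%E by apply: nneseries_ge0 => n _ _; rewrite lee_fin G_ge0.
exists (fine (\sum_(n <oo) (G n)%:E)); first exact: fine_ge0.
move=> c c0; rewrite -nneseries_esumT => [|n]; last by rewrite lee_fin mulr_ge0 ?G_ge0.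
under eq_eseriesr do rewrite EFinM.
rewrite nneseriesZl => [|n _]; last by rewrite lee_fin G_ge0.
by rewrite EFinM fineK // ge0_fin_numE // nneseries_majorant_lty.
Qed.

(** The terms are dominated by a product of three summable sequences over all triples, the ordering
    of the indices being dropped. This provides an open set on which a continuation must agree with
    the series. *)
Lemma ez3_abs_convergent_halfspaces s : 2 <= complex.Re (s1 s) ->
  2 <= complex.Re (s2 s) -> 2 <= complex.Re (s3 s) -> ez3_abs_convergent s.
Proof.
move=> a2 b2 c2; rewrite /ez3_abs_convergent /summable.
have [S S0 GS] := esum_majorant.
pose h (n : nat * nat * nat) : \bar R := (G n.1.1 * G n.1.2 * G n.2)%:E.
have G2 (i j : nat) : 0 <= G i * G j by rewrite mulr_ge0 ?G_ge0.
have hE : \esum_(n in setT) h n = (S * S * S)%:E.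
  have -> : [set: nat * nat * nat] = [set: nat * nat] `*`` (fun=> [set: nat]).
    by apply/seteqP; split.
  rewrite -(esum_esum (a := fun p n => (G p.1 * G p.2 * G n)%:E)); last first.
    by move=> p n _ _; rewrite lee_fin mulr_ge0 ?G_ge0.
  rewrite (eq_esum (b := fun p => (G p.1 * G p.2 * S)%:E)); last first.
    by move=> p _; exact: GS.
  have -> : [set: nat * nat] = [set: nat] `*`` (fun=> [set: nat]).
    by apply/seteqP; split.
  rewrite -(esum_esum (a := fun i j => (G i * G j * S)%:E)); last first.
    by move=> i j _ _; rewrite lee_fin mulr_ge0.
  rewrite (eq_esum (b := fun i => (S * S * G i)%:E)); last first.
    move=> i _; rewrite (_ : S * S * G i = (G i * S) * S); last by ring.
    rewrite -(GS (G i * S)); last by rewrite mulr_ge0 ?G_ge0.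
    by apply: eq_esum => j _; congr (_%:E); ring.
  by rewrite GS ?mulr_ge0.
apply: (@le_lt_trans _ _ (\esum_(n in setT) h n)); last by rewrite hE ltry.
have bd n (a : C) : 2 <= complex.Re a -> (0 < n)%N -> nrm (npowN n a) <= G n.
  by move=> ha; case: n => // n _; exact: nrm_npowN_majorant.
have tb n1 n2 n3 : (0 < n1 < n2)%N -> (n2 < n3)%N ->
    nrm (ez3_term s n1 n2 n3) <= G n1 * G n2 * G n3.
  move=> /andP[n10 n12] n23; have n20 : (0 < n2)%N := leq_trans n10 (ltnW n12).
  have n30 : (0 < n3)%N := leq_trans n20 (ltnW n23).
  rewrite /ez3_term !nrmM; apply: ler_pM; rewrite ?mulr_ge0 ?nrm_ge0 //; last exact: bd.
  by apply: ler_pM; rewrite ?nrm_ge0 //; exact: bd.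
rewrite esum_mkcond; apply: le_esum => -[[n1 n2] n3] _.
case: ifPn => [|_]; last by rewrite lee_fin mulr_ge0 ?G_ge0.
rewrite inE => -[n12 n23]; rewrite gee0_abs; first by rewrite lee_fin; exact: tb.
by rewrite lee_fin; exact: (nrm_ge0 (ez3_term s n1 n2 n3)).
Qed.

End AbsoluteConvergence.

Lemma norm_lt_coord (K : numDomainType) m n (A : 'M[K]_(m, n)) (e : K) : 0 < e ->
  (forall i j, `|A i j| < e) -> `|A| < e.
Proof.
move=> e0; move: e0 (e0) => /ltW/nonnegP[{}e] e0 H.
rewrite [ltLHS]/Num.norm /= mx_normE num_lt; apply/bigmax_ltP; split => // -[i j] _.
exact: H.
Qed.

(** * Linear forms and numerators on an exhaustion by balls *)

Section ZetaPolarModel.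
Context {R : realType}.
Local Notation C := (cplx R).
Local Notation I := (option (nat + nat)).
Local Notation zidx := (@zidx R).
Local Notation zactive := (@zactive R).
Implicit Types (s p q : cplx3 R) (n k i j l m K S r : nat) (a b c : C).

Lemma cball_point3 r a b c : nrm a < r%:R -> nrm b < r%:R -> nrm c < r%:R ->
  cball r (point3 a b c).
Proof.
move=> ar br cr; rewrite /cball /= -RtoC_lt -nrmE; apply: norm_lt_coord.
  by rewrite RtoC_lt (le_lt_trans (nrm_ge0 a)).
by move=> i j; rewrite mxE nrmE RtoC_lt; case: j => -[|[|[|]]].
Qed.

Lemma zform_line (i : I) p q (w : C) :
  zform i (q + w *: (p - q)) = zform i q + w * (zform i p - zform i q).
Proof.
have sE (j : 'I_3) : (q + w *: (p - q)) 0 j = q 0 j + w * (p 0 j - q 0 j) by rewrite !mxE.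
by case: i => [[k|l]|] /=; rewrite /tau /s1 /s2 /s3 !sE; ring.
Qed.

(** All the forms contain [s3] with coefficient [1], so this single direction shows that each has a
    nonzero differential. *)
Lemma zform_translate (i : I) p (h : C) : zform i (p + h *: point3 0 0 1) = zform i p + h.
Proof.
have sE (j : 'I_3) : (p + h *: point3 0 0 1) 0 j = p 0 j + h * point3 0 0 1 0 j.
  by rewrite !mxE.
have [e1 e2 e3] : [/\ s1 (p + h *: point3 0 0 1) = s1 p,
    s2 (p + h *: point3 0 0 1) = s2 p & s3 (p + h *: point3 0 0 1) = s3 p + h].
  split; rewrite [LHS]sE; [rewrite [point3 _ _ _ _ _]s1_point3|
    rewrite [point3 _ _ _ _ _]s2_point3|rewrite [point3 _ _ _ _ _]s3_point3];
  by rewrite ?mulr0 ?addr0 ?mulr1.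
by case: i => [[k|l]|] /=; rewrite /tau ?e1 ?e2 ?e3; ring.
Qed.

Lemma diff_line (E : normedModType C) (f : E -> C) (p v : E) (c : C) :
  differentiable f p -> (forall h : C, f (p + h *: v) = f p + h * c) -> 'd f p v = c.
Proof.
move=> df fE; rewrite -deriveE //; apply: cvg_lim; first exact: norm_hausdorff.
apply: cvg_near_cst; near=> h; have h0 : h != 0 by near: h; exact: nbhs_dnbhs_neq.
by rewrite /= [h *: v + p]addrC fE addrAC subrr add0r -[_ *: _]/(h^-1 * (h * c)) mulKf.
Unshelve. all: by end_near.
Qed.

Lemma zform_affine (i : I) : affine_form (zform i : cplx3 R -> C).
Proof.
split=> [z||p|p q w]; [exact: zform_holo| | |exact: zform_line].
- have E := zform_translate i (0 : cplx3 R) 1.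
  have [z0|?] := eqVneq (zform i (0 : cplx3 R)) 0; last by exists 0.
  by exists (0 + 1 *: point3 0 0 1); rewrite E z0 add0r oner_eq0.
- exists (point3 0 0 1); rewrite (diff_line _ _ _ _ 1 (zform_holo i p)).
    by apply/eqP; exact: oner_neq0.
  by move=> h; rewrite zform_translate mulr1.
Qed.

(** The margin [10] makes room for the base point and for the test points of the hyperplanes with
    [zlevel] equal to [S]. *)
Definition zdom S := cball (R := R) (S + 10).

(** The order [3 r + 4] required by the remainders on the ball of radius [r = S + 10]. *)
Definition zorder S := (3 * (S + 10) + 4)%N.

Lemma mem_zidx_inl K k : (Some (inl k) \in zidx K) = (bern k != 0 :> R) && (k <= K)%N.
Proof. by rewrite inE /= mem_cat mem_zidxT (negbTE (mem_zidxW_inl K k)) orbF. Qed.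

Lemma mem_zidx_inr K l : (Some (inr l) \in zidx K) = (l <= 2 * K)%N.
Proof. by rewrite inE /= mem_cat mem_zidxW (negbTE (mem_zidxT_inr K l)). Qed.

Lemma zidx_active S (i : I) : i \in zidx (zorder S) -> zactive i.
Proof. by case: i => [[k|l]|] //; rewrite mem_zidx_inl => /andP[]. Qed.

Lemma Re_gt0_neq0 a : 0 < complex.Re a -> a != 0.
Proof. by apply: contraTneq => ->; rewrite ltxx. Qed.

(** On the ball the real parts of [t] and [w] are bounded below by multiples of the radius, and an
    index beyond the order outweighs these bounds, so the form has positive real part. *)
Lemma zform_neq0 S (i : I) s : zactive i -> zdom S s -> i \notin zidx (zorder S) ->
  zform i s != 0.
Proof.
move=> ai zs; have := Re_coord _ _ 0 zs; have := Re_coord _ _ 1 zs; have := Re_coord _ _ 2 zs.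
rewrite /zorder; set r := (S + 10)%N => h3 h2 h1.
have r0 : 0 <= r%:R :> R by [].
case: i ai => [[k|l]|] //.
- rewrite mem_zidx_inl /zactive => bk; rewrite bk -ltnNge -(@ltr_nat R) natrD natrM => rk.
  apply: Re_gt0_neq0; rewrite /= /tau /s2 /s3 !ReD !ReN -RtoC_nat /=; lra.
- rewrite mem_zidx_inr => _; rewrite -ltnNge -(@ltr_nat R) natrM natrD natrM => rk.
  apply: Re_gt0_neq0; rewrite /= /s1 /s2 /s3 !ReD !ReN -!RtoC_nat /=; lra.
Qed.

Lemma zform_halfspaces (i : I) s : 4 <= complex.Re (s1 s) ->
  4 <= complex.Re (s2 s) -> 4 <= complex.Re (s3 s) -> zform i s != 0.
Proof.
move=> h1 h2 h3; apply: Re_gt0_neq0.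
have ge0 n : 0 <= n%:R :> R by [].
case: i => [[k|l]|]; rewrite /= ?/tau !ReD !ReN -?RtoC_nat /=.
- have := ge0 k; lra.
- have := ge0 l; lra.
- lra.
Qed.

Definition base_point : cplx3 R := point3 5 5 5.

Lemma base_point_dom S : zdom S base_point.
Proof.
by apply: cball_point3; rewrite nrm_nat ltr_nat; lia.
Qed.

Lemma zidx_prod_neq0 S : \prod_(i <- zidx (zorder S)) zform i base_point != 0.
Proof.
rewrite prodf_seq_neq0; apply/allP => i _; rewrite implyTb.
by apply: zform_halfspaces; rewrite point3E -RtoC_nat /= ler_nat.
Qed.

Lemma prod_zform_holo (t : seq I) s : differentiable (fun z => \prod_(i <- t) zform i z) s.
Proof. by apply: holo_prod => i _; exact: zform_holo. Qed.

Lemma Re_gt_open (f : cplx3 R -> C) (x : R) : (forall z, differentiable f z) ->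
  open [set z | x < complex.Re (f z)].
Proof.
move=> df; apply/nrm_openP => z /= xz.
have e0 : 0 < (complex.Re (f z) - x) / 2 by rewrite divr_gt0 ?subr_gt0.
have [d d0 hd] := (nrm_continuousP _ _).1 (holo_cont _ _ (df z)) _ e0.
exists d => // y /hd h /=.
by have := le_trans (ler_norm _) (Re_le_nrm (f z - f y)); rewrite ReD ReN; lra.
Qed.

(** On the part of the ball where all three real parts exceed [4] the series converges and
    [zetaZ_formula] holds; uniqueness of continuation carries the quotient over the whole ball. *)
Lemma zeta_local_form (zeta : cplx3 R -> C) S s : ez3_continuation zeta -> zdom S s ->
  exists V, [/\ open V, V s, V `<=` zdom S & mero_eq V zeta
    (fun z => znum (zorder S) z / \prod_(i <- zidx (zorder S)) zform i z)].
Proof.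
move=> [mz cz] sS.
have holoN : holomorphic (zdom S) (znum (zorder S)).
  by move=> z zS; apply: znum_holo zS; rewrite /zorder.
have oD : open (zdom S) by exact: cball_open.
have cD : convex_set (zdom S) by exact: cball_convex.
have dQ : denominator (zdom S) (fun z => \prod_(i <- zidx (zorder S)) zform i z).
  apply: (nonzero_denominator _ _ base_point oD cD) => [z _||].
  - exact: prod_zform_holo.
  - exact: base_point_dom.
  - exact: zidx_prod_neq0.
pose U := zdom S `&` ([set z | 4 < complex.Re (s1 z)] `&`
  ([set z | 4 < complex.Re (s2 z)] `&` [set z | 4 < complex.Re (s3 z)])).
have oU : open U.
  apply: openI => //; apply: openI; last apply: openI; apply: Re_gt_open.
  - exact: s1_holo.
  - exact: s2_holo.
  - exact: s3_holo.
apply: (meromorphic_continuation_unique zeta (zdom S) U _ _ base_point mz oD cD holoN dQ oU)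
  => //.
- by move=> z [].
- split; first exact: base_point_dom.
  by do ?split; rewrite /= point3E -RtoC_nat /= ltr_nat.
- move=> z [zS [/ltW h1 [/ltW h2 /ltW h3]]].
  have K0 : (0 < zorder S)%N by rewrite /zorder; lia.
  have conv : ez3_partial_sum z @ \oo --> zeta z.
    by apply/cz/ez3_abs_convergent_halfspaces; lra.
  rewrite -(zetaZ_formula _ _ _ K0 h1 h2 h3 conv) mulfK //.
  rewrite prodf_seq_neq0; apply/allP => i _; rewrite implyTb.
  exact: zform_halfspaces.
Qed.

End ZetaPolarModel.

(** * Test points and the polar model of the triple zeta function *)

Section ZetaPolarDivisor.
Context {R : realType}.
Local Notation C := (cplx R).
Local Notation I := (option (nat + nat)).
Local Notation zidx := (@zidx R).
Local Notation zactive := (@zactive R).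
Implicit Types (s p q : cplx3 R) (n k i j l m K S r : nat) (a b c : C).

Definition zlevel (i : I) : nat :=
  match i with Some (inl k) => k | Some (inr l) => l | None => 0 end.

(** Forms of the same family differ by nonzero integers. The coordinates keep the other families
    positive: [w = 10] and [s3 = 5] on [t = 2 - k], [t = s3 = 5] on [w = 3 - l], and [t = 6],
    [w = 11] on [s3 = 1]. *)
Lemma zform_generic (i : I) : exists2 q, zform i q = 0 :> C &
  (forall j : I, j != i -> zform j q != 0) /\
  zdom (zlevel i) q.
Proof.
have nz n (x : C) : x = n.+1%:R -> x != 0 by move=> ->; rewrite pnatr_eq0.
have nzB n m (x : C) : n != m -> x = n%:R - m%:R -> x != 0.
  by move=> nm ->; rewrite subr_eq0 eqr_nat.
case: i => [[k|l]|]; rewrite /zlevel.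
- exists (point3 (8 + k)%:R (- (3 + k)%:R) 5); first by rewrite /= /tau !point3E !natrD; ring.
  split; last by apply: cball_point3;
    rewrite ?nrmN ?nrm1 ?nrm0 ?nrm_nat ?ltr_nat ?ltr1n ?ltr0n; lia.
  case=> [[k'|l']|] /= ne; rewrite /tau !point3E ?natrD.
  + apply: (nzB k' k); last by ring.
    by apply: contraNneq ne => ->.
  + by apply: (nz (6 + l')%N); rewrite -addSn natrD; ring.
  + by apply: (nz 3%N); ring.
- exists (point3 (- (2 + l)%:R) 0 5); first by rewrite /= !point3E !natrD; ring.
  split; last by apply: cball_point3;
    rewrite ?nrmN ?nrm1 ?nrm0 ?nrm_nat ?ltr_nat ?ltr1n ?ltr0n; lia.
  case=> [[k'|l']|] /= ne; rewrite /tau !point3E ?natrD.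
  + by apply: (nz (2 + k')%N); rewrite -addSn natrD; ring.
  + apply: (nzB l' l); last by ring.
    by apply: contraNneq ne => ->.
  + by apply: (nz 3%N); ring.
- exists (point3 5 5 1); first by rewrite /= !point3E subrr.
  split; last by apply: cball_point3;
    rewrite ?nrmN ?nrm1 ?nrm0 ?nrm_nat ?ltr_nat ?ltr1n ?ltr0n.
  case=> [[k'|l']|] //= _; rewrite /tau !point3E.
  + by apply: (nz (3 + k')%N); rewrite -addSn natrD; ring.
  + by apply: (nz (7 + l')%N); rewrite -addSn natrD; ring.
Qed.

Lemma znum_generic (i : I) : zactive i ->
  i \in zidx (zorder (zlevel i)) /\
  exists p, [/\ zdom (zlevel i) p, zform i p = 0 & znum (zorder (zlevel i)) p != 0].
Proof.
have kK S : (S <= zorder S)%N by rewrite /zorder; lia.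
case: i => [[k|l]|] ai; rewrite /zlevel.
- split; first by rewrite mem_zidx_inl kK andbT.
  exists (point3 1 (- k%:R) 2); split; last exact: znum_neq0T.
    by apply: cball_point3;
    rewrite ?nrmN ?nrm1 ?nrm0 ?nrm_nat ?ltr_nat ?ltr1n ?ltr0n; lia.
  by rewrite /= /tau !point3E; ring.
- split; first by rewrite mem_zidx_inr /zorder; lia.
  have [b0|b0] := eqVneq (bern l : R) 0; last first.
    exists (point3 1 (- l%:R) 2); split; last exact: znum_neq0T.
      by apply: cball_point3;
    rewrite ?nrmN ?nrm1 ?nrm0 ?nrm_nat ?ltr_nat ?ltr1n ?ltr0n; lia.
    by rewrite /= !point3E; ring.
  have [m lE] : exists m, l = m.*2.+3.
    have : ~ (l = 1%N \/ ~~ odd l) by move/(@bern_neq0 R); rewrite b0 eqxx.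
    move=> h; exists l./2.-1; have := odd_double_half l; case: (odd l) h => [h|[]]; last by right.
    by case: (l./2) => [|x /= <-]; [move=> E; case: h; left|rewrite doubleS].
  rewrite lE; exists (point3 (- m.*2.+3%:R) 1 2); split; last exact: znum_neq0W.
    by apply: cball_point3;
    rewrite ?nrmN ?nrm1 ?nrm0 ?nrm_nat ?ltr_nat ?ltr1n ?ltr0n; lia.
  by rewrite /= !point3E; ring.
- split; first by rewrite inE eqxx.
  exists (point3 1 1 1); split; last exact: znum_neq0S.
    by apply: cball_point3;
    rewrite ?nrmN ?nrm1 ?nrm0 ?nrm_nat ?ltr_nat ?ltr1n ?ltr0n.
  by rewrite /= !point3E subrr.
Qed.

Lemma zdom_cover (N : nat) s : exists2 S, (N <= S)%N & zdom S s.
Proof.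
exists (N + Num.bound (nrm s))%N; first exact: leq_addr.
rewrite /zdom /cball /= (lt_le_trans (archi_boundP (nrm_ge0 s))) // ler_nat; lia.
Qed.

(** Kept transparent, so that [form] and [active] of this model compute to [zform] and [zactive] in
    the theorem. *)
Definition zeta_polar_model (zeta : cplx3 R -> C) (h : ez3_continuation zeta) :
  polar_model zeta I.
Proof.
refine (PolarModel zeta I zform zactive zdom (fun S => zidx (zorder S))
  (fun S => znum (zorder S)) zform_affine _ _ _ zidx_active zform_neq0 _ _ _ _ _).
- by move=> S; exact: cball_open.
- by move=> S; exact: cball_convex.
- by move=> S; exact: zidx_uniq.
- by move=> z; have [S _ Sz] := zdom_cover 0 z; exists S.
- move=> z [[k|l]|] ai.
  + have [S kS Sz] := zdom_cover k z; exists S => //.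
    by rewrite mem_zidx_inl (ai : bern k != 0) /zorder; lia.
  + have [S lS Sz] := zdom_cover l z; exists S => //.
    by rewrite mem_zidx_inr /zorder; lia.
  + by have [S _ Sz] := zdom_cover 0 z; exists S => //; rewrite inE eqxx.
- by move=> S z zS; apply: znum_holo zS; rewrite /zorder.
- by move=> S z; exact: zeta_local_form.
- move=> i ai; have [iS [p [pS p0 np]]] := znum_generic i ai.
  have [q q0 [gq qS]] := zform_generic i.
  exists (zlevel i), p, q.
  by split=> // j _; exact: gq.
Defined.

Lemma zero_set_eq (f g : cplx3 R -> C) c : (forall s, f s = g s - c) ->
  [set s | f s = 0] = [set s | g s = c].
Proof.
move=> fg; apply/funext => s; apply/propext; rewrite /= fg.
by split=> [/subr0_eq|->] //; rewrite subrr.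
Qed.

End ZetaPolarDivisor.

(** * The singular hyperplanes of the triple zeta function *)

Theorem theorem7p4 (R : realType) (zeta : cplx3 R -> cplx R)
    (hzeta : ez3_continuation zeta) :
  (forall Z : set (cplx3 R),
     polar_component zeta Z <->
     [\/ Z = [set s | s3 s = 1],
         exists2 k : int,
           k = 2 \/ k = 1 \/ (exists m : nat, k = - (2 * m%:Z))
           & Z = [set s | s2 s + s3 s = k%:~R]
       | exists2 k : int, k <= 3
           & Z = [set s | s1 s + s2 s + s3 s = k%:~R]]) /\
  (forall Z : set (cplx3 R), polar_component zeta Z -> generically_simple zeta Z).
Proof.
pose M := zeta_polar_model zeta hzeta; split => Z; last first.
  by move=> /(polar_components _ _ M)[i ai ->]; exact: hyperplane_generically_simple.
have HS : hyperplane _ _ M None = [set s | s3 s = 1] by exact: zero_set_eq.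
have HT k : hyperplane _ _ M (Some (inl k)) = [set s | s2 s + s3 s = (2 - k%:Z)%:~R].
  by apply: zero_set_eq => s; rewrite /= /tau rmorphB /=; ring.
have HW l : hyperplane _ _ M (Some (inr l)) = [set s | s1 s + s2 s + s3 s = (3 - l%:Z)%:~R].
  by apply: zero_set_eq => s; rewrite /= rmorphB /=; ring.
have aT k : active _ _ M (Some (inl k)) <-> k = 1%N \/ ~~ odd k by exact: (@bern_neq0 R).
apply: (iff_trans (polar_components _ _ M Z)); split.
- case=> -[[k|l]|] ai ->.
  + rewrite HT; apply: Or32; exists (2 - k%:Z) => //.
    case: ((aT k).1 ai) => [->|ek]; first by right; left.
    have := odd_double_half k; rewrite (negbTE ek) add0n; case: (k./2) => [|m] <-.
      by left.
    by right; right; exists m; lia.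
  + by rewrite HW; apply: Or33; exists (3 - l%:Z) => //; lia.
  + by rewrite HS; apply: Or31.
- case=> [->|[k kE ->]|[k k3 ->]].
  + by exists None.
  + case: kE => [->|[->|[m ->]]].
    * by exists (Some (inl 0%N)); [apply/aT; right|rewrite HT].
    * by exists (Some (inl 1%N)); [apply/aT; left|rewrite HT].
    * exists (Some (inl m.+1.*2)); first by apply/aT; right; rewrite odd_double.
      by rewrite HT (_ : 2 - m.+1.*2%:Z = - (2 * m%:Z)) //; lia.
  + exists (Some (inr `|3 - k|%N)) => //.
    by rewrite HW gez0_abs ?subr_ge0 // opprB addrC subrK.
Qed.
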